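(* Let $u\in L^2(S)$. Then $$\|T(t)u-\overline{(u)}_S\|_{L^1(S)}\le C_{S,1}\,\Gamma_{0,p}\,\|u-\overline{(u)}_S\|_{L^2(S)}^{2/p}\left(\frac1t\right)^{1/p}$$ for every $t\in(0,\infty)$, where $\Gamma_{0,p}:=\left(\int_S\gamma^{\frac{1}{1-p}}\,d\lambda\right)^{\frac{p-1}{p}}\left(\frac{2}{|p-2|}\right)^{1/p}$.
   Context: Setting. Let $n\in\mathbb{N}$, $n\ge 2$; let $\emptyset\ne S\subseteq\mathbb{R}^n$ be open, connected, bounded and of class $C^1$; let $p\in(1,\infty)\setminus\{2\}$. Let $\lambda$ be Lebesgue measure and $|\cdot|$ the Euclidean norm. Let $\gamma:S\to(0,\infty)$ satisfy $\gamma\in L^\infty(S)$, $\gamma^{1/(1-p)}\in L^1(S)$, and assume there is a Muckenhoupt weight $\gamma_0\in A_p(\mathbb{R}^n)$ with $\gamma_0|_S=\gamma$ a.e. on $S$. Here $A_p(\mathbb{R}^n)$ is the set of $\gamma_0:\mathbb{R}^n\to\mathbb{R}$ with $\gamma_0>0$ a.e., $\gamma_0\in L^1_{\mathrm{loc}}(\mathbb{R}^n)$ and $\sup_B \frac{1}{\lambda(B)}\int_B\gamma_0\,d\lambda\left(\frac{1}{\lambda(B)}\int_B\gamma_0^{1/(1-p)}d\lambda\right)^{p-1}<\infty$, the supremum over all balls $B\subseteq\mathbb{R}^n$. Let $\nu(B):=\int_B\gamma\,d\lambda$ and $W^{1,p}_\gamma(S):=\{f\in L^p(S): f \text{ weakly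 differentiable},\ \nabla f\in L^p(S,\nu;\mathbb{R}^n)\}$. Truncation and generalized gradient. For $k>0$, $\tau_k(s):=s$ if $|s|<k$ and $\tau_k(s):=k\,\mathrm{sign}(s)$ if $|s|\ge k$. If $f:S\to\mathbb{R}$ is measurable with $\tau_k(f)\in W^{1,1}_{\mathrm{loc}}(S)$ for all $k>0$, then $\tilde\nabla f:S\to\mathbb{R}^n$ is the a.e. unique function with $\nabla\tau_k(f)=\tilde\nabla f\,\mathbf{1}_{\{|f|<k\}}$ a.e. for all $k>0$. Operators (identified with their graphs). $A\subseteq L^1(S)\times L^1(S)$: $(f,\hat f)\in A$ iff $f\in W^{1,p}_\gamma(S)\cap L^\infty(S)$, $\hat f\in L^1(S)$ and $\int_S\gamma|\nabla f|^{p-2}\nabla f\cdot\nabla\varphi\,d\lambda=\int_S\hat f\varphi\,d\lambda$ for all $\varphi\in W^{1,p}_\gamma(S)\cap L^\infty(S)$. $\mathcal{A}\subseteq L^1(S)\times L^1(S)$: $(f,\hat f)\in\mathcal{A}$ iff $f,\hat f\in L^1(S)$, $\tau_k(f)\in W^{1,p}_\gamma(S)$ for all $k>0$, and $\int_S\gamma|\tilde\nabla f|^{p-2}\tilde\nabla f\cdot\nabla(\tau_k(f-\varphi))\,d\lambda\le\int_S\hat f\,\tau_k(f-\varphi)\,d\lambda$ for all $k>0$ and $\varphi\in W^{1,p}_\gamma(S)\cap L^\infty(S)$. Semigroup. It is known (prior work) that $\mathcal{A}$ is completely accretive, m-accretive in $L^1(S)$ and the closure of $A$, that $D(A)$ is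 dense in $L^1(S)$, and that for each $u\in L^1(S)$ there is a unique strong solution (which is also the unique mild solution) $T(\cdot)u\in C([0,\infty);L^1(S))\cap W^{1,1}_{\mathrm{loc}}((0,\infty);L^1(S))$ of $0\in T'(t)u+\mathcal{A}T(t)u$, $T(t)u\in D(\mathcal{A})$ for a.e. $t>0$, $T(0)u=u$. Here $W^{1,1}_{\mathrm{loc}}((0,\infty);X)$ denotes the locally absolutely continuous, a.e. differentiable functions $(0,\infty)\to X$, and $T'(t)u$ is the a.e. derivative of $T(\cdot)u$. $(T(t))_{t\ge0}$ is this semigroup. (Complete accretivity of $\mathcal{A}$ means: for all $(f,\hat f),(h,\hat h)\in\mathcal{A}$, $\alpha>0$ and all convex lower semicontinuous $j:\mathbb{R}\to[0,\infty]$ with $j(0)=0$, $\int_S j(f-h)d\lambda\le\int_S j(f-h+\alpha(\hat f-\hat h))d\lambda$.) Further notation. $\overline{(u)}_S:=\frac{1}{\lambda(S)}\int_S u\,d\lambda$ (also viewed as a constant function). $C_{S,1}\in(0,\infty)$ is the Poincaré constant: the smallest constant with $\|f-\overline{(f)}_S\|_{L^1(S)}\le C_{S,1}\|\nabla f\|_{L^1(S;\mathbb{R}^n)}$ for all $f\in W^{1,1}(S)$. *)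

(* Defs.v *)
From HB Require Import structures.
From mathcomp Require Import all_boot all_order all_algebra.
From mathcomp Require Import all_classical all_reals all_analysis.

Set Implicit Arguments.
Unset Strict Implicit.
Unset Printing Implicit Defensive.

Import Order.TTheory GRing.Theory Num.Theory.
Import numFieldNormedType.Exports.

Local Open Scope classical_set_scope.
Local Open Scope ring_scope.

Definition rV_display : measure_display.
Proof. exact: default_measure_display. Qed.

(* R^n is ['rV[R]_n]: its topology is the library's (induced by the sup norm),
   and its sigma-algebra is generated by the coordinate maps, i.e. it is the
   Borel sigma-algebra. *)
Section measurable_rV.
Context {R : realType} (n : nat).

Definition rV_coord (i : 'I_n) (x : 'rV[R]_n) : measurableTypeR R := x ord0 i.

Let rV_set0 : g_sigma_preimage rV_coord set0.
Proof. exact: sigma_algebra0. Qed.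

Let rV_setC A : g_sigma_preimage rV_coord A -> g_sigma_preimage rV_coord (~` A).
Proof. exact: sigma_algebraC. Qed.

Let rV_bigcup (F : _^nat) : (forall i, g_sigma_preimage rV_coord (F i)) ->
  g_sigma_preimage rV_coord (\bigcup_i (F i)).
Proof. exact: sigma_algebra_bigcup. Qed.

HB.instance Definition _ := @isMeasurable.Build rV_display
  'rV[R]_n (g_sigma_preimage rV_coord) rV_set0 rV_setC rV_bigcup.

End measurable_rV.

Section lebesgue_rV_step.
Context {R : realType} (n : nat).
Variable m : {sigma_finite_measure set 'rV[R]_n -> \bar R}.

Definition rV_cons (z : measurableTypeR R * 'rV[R]_n) : 'rV[R]_n.+1 :=
  row_mx (\row_(_ < 1) z.1) z.2.

Lemma rV_cons0 z : rV_cons z ord0 ord0 = z.1.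
Proof.
rewrite /rV_cons (_ : ord0 = lshift n (ord0 : 'I_1)); last exact/val_inj.
by rewrite (row_mxEl (\row_(_ < 1) z.1)) mxE.
Qed.

Lemma rV_consS z i : rV_cons z ord0 (lift ord0 i) = z.2 ord0 i.
Proof.
rewrite /rV_cons (_ : lift ord0 i = rshift 1 i); last exact/val_inj.
by rewrite (row_mxEr (\row_(_ < 1) z.1)).
Qed.

Lemma measurable_rV_coord k (i : 'I_k) :
  measurable_fun [set: 'rV[R]_k] (@rV_coord R k i).
Proof.
move=> _ Y mY; rewrite setTI; apply: sub_sigma_algebra => /=.
rewrite -bigcup_seq/=; exists i => /=; first by rewrite mem_index_enum.
by exists Y => //; rewrite setTI.
Qed.

Lemma measurable_fun_rVP d (T : measurableType d) k (f : T -> 'rV[R]_k) :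
  (forall i, measurable_fun [set: T] (@rV_coord R k i \o f)) ->
  measurable_fun [set: T] f.
Proof.
move=> mf.
apply: (@measurability _ _ _ _ _ _
  (\big[setU/set0]_(i < k)
     preimage_set_system setT (@rV_coord R k i) measurable)) => //.
move=> _ [B + <-]; rewrite -bigcup_seq/= => -[i _ [C mC <-]].
rewrite setTI setTI.
by have := mf i measurableT _ mC; rewrite setTI.
Qed.

Lemma measurable_rV_cons : measurable_fun [set: _] rV_cons.
Proof.
apply: measurable_fun_rVP => i.
have [->|] := eqVneq i ord0.
  by apply: (eq_measurable_fun fst) => // z _; rewrite /= /rV_coord rV_cons0.
rewrite -(inj_eq val_inj) /= -lt0n => i0.
have im : (i.-1 < n)%N by rewrite -ltnS prednK.
have iE : i = lift ord0 (Ordinal im).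
  by apply/val_inj; rewrite /= /bump /= add1n prednK.
apply: (eq_measurable_fun (@rV_coord R n (Ordinal im) \o snd)).
  by move=> z _; rewrite /= /rV_coord {2}iE rV_consS.
exact: measurableT_comp (measurable_rV_coord _) measurable_snd.
Qed.

Definition rV_uncons (x : 'rV[R]_n.+1) : measurableTypeR R * 'rV[R]_n :=
  (x ord0 ord0, \row_i x ord0 (lift ord0 i)).

Lemma rV_consK : cancel rV_cons rV_uncons.
Proof.
move=> z; rewrite /rV_uncons rV_cons0 [RHS]surjective_pairing; congr pair.
by apply/rowP => i; rewrite mxE rV_consS.
Qed.

Lemma measurable_rV_uncons : measurable_fun [set: _] rV_uncons.
Proof.
apply/measurable_fun_pairP; split; first exact: measurable_rV_coord.
apply: measurable_fun_rVP => i.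
apply: (eq_measurable_fun (@rV_coord R n.+1 (lift ord0 i))).
  by move=> x _; rewrite /= /rV_coord mxE.
exact: measurable_rV_coord.
Qed.

Definition lebesgue_rV_step : set 'rV[R]_n.+1 -> \bar R :=
  pushforward (lebesgue_measure \x m)%E rV_cons.

Let step0 : lebesgue_rV_step set0 = 0%E.
Proof. by rewrite /lebesgue_rV_step /pushforward preimage_set0 measure0. Qed.

Let step_ge0 A : (0 <= lebesgue_rV_step A)%E.
Proof. by rewrite /lebesgue_rV_step /pushforward measure_ge0. Qed.

Let step_sigma_additive : semi_sigma_additive lebesgue_rV_step.
Proof.
move=> F mF tF mUF; rewrite /lebesgue_rV_step /pushforward preimage_bigcup.
have mpre A : measurable A -> measurable (rV_cons @^-1` A).
  by move=> mA; rewrite -[X in measurable X]setTI; exact: measurable_rV_cons.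
apply: measure_semi_sigma_additive => //.
- by move=> i; exact: mpre.
- apply/trivIsetP => /= i j _ _ ij; rewrite -preimage_setI.
  by move/trivIsetP : tF => /(_ _ _ _ _ ij) ->//; rewrite preimage_set0.
- by rewrite -preimage_bigcup; exact: mpre.
Qed.

HB.instance Definition _ := isMeasure.Build _ _ _ lebesgue_rV_step
  step0 step_ge0 step_sigma_additive.

Let step_sigma_finite : sigma_finite setT lebesgue_rV_step.
Proof.
have /sigma_finiteP[F [TF ndF Foo]] := sigma_finiteT (@lebesgue_measure R).
have /sigma_finiteP[G [TG ndG Goo]] := sigma_finiteT m.
exists (fun k => rV_uncons @^-1` (F k `*` G k)).
  rewrite -preimage_bigcup [X in _ @^-1` X](_ : _ = setT) ?preimage_setT//.
  rewrite -setXTT TF TG predeqE => -[x y]; split.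
    by move=> [k _ []/= ? ?]; split; exists k.
  move=> [/= [i _ Fix] [k _ Gky]]; exists (maxn i k) => //; split.
  - by move: x Fix; exact/subsetPset/ndF/leq_maxl.
  - by move: y Gky; exact/subsetPset/ndG/leq_maxr.
move=> k; have [? ?] := Foo k; have [? ?] := Goo k; split.
  rewrite -[X in measurable X]setTI; apply: measurable_rV_uncons => //.
  exact: measurableX.
rewrite /lebesgue_rV_step /pushforward -comp_preimage.
rewrite (_ : rV_uncons \o rV_cons = id); last first.
  by apply/funext => z /=; rewrite rV_consK.
by rewrite preimage_id product_measure1E// lte_mul_pinfty// ge0_fin_numE.
Qed.

HB.instance Definition _ := Measure_isSigmaFinite.Build _ _ _ lebesgue_rV_step
  step_sigma_finite.

End lebesgue_rV_step.

(* n-dimensional Lebesgue measure: the point mass on R^0, and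
   lambda_(n+1) = lambda_1 \x lambda_n under R^(n+1) = R * R^n. *)
Fixpoint lebesgue_rV {R : realType} (n : nat) :
    {sigma_finite_measure set 'rV[R]_n -> \bar R} :=
  match n with
  | 0 => \d_(0 : 'rV[R]_0)
  | n'.+1 => lebesgue_rV_step (lebesgue_rV n')
  end.

Section euclidean.
Context {R : realType} {n : nat}.
Implicit Types x y : 'rV[R]_n.

Definition dotv x y : R := \sum_(i < n) x ord0 i * y ord0 i.

(* The library norm on ['rV[R]_n] is the sup norm. *)
Definition enorm x : R := Num.sqrt (dotv x x).

Definition eball x (r : R) : set 'rV[R]_n := [set y | enorm (y - x) < r].

Definition basis_vec (i : 'I_n) : 'rV[R]_n := delta_mx ord0 i.

End euclidean.

Definition C1_fun {R : realType} {n : nat} (g : 'rV[R]_n -> R) : Prop :=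
  continuous g /\
  forall i : 'I_n, (forall x, derivable g x (basis_vec i)) /\
                   continuous ('D_(basis_vec i) g).

(* Near each boundary point, S is the region on one side of the graph of a C^1
   function of n - 1 of the coordinates: [i] is the remaining coordinate, [b]
   tells on which side, and [col' i x] is [x] with that coordinate removed. *)
Definition C1_domain {R : realType} {n : nat} (S : set 'rV[R]_n) : Prop :=
  forall x0, (closure S `\` S^°) x0 ->
  exists (r : R) (i : 'I_n) (b : bool) (g : 'rV[R]_n.-1 -> R),
    [/\ 0 < r, C1_fun g &
        forall x, eball x0 r x ->
          (S x <-> g (col' i x) < (-1) ^+ b * x ord0 i)].

Section spaces.
Context {R : realType} {n : nat}.
Variable S : set 'rV[R]_n.
Local Notation E := 'rV[R]_n.
Local Notation mu := (lebesgue_rV n).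
Implicit Types (f g phi : E -> R) (G : E -> E) (p : \bar R).

(* Functions on S are represented by functions on R^n whose values outside S
   are ignored, and elements of Lebesgue spaces by their representatives. *)
Definition LnormS p f : \bar R := 'N[mu]_p[(EFin \o f) \_ S].

Definition inLp p f : Prop := measurable_fun S f /\ (LnormS p f < +oo)%E.

Definition inLp_vec p G : Prop :=
  measurable_fun S G /\ (LnormS p (enorm \o G) < +oo)%E.

Definition inL1loc f : Prop :=
  measurable_fun S f /\
  forall K, compact K -> K `<=` S -> (\int[mu]_(x in K) `|f x|%:E < +oo)%E.

Definition inL1loc_vec G : Prop :=
  measurable_fun S G /\
  forall K, compact K -> K `<=` S -> (\int[mu]_(x in K) (enorm (G x))%:E < +oo)%E.

Definition mean f : R := (fine (mu S))^-1 * \int[mu]_(x in S) f x.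

Definition iter_partial (s : seq 'I_n) f : E -> R :=
  foldr (fun i h => 'D_(basis_vec i) h) f s.

Definition smooth f : Prop :=
  forall s : seq 'I_n,
    continuous (iter_partial s f) /\
    forall i x, derivable (iter_partial s f) x (basis_vec i).

Definition test_function phi : Prop :=
  [/\ smooth phi, compact (closure [set x | phi x != 0]) &
      closure [set x | phi x != 0] `<=` S].

Definition is_weak_gradient f G : Prop :=
  [/\ inL1loc f, inL1loc_vec G &
      forall phi, test_function phi -> forall i : 'I_n,
        \int[mu]_(x in S) (f x * 'D_(basis_vec i) phi x) =
        - \int[mu]_(x in S) (G x ord0 i * phi x)].

(* This is also membership in W^{1,1}_loc(S). *)
Definition weakly_differentiable f : Prop := exists G, is_weak_gradient f G.

(* The weak gradient is unique up to a null set: this picks one representative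
   (0 when f is not weakly differentiable). *)
Definition wgrad f : E -> E := xget (cst 0) [set G | is_weak_gradient f G].

Definition inW11 f : Prop :=
  [/\ inLp 1 f, weakly_differentiable f & inLp_vec 1 (wgrad f)].

Definition poincare_ineq (C : R) : Prop :=
  forall f, inW11 f ->
    (LnormS 1 (fun x => f x - mean f)%R <= C%:E * LnormS 1 (enorm \o wgrad f))%E.

Definition poincare_constant (C : R) : Prop :=
  [/\ 0 < C, poincare_ineq C & forall C', poincare_ineq C' -> C <= C'].

Definition trunc (k s : R) : R := if `|s| < k then s else k * Num.sg s.

Definition is_gen_gradient f G : Prop :=
  measurable_fun S G /\
  forall k, 0 < k ->
    {ae mu, forall x, S x ->
       wgrad (trunc k \o f) x = if `|f x| < k then G x else 0}.

Definition ggrad f : E -> E := xget (cst 0) [set G | is_gen_gradient f G].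

Section operators.
Variables (q : R) (gamma : E -> R).

(* With nu = gamma lambda, the last condition reads: the weak gradient is in
   L^q(S, nu; R^n). *)
Definition inWweighted f : Prop :=
  [/\ inLp q%:E f, weakly_differentiable f &
      (\int[mu]_(x in S) (gamma x * enorm (wgrad f x) `^ q)%:E < +oo)%E].

Definition inWbounded f : Prop := inWweighted f /\ inLp +oo f.

(* gamma |xi|^(q-2) xi, where |0|^(q-2) 0 = 0 also for q < 2. *)
Definition flux (G : E -> E) (x : E) : E :=
  (gamma x * enorm (G x) `^ (q - 2)) *: G x.

Definition opA f fhat : Prop :=
  [/\ inWbounded f, inLp 1 fhat &
      forall phi, inWbounded phi ->
        \int[mu]_(x in S) dotv (flux (wgrad f) x) (wgrad phi x) =
        \int[mu]_(x in S) (fhat x * phi x)].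

Definition opAcal f fhat : Prop :=
  [/\ inLp 1 f, inLp 1 fhat,
      forall k, 0 < k -> inWweighted (trunc k \o f) &
      forall k phi, 0 < k -> inWbounded phi ->
        \int[mu]_(x in S)
          dotv (flux (ggrad f) x) (wgrad (fun y => trunc k (f y - phi y)) x) <=
        \int[mu]_(x in S) (fhat x * trunc k (f x - phi x))].

End operators.

Definition convex_ereal (j : R -> \bar R) : Prop :=
  forall x y t, 0 <= t <= 1 ->
    (j (t * x + (1 - t) * y)%R <= t%:E * j x + (1 - t)%:E * j y)%E.

Section graphs.
Variable B : (E -> R) -> (E -> R) -> Prop.

Definition completely_accretive : Prop :=
  forall f fhat h hhat (alpha : R) (j : R -> \bar R),
    B f fhat -> B h hhat -> 0 < alpha ->
    (forall s, (0 <= j s)%E) -> j 0 = 0%E ->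
    convex_ereal j -> lower_semicontinuous j ->
    (\int[mu]_(x in S) j (f x - h x)%R <=
     \int[mu]_(x in S) j (f x - h x + alpha * (fhat x - hhat x))%R)%E.

Definition m_accretive : Prop :=
  (forall f fhat h hhat (alpha : R),
     B f fhat -> B h hhat -> 0 < alpha ->
     (LnormS 1 (fun x => f x - h x)%R <=
      LnormS 1 (fun x => f x - h x + alpha * (fhat x - hhat x))%R)%E) /\
  (forall (alpha : R) g, 0 < alpha -> inLp 1 g ->
     exists f fhat, B f fhat /\
       {ae mu, forall x, S x -> f x + alpha * fhat x = g x}).

Definition dense_domain : Prop :=
  forall u (e : R), inLp 1 u -> 0 < e ->
    exists f fhat, B f fhat /\ (LnormS 1 (fun x => u x - f x)%R < e%:E)%E.

Definition graph_closure f fhat : Prop :=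
  [/\ inLp 1 f, inLp 1 fhat &
      forall e : R, 0 < e -> exists h hhat,
        [/\ B h hhat, (LnormS 1 (fun x => f x - h x)%R < e%:E)%E &
            (LnormS 1 (fun x => fhat x - hhat x)%R < e%:E)%E]].

End graphs.

Implicit Type v : R -> E -> R.

Definition L1_continuous v : Prop :=
  forall t (e : R), 0 <= t -> 0 < e -> exists2 d : R, 0 < d &
    forall s, 0 <= s -> `|s - t| < d ->
      (LnormS 1 (fun x => v s x - v t x)%R < e%:E)%E.

Definition L1_locally_abs_continuous v : Prop :=
  forall a b (e : R), 0 < a -> a <= b -> 0 < e -> exists2 d : R, 0 < d &
    forall m (s t : 'I_m -> R),
      (forall i, [/\ a <= s i, s i <= t i & t i <= b]) ->
      (forall i j, i != j -> t i <= s j \/ t j <= s i) ->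
      \sum_(i < m) (t i - s i) < d ->
      (\sum_(i < m) LnormS 1 (fun x => v (t i) x - v (s i) x)%R < e%:E)%E.

Definition L1_derivative v (t : R) (w : E -> R) : Prop :=
  inLp 1 w /\
  forall e : R, 0 < e -> exists2 d : R, 0 < d &
    forall h, h != 0 -> `|h| < d ->
      (LnormS 1 (fun x => h^-1 * (v (t + h) x - v t x) - w x)%R < e%:E)%E.

(* Strong solutions of 0 \in v'(t) + B v(t), v(0) = u. Their a.e.
   differentiability on (0, oo) is part of the fourth condition. *)
Definition strong_solution (B : (E -> R) -> (E -> R) -> Prop) u v : Prop :=
  [/\ forall t, 0 <= t -> inLp 1 (v t),
      L1_continuous v,
      L1_locally_abs_continuous v,
      {ae (@lebesgue_measure R), forall t : R, 0 < t ->
         exists2 w, L1_derivative v t w & B (v t) (fun x => - w x)} &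
      {ae mu, forall x, S x -> v 0 x = u x}].

Definition semigroup_of (B : (E -> R) -> (E -> R) -> Prop)
    (T : R -> (E -> R) -> E -> R) : Prop :=
  forall u, inLp 1 u ->
    strong_solution B u (fun t => T t u) /\
    forall v, strong_solution B u v ->
      forall t, 0 <= t -> {ae mu, forall x, S x -> v t x = T t u x}.

End spaces.

Definition muckenhoupt {R : realType} {n : nat} (p : R) (w : 'rV[R]_n -> R) :
    Prop :=
  let mu := lebesgue_rV n in
  let avg (B : set 'rV[R]_n) (h : 'rV[R]_n -> R) : \bar R :=
    ((fine (mu B))^-1%:E * \int[mu]_(x in B) (h x)%:E)%E in
  [/\ {ae mu, forall x, 0 < w x}, inL1loc [set: 'rV[R]_n] w &
      (ereal_sup [set z | exists (x : 'rV[R]_n) (r : R), (0 < r)%R /\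
         z = avg (eball x r) w *
             (avg (eball x r) (fun y => w y `^ (1 / (1 - p)))%R) `^ (p - 1)]
       < +oo)%E].

Definition Gamma0 {R : realType} {n : nat} (S : set 'rV[R]_n) (p : R)
    (gamma : 'rV[R]_n -> R) : \bar R :=
  ((\int[lebesgue_rV n]_(x in S) (gamma x `^ (1 / (1 - p)))%:E)
     `^ ((p - 1) / p) *
   ((2 / `|p - 2|) `^ (1 / p))%:E)%E.

(* Main.v *)
(* Let c be the mean of u, v(t) = T(t)u and a = |u - c|_2.  The operator is homogeneous of degree
   p - 1 and ignores constants, so c + l (v(l^(p-2) t) - c) is a strong solution for every l > 0.
   Complete accretivity makes |v - w|_2 nonincreasing along strong solutions v, w; comparing v with
   its rescaled copies gives |v(t) - v(l^(p-2) t)|_2 <= 2 |l - 1| a, hence, as l tends to 1,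
   - int v'(t) psi <= 2 / (|p - 2| t) a |psi|_2 for bounded psi (Benilan-Crandall).  Testing the
   equation with phi = 0 bounds the energy int gamma |grad tau_k v(t)|^p by
   - int v'(t) tau_k v(t) = - int v'(t) (tau_k v(t) - c) <= 2 / (|p - 2| t) a^2, as int v'(t) = 0.
   Hoelder's inequality with weight gamma and the Poincare inequality in W^(1,1), applied to
   tau_k v(t), conclude as k tends to infinity.

   That the generalized gradient exists rests on the locality of weak gradients: grad f = 0 almost
   everywhere on {f = 0}.  If f vanishes at z and at z + h e, then the integral of d_e f over the
   segment between them is 0; almost every z in {f = 0} has such returns with h -> 0, and then
   Lebesgue differentiation along the line gives d_e f (z) = 0. *)

Require Import Defs.
From mathcomp Require Import all_boot all_order all_algebra.
From mathcomp Require Import all_classical all_reals all_analysis.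
From mathcomp Require Import measurable_realfun ess_sup_inf ring lra.

Set Implicit Arguments.
Unset Strict Implicit.
Unset Printing Implicit Defensive.

Import Order.TTheory GRing.Theory Num.Theory.
Import numFieldNormedType.Exports.

Local Open Scope classical_set_scope.
Local Open Scope ring_scope.

(** Solutions are differentiable only at almost every time, and only in [L^1], where the integral of
    the square is not continuous. Contraction is therefore proved for Lipschitz convex functions
    increasing to the square; their integrals are absolutely continuous in time with a one-sided
    bound almost everywhere, and a covering argument makes them monotone. The factor 2 counts two
    terms: with [b = l^(p-2)], the increment [v(b t) - v(t)] is minus the defect
    [v(t) - (c + l (v(b t) - c))], whose norm is at most its initial value [|1 - l| a], plus
    [(1 - l) (v(b t) - c)], bounded likewise. The time step is [(b - 1) t], and [b - 1] behaves like
    [(p - 2) (l - 1)]; this is where [|p - 2|] enters. Scaling is proved for [A] and carried to its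
    closure by [L^1] limits. Truncation levels are taken above [|c|], so that [tau_k] fixes [c] and
    [|tau_k v - c| <= |v - c|]. The estimate holds first at almost every time; [L^1] continuity
    extends it to every time, since the bound decreases in [t]. *)

Lemma ae_forall_count d (T : measurableType d) (R : realType)
    (mu : {measure set T -> \bar R}) (I : countType) (P : I -> T -> Prop) :
  (forall i, {ae mu, forall x, P i x}) -> {ae mu, forall x, forall i, P i x}.
Proof.
move=> h.
have : {ae mu, forall x, forall m : nat, if unpickle m is Some i then P i x else True}.
  by apply/ae_foralln => m; case: unpickle => [i|]; [exact: h|exact: aeW].
by apply: filterS => x hx i; have := hx (pickle i); rewrite pickleK.
Qed.

(** * Lebesgue measure on row vectors *)

Section rV_measure.
Context {R : realType}.
Local Notation leb n := (@lebesgue_rV R n).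

Lemma ball_rVE n (c : 'rV[R]_n) r : 0 < r ->
  ball c r = [set y | forall i, `|y ord0 i - c ord0 i| < r].
Proof.
move=> r0; apply/seteqP; split => y /=.
  by move=> [_ h] i; have := h ord0 i; rewrite /ball/= distrC.
by move=> h; split => // i j; rewrite /ball/= distrC ord1; exact: h.
Qed.

Lemma measurable_ball_rV n (c : 'rV[R]_n) r : measurable (ball c r).
Proof.
have [r0|r0] := ltP 0 r; last first.
  rewrite (_ : ball c r = set0); first exact: measurable0.
  by rewrite -subset0 => y [] /lt_le_trans /(_ r0); rewrite ltxx.
rewrite (_ : ball c r =
  \big[setI/setT]_(i < n) (@rV_coord R n i @^-1` ball (c ord0 i : R) r)).
  apply: bigsetI_measurable => i _; rewrite -[X in measurable X]setTI.
  by apply: measurable_rV_coord => //; exact: measurable_ball.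
rewrite ball_rVE // -bigcap_seq; apply/seteqP; split => y /= h i.
  by move=> _; rewrite /ball /= distrC; exact: h.
by rewrite distrC; apply: (h i); rewrite /= mem_index_enum.
Qed.

Lemma normr_coord_le n (x : 'rV[R]_n) i : `|x ord0 i| <= `|x|.
Proof.
rewrite [leRHS]mx_normrE.
exact: (le_bigmax _ (fun i : 'I_1 * 'I_n => `|x i.1 i.2|) (ord0, i)).
Qed.

(** The closed sup-norm ball; the library balls of ['rV[R]_n] are the open ones. Being compact, it
    serves as carrier for the supports of test functions. *)
Definition cube n (c : 'rV[R]_n) (r : R) : set 'rV[R]_n := [set y | forall i, `|y ord0 i - c ord0 i| <= r].

Lemma cube_closed n (c : 'rV[R]_n) r : closed (cube c r).
Proof.
rewrite (_ : cube c r = \bigcap_(i in [set: 'I_n]) [set x : 'rV[R]_n | `|x ord0 i - c ord0 i| <= r]).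
  apply: closed_bigI => i _.
  apply: (@preimage_closed _ _ (fun x : 'rV[R]_n => `|x ord0 i - c ord0 i|) [set y | y <= r]).
    move=> x _; apply: (@continuous_comp _ _ _ (fun x : 'rV[R]_n => x ord0 i - c ord0 i) Num.norm).
      by apply: continuousB; [exact: coord_continuous|exact: cst_continuous].
    exact: norm_continuous.
  exact: closed_le.
apply/seteqP; split => x /= h i; first by move=> _; exact: h.
by have := h i I.
Qed.

Lemma cube_compact n (c : 'rV[R]_n) r : compact (cube c r).
Proof.
apply: bounded_closed_compact; last exact: cube_closed.
exists (`|r| + `|c|); split; first exact: num_real.
move=> M rM x xc.
apply: le_trans (ltW rM).
rewrite [leLHS]mx_normrE; apply: bigmax_le => [|[a i] _ /=].
  by rewrite addr_ge0.
rewrite (ord1 a) -[x _ _](subrK (c ord0 i)); apply: le_trans (ler_normD _ _) _.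
by apply: lerD; [exact: le_trans (xc i) (ler_norm r)|exact: normr_coord_le].
Qed.

Definition rat_ball n (q : 'rV[rat]_n * rat) : set 'rV[R]_n :=
  ball (map_mx ratr q.1 : 'rV[R]_n) (ratr q.2 : R).

(** Asking for the doubled cube inside [A] leaves room around the ball: bumps supported in
    [ball c r] can be translated by less than [r] with their supports still compact in [A]. *)
Lemma open_rat_balls n (A : set 'rV[R]_n) : open A ->
  A = \bigcup_(q in [set q : 'rV[rat]_n * rat | 0 < ratr q.2 :> R /\
        cube (map_mx ratr q.1) (2 * ratr q.2) `<=` A]) rat_ball q.
Proof.
move=> oA; apply/seteqP; split => [x Ax|x [q [q0 qA]]]; last first.
  rewrite /rat_ball ball_rVE //= => xq; apply: qA => i; apply: le_trans (ltW (xq i)) _.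
  by rewrite ler_peMl ?ltW // ltr1n.
have /nbhs_ballP[e /= e0 eA] : nbhs x A by apply: open_nbhs_nbhs.
(* The centre will be within [r] of [x], so a point of the doubled cube is within [3 r < e] of
   [x]. *)
have [r] := @rat_in_itvoo R 0 (e / 4) (divr_gt0 e0 (ltr0n _ 4)).
rewrite in_itv/= => /andP[r0 re].
have cP i : {q : rat | ratr q \in `](x ord0 i - ratr r), (x ord0 i)[ }.
  by apply/cid/rat_in_itvoo; rewrite ltrBlDr ltrDl.
pose c : 'rV[rat]_n := \row_i sval (cP i).
have cx i : `|x ord0 i - (map_mx ratr c : 'rV[R]_n) ord0 i| < ratr r.
  rewrite !mxE; case: (cP i) => q /=; rewrite in_itv/= => /andP[h1 h2].
  by rewrite ger0_norm ?subr_ge0 1?ltW//; lra.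
exists (c, r) => /=; last by rewrite /rat_ball ball_rVE.
split=> // y yc; apply: eA; rewrite ball_rVE //= => i.
have := yc i; have := cx i; set z := (map_mx _ _) _ _.
rewrite !ltr_norml !ler_norml; lra.
Qed.

Lemma open_measurable_rV n (A : set 'rV[R]_n) : open A -> measurable A.
Proof.
move=> /open_rat_balls ->; rewrite bigcup_mkcond.
apply: countable_bigcupT_measurable; first exact: countableP.
by move=> q; case: ifPn => _ //; exact: measurable_ball_rV.
Qed.

(** Countably many balls cover [A], so almost everywhere statements may be proved locally, inside a
    ball whose doubled cube lies in [A]. *)
Lemma ae_open_rat_balls n (A : set 'rV[R]_n) (P : 'rV[R]_n -> Prop) : open A ->
  (forall c r, 0 < r -> cube c (2 * r) `<=` A ->
     {ae leb n, forall x, ball c r x -> P x}) ->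
  {ae leb n, forall x, A x -> P x}.
Proof.
move=> oA h.
pose D := [set q : 'rV[rat]_n * rat | 0 < ratr q.2 :> R /\
        cube (map_mx ratr q.1) (2 * ratr q.2) `<=` A].
have : {ae leb n, forall x q, D q -> rat_ball q x -> P x}.
  apply: ae_forall_count => q; have [Dq|nDq] := pselect (D q); last exact: aeW.
  by case: (Dq) => q0 /(h _ _ q0); apply: filterS => x hx _; exact: hx.
apply: filterS => x hx; rewrite (open_rat_balls oA) => -[q Dq qx].
exact: hx Dq qx.
Qed.

Lemma closed_measurable_rV n (A : set 'rV[R]_n) : closed A -> measurable A.
Proof.
move=> cA; rewrite -[A]setCK; apply: measurableC.
by apply: open_measurable_rV; exact: closed_openC.
Qed.

Lemma measurable_cube n (c : 'rV[R]_n) r : measurable (cube c r).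
Proof. by apply: closed_measurable_rV; exact: cube_closed. Qed.

Lemma compact_measurable_rV n (A : set 'rV[R]_n) : compact A -> measurable A.
Proof. by move=> cA; apply: closed_measurable_rV; exact: compact_closed. Qed.

Lemma continuous_measurable_rV n (f : 'rV[R]_n -> R) : continuous f ->
  measurable_fun [set: 'rV[R]_n] f.
Proof.
move=> cf; apply: (measurability _ (RGenOpens.measurableE R)) => //.
move=> _ [_ [a [b ->]] <-]; rewrite setTI.
by apply: open_measurable_rV; apply: open_comp => // x _; exact: cf.
Qed.

Lemma measurable_translation n (a : 'rV[R]_n) :
  measurable_fun [set: 'rV[R]_n] (fun x : 'rV[R]_n => x + a).
Proof.
apply: measurable_fun_rVP => i.
apply: (eq_measurable_fun (fun x : 'rV_n => @rV_coord R n i x + a ord0 i)).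
  by move=> x _; rewrite /= /rV_coord mxE.
by apply: measurable_funD => //; exact: measurable_rV_coord.
Qed.

Lemma lebesgue_measure_translation (h : R) (A : set (measurableTypeR R)) :
  measurable A ->
  lebesgue_measure ((fun x : measurableTypeR R => x + h) @^-1` A) =
  lebesgue_measure A.
Proof.
move=> mA.
have mf : @measurable_fun _ _ (measurableTypeR R) (measurableTypeR R) setT (fun x => x + h).
  exact: measurable_funD.
rewrite -[LHS]/(pushforward lebesgue_measure (fun x : measurableTypeR R => (x + h) : measurableTypeR R) A).
apply/esym/lebesgue_measure_unique => //= _ [[a b]] _ <-.
rewrite /pushforward /=.
rewrite (_ : _ @^-1` _ = `]a - h, b - h]%classic); last first.
  by apply/seteqP; split => x /=; rewrite !in_itv/= ltrBlDr lerBrDr.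
by rewrite !lebesgue_measure_itv/= !lte_fin ltrD2r -!EFinB opprB addrA subrK.
Qed.

Lemma lebesgue_rVS n (A : set 'rV[R]_n.+1) :
  leb n.+1 A = (lebesgue_measure \x leb n)%E (@rV_cons R n @^-1` A).
Proof. by []. Qed.

(** By induction on the dimension: the image of the product measure under the coordinatewise shift
    agrees with it on rectangles, and product measures are unique. *)
Lemma lebesgue_rV_translation n (a : 'rV[R]_n) (A : set 'rV[R]_n) :
  measurable A -> leb n ((fun x => x + a) @^-1` A) = leb n A.
Proof.
elim: n a A => [|n IH] a A mA.
  congr (leb 0 _); apply/seteqP; split => x /=; by rewrite (thinmx0 a) addr0.
rewrite !lebesgue_rVS.
pose h : measurableTypeR R := a ord0 ord0.
pose a' : 'rV[R]_n := \row_i a ord0 (lift ord0 i).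
pose g (z : measurableTypeR R * 'rV[R]_n) := (z.1 + h : measurableTypeR R, z.2 + a').
have mg : @measurable_fun _ _ (measurableTypeR R * 'rV[R]_n)%type (measurableTypeR R * 'rV[R]_n)%type setT g.
  apply/measurable_fun_pairP; split; first exact: measurable_funD.
  apply: (@measurableT_comp _ _ _ _ _ _ (fun x : 'rV[R]_n => x + a') _ snd) => //.
  exact: measurable_translation.
pose m : {measure set (measurableTypeR R * 'rV[R]_n) -> \bar R} :=
  pushforward (lebesgue_measure \x leb n)%E g.
have mB : measurable (@rV_cons R n @^-1` A).
  by rewrite -[X in measurable X]setTI; exact: measurable_rV_cons.
rewrite (@product_measure_unique _ _ _ _ _ lebesgue_measure (leb n) (m mg) _ _ mB).
  rewrite /m /= /pushforward /=; congr (_ _).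
  have E z : rV_cons z + a = rV_cons (g z).
    apply/rowP => i; rewrite [LHS]mxE; case: (unliftP ord0 i) => [j ->|->].
      by rewrite !rV_consS /g /= !mxE.
    by rewrite !rV_cons0.
  by apply/seteqP; split => z /=; rewrite E.
move=> B C mB' mC; rewrite /m /= /pushforward /=.
rewrite (_ : g @^-1` _ = ((fun x => x + h) @^-1` B) `*` ((fun x => x + a') @^-1` C)) //.
have mh : @measurable_fun _ _ (measurableTypeR R) (measurableTypeR R) setT (fun x => x + h).
  exact: measurable_funD.
rewrite product_measure1E ?IH //.
- by rewrite [X in (X * _)%E]lebesgue_measure_translation.
- by rewrite -[X in measurable X]setTI; exact: mh.
- by rewrite -[X in measurable X]setTI; exact: measurable_translation.
Qed.

Lemma lebesgue_rV_cube n (M : R) : (leb n (cube (0 : 'rV[R]_n) M) < +oo)%E.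
Proof.
elim: n => [|n IH].
  by rewrite /= /dirac /= indicE; case: (_ \in _); rewrite ltry.
rewrite lebesgue_rVS.
pose I : set (measurableTypeR R) := `[- M, M]%classic.
have mI : measurable I by exact: measurable_itv.
have I_fin : (lebesgue_measure I < +oo)%E.
  by rewrite lebesgue_measure_itv /=; case: ifP; rewrite ltry.
have le_prod : ((lebesgue_measure \x leb n) (@rV_cons R n @^-1`
    cube 0 M) <= (lebesgue_measure \x leb n) (I `*` cube 0 M))%E.
  apply: le_measure; rewrite ?inE.
  - rewrite -[X in measurable X]setTI; apply: measurable_rV_cons => //.
    exact: measurable_cube.
  - by apply: measurableX => //; exact: measurable_cube.
  - move=> [x y] /= h; split => /=.
      by have := h ord0; rewrite rV_cons0 mxE subr0 /= ler_norml /I /= in_itv.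
    by move=> i; have := h (lift ord0 i); rewrite rV_consS !mxE !subr0.
apply: le_lt_trans le_prod _.
by rewrite product_measure1E //; [rewrite lte_mul_pinfty // ge0_fin_numE|exact: measurable_cube].
Qed.

Lemma bounded_lebesgue_rV n (A : set 'rV[R]_n) : bounded_set A ->
  measurable A -> (leb n A < +oo)%E.
Proof.
move=> [M [_ AM]] mA.
have {}AM := AM (`|M| + 1) (ltr_pwDr ltr01 (ler_norm M)).
apply: le_lt_trans (lebesgue_rV_cube n (`|M| + 1)).
apply: le_measure; rewrite ?inE //; first exact: measurable_cube.
by move=> x Ax i; rewrite mxE subr0; exact: le_trans (normr_coord_le x i) (AM x Ax).
Qed.

Lemma compact_lebesgue_rV n (A : set 'rV[R]_n) : compact A -> (leb n A < +oo)%E.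
Proof.
move=> cA; apply: bounded_lebesgue_rV; first exact: compact_bounded.
exact: compact_measurable_rV.
Qed.

Lemma ge0_integral_translation n (a : 'rV[R]_n) (f : 'rV[R]_n -> \bar R) :
  measurable_fun setT f -> (forall x, 0 <= f x)%E ->
  (\int[leb n]_x f (x + a)%R = \int[leb n]_x f x)%E.
Proof.
move=> mf f0.
rewrite -(@ge0_integral_pushforward _ _ _ _ _ _ (@measurable_translation n a) (leb n) setT f) //.
apply: eq_measure_integral; first exact: measurable_translation.
by move=> ? A mA _; rewrite /= /pushforward; exact: lebesgue_rV_translation.
Qed.

Lemma integral_translation n (a : 'rV[R]_n) (f : 'rV[R]_n -> \bar R) :
  measurable_fun setT f ->
  (\int[leb n]_x f (x + a)%R = \int[leb n]_x f x)%E.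
Proof.
move=> mf; rewrite integralE [RHS]integralE.
rewrite -(ge0_integral_translation a (measurable_funepos mf)) //.
rewrite -(ge0_integral_translation a (measurable_funeneg mf)) //.
by congr (_ - _)%E; apply: eq_integral => x _; rewrite /= ?funeposE ?funenegE.
Qed.

Lemma integrable_translation n (a : 'rV[R]_n) (f : 'rV[R]_n -> \bar R) :
  (leb n).-integrable setT f -> (leb n).-integrable setT (fun x => f (x + a)%R).
Proof.
move=> /integrableP[mf intf]; apply/integrableP; split.
  refine (measurableT_comp mf (@measurable_translation n a)).
by rewrite (ge0_integral_translation a (f := fun x => `|f x|%E)) //; exact: measurableT_comp.
Qed.

Lemma measurable_line n (e : 'rV[R]_n) :
  measurable_fun [set: measurableTypeR R * 'rV[R]_n]
    (fun z : measurableTypeR R * 'rV[R]_n => z.2 + (z.1 : R) *: e).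
Proof.
apply: measurable_fun_rVP => i.
apply: (eq_measurable_fun (fun z : measurableTypeR R * 'rV[R]_n =>
   @rV_coord R n i z.2 + (z.1 : R) * e ord0 i)).
  by move=> z _; rewrite /= /rV_coord !mxE.
apply: measurable_funD; first exact: measurableT_comp (measurable_rV_coord i) measurable_snd.
by apply: measurable_funM => //; exact: measurable_fst.
Qed.

(** Slices bounded in [L^1] uniformly over an interval of finite length make the function integrable
    on the strip; extended by zero off [I], it falls under Fubini on the whole product. This serves
    integrals along families of parallel segments. *)
Lemma strip_fubini n (k : measurableTypeR R * 'rV[R]_n -> R)
    (I : set (measurableTypeR R)) (C : R) :
  0 <= C -> measurable_fun setT k -> measurable I -> (lebesgue_measure I < +oo)%E ->
  (forall s, I s -> \int[leb n]_x `|k (s, x)|%:E <= C%:E)%E ->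
  [/\ {ae leb n, forall x, lebesgue_measure.-integrable I (fun s => (k (s, x))%:E)},
      (leb n).-integrable setT (fun x => \int[lebesgue_measure]_(s in I) (k (s, x))%:E)%E &
      (\int[lebesgue_measure]_(s in I) \int[leb n]_x (k (s, x))%:E =
       \int[leb n]_x \int[lebesgue_measure]_(s in I) (k (s, x))%:E)%E].
Proof.
move=> C0 mk mI I_fin kC.
pose F (z : measurableTypeR R * 'rV[R]_n) : \bar R := (\1_I z.1 * k z)%:E.
have mF : measurable_fun setT F.
  apply/measurable_EFinP/measurable_funM => //.
  by apply: (@measurableT_comp _ _ _ _ _ _ (\1_I : _ -> R) _ fst).
have FE s x : F (s, x) = ((fun s => (k (s, x))%:E) \_ I) s.
  by rewrite /F /= patchE indicE; case: ifPn => _; rewrite ?mul1r ?mul0r.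
have intF : (lebesgue_measure \x leb n)%E.-integrable setT F.
  apply/(integrable12ltyP _ _ mF).
  apply: (@le_lt_trans _ _ (\int[lebesgue_measure]_(s in I) C%:E)%E); last first.
    by rewrite integral_cst //= lte_mul_pinfty // ?lee_fin.
  rewrite [leRHS]integral_mkcond; apply: ge0_le_integral => //.
  - by move=> s _; exact: integral_ge0.
  - apply: (@measurable_fun_fubini_tonelli_F _ _ _ _ _ (leb n) (abse \o F)) => //.
      exact: measurableT_comp.
    by move=> z; exact: abse_ge0.
  - refine ((measurable_restrictT (fun _ => C%:E) mI).1 _); exact: measurable_cst.
  - move=> s _; rewrite patchE; case: ifPn => [Is|nIs].
      rewrite (eq_integral (fun x => `|k (s, x)|%:E)); first exact/kC/set_mem.
      by move=> x _; rewrite FE patchE Is.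
    rewrite integral0_eq // => x _.
    by rewrite FE patchE (negbTE nIs) abse0.
split.
- have := ae_integrable2 intF; apply: filterS => x.
  have -> : (fun s => F (s, x)) = (fun s => (k (s, x))%:E) \_ I.
    by apply/funext => s; rewrite FE.
  by move=> h; apply/integrable_mkcond.
- have GE x : (\int[lebesgue_measure]_s F (s, x) =
      \int[lebesgue_measure]_(s in I) (k (s, x))%:E)%E.
    by rewrite [RHS]integral_mkcond; apply: eq_integral => s _; rewrite FE.
  suff : (leb n).-integrable setT (fun x => \int[lebesgue_measure]_s F (s, x))%E.
    by apply: eq_integrable => // x _; rewrite GE.
  apply/integrableP; split; first exact: measurable_fubini_G intF.
  apply: le_lt_trans ((integrable21ltyP _ _ mF).1 intF).
  apply: ge0_le_integral => //.
  - by apply: measurableT_comp => //; exact: measurable_fubini_G intF.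
  - apply: (@measurable_fun_fubini_tonelli_G _ _ _ _ _ lebesgue_measure (abse \o F)).
      exact: measurableT_comp.
    by move=> z; exact: abse_ge0.
  - move=> x _; apply: le_abse_integral => //.
    by apply: measurableT_comp mF _; exact: pair2_measurable.
- transitivity (\int[lebesgue_measure]_s \int[leb n]_x F (s, x))%E.
    rewrite integral_mkcond; apply: eq_integral => s _; rewrite patchE.
    case: ifPn => [Is|nIs]; first by apply: eq_integral => x _; rewrite FE patchE Is.
    by rewrite integral0_eq // => x _; rewrite FE patchE (negbTE nIs).
  rewrite (Fubini intF); apply: eq_integral => x _.
  by rewrite [RHS]integral_mkcond; apply: eq_integral => s _; rewrite FE.
Qed.

End rV_measure.

(** * Smooth bumps and the fundamental lemma *)

Section smooth_functions_of_one_variable.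
Context {R : realType}.
Implicit Types (f g : R -> R) (p : {poly R}).

(** The derivative is a witness rather than [derive1 f], so that the closure properties go by plain
    induction. Continuity of the last derivative comes from the next order in [smooth1]. *)
Fixpoint Ck k f : Prop :=
  if k is k'.+1 then
    exists2 f' : R -> R, (forall x : R, is_derive x 1 f (f' x)) & Ck k' f'
  else True.

Definition smooth1 f := forall k, Ck k f.

Lemma CkS k f : Ck k.+1 f -> Ck k f.
Proof.
elim: k f => [//|k IH] f [f' df /= Cf']; exists f' => //.
exact: IH.
Qed.

Lemma Ck_cst k c : Ck k (cst c).
Proof. by elim: k c => [//|k IH] c; exists (cst 0) => // x; exact: is_derive_cst. Qed.

Lemma CkD k f g : Ck k f -> Ck k g -> Ck k (fun x => f x + g x).
Proof.
elim: k f g => [//|k IH] f g [f' df Cf] [g' dg Cg].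
exists (fun x => f' x + g' x); last exact: IH.
by move=> x; apply: (@is_deriveD _ _ _ f g).
Qed.

Lemma CkM k f g : Ck k f -> Ck k g -> Ck k (fun x => f x * g x).
Proof.
elim: k f g => [//|k IH] f g Cf Cg; have [f' df Cf'] := Cf; have [g' dg Cg'] := Cg.
exists (fun x => f x * g' x + g x * f' x); last first.
  by apply: CkD; apply: IH => //; exact: CkS.
by move=> x; apply: (@is_deriveM _ _ f g).
Qed.

Lemma Ck_affine k f a b : Ck k f -> Ck k (fun x => f (a * x + b)).
Proof.
elim: k f => [//|k IH] f [f' df Cf'].
exists (fun x => f' (a * x + b) * a).
  move=> x; apply: (@is_derive1_comp _ f (fun x => a * x + b)).
  by apply: is_derive_eq; rewrite /= addr0 /GRing.scale /= !mulr1.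
by apply: CkM; [exact: IH|exact: Ck_cst].
Qed.

Lemma smooth1_continuous f : smooth1 f -> continuous f.
Proof.
move=> /(_ 1) [f' df _] x.
by apply/differentiable_continuous/derivable1_diffP; have [] := df x.
Qed.

Lemma smooth1_derive f : smooth1 f -> smooth1 (derive1 f).
Proof.
move=> sf k; have [f' df Cf'] := sf k.+1.
suff -> : derive1 f = f' by [].
by apply/funext => x; rewrite derive1E; have [_ ->] := df x.
Qed.

Lemma smooth1_derivable f (x : R) : smooth1 f -> is_derive x 1 f (derive1 f x).
Proof.
move=> /(_ 1) [f' df _]; apply: DeriveDef; first by have [] := df x.
by rewrite derive1E.
Qed.

(* The polynomial factor makes this family closed under differentiation; [flat 1] is the usual
   [exp(-1/x)]. *)
Definition flat p (x : R) : R := if 0 < x then p.[x^-1] * expR (- x^-1) else 0.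

(** Each monomial obeys [y^n <= n! exp y], from the exponential series. *)
Lemma horner_expR_bounded p :
  exists2 K : R, 0 <= K & forall y : R, 0 <= y -> `|p.[y] * expR (- y)| <= K.
Proof.
have mono n y : 0 <= y -> y ^+ n * expR (- y) <= n`!%:R.
  move=> y0; rewrite expRN ler_pdivrMr ?expR_gt0//.
  case: n => [|n].
    by rewrite expr0 mul1r -[leLHS]addr0; apply: le_trans (expR_ge1Dx y); rewrite lerD2l.
  rewrite mulrC -ler_pdivrMr ?ltr0n ?fact_gt0//.
  by apply: le_trans (expR_ge1Dxn n y0); rewrite lerDr.
exists (\sum_(i < size p) `|p`_i| * (i`!%:R)).
  by apply: sumr_ge0 => i _; rewrite mulr_ge0.
move=> y y0; rewrite horner_coef mulr_suml.
apply: le_trans (ler_norm_sum _ _ _) _; apply: ler_sum => i _.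
rewrite -mulrA normrM ler_wpM2l// ger0_norm ?mono//.
by rewrite mulr_ge0 ?exprn_ge0 ?expR_ge0.
Qed.

Lemma is_derive0_quadratic f K : 0 <= K -> (forall h, `|f h| <= K * h ^+ 2) ->
  is_derive (0 : R) 1 f 0.
Proof.
move=> K0 fK.
have f0 : f 0 = 0.
  by apply/eqP; rewrite -normr_le0; apply: le_trans (fK 0) _; rewrite expr2 !mulr0.
have c : (fun h : R => h^-1 *: ((f \o shift 0) (h *: (1 : R)) - f 0)) @ 0^' --> (0 : R).
  apply/cvgr0Pnorm_lt => e e0; near=> h.
  rewrite /= f0 subr0 addr0 /GRing.scale /= mulr1 normrM normfV.
  have h0 : h != 0 by near: h; exact: nbhs_dnbhs_neq.
  have hn : 0 < `|h| by rewrite normr_gt0.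
  rewrite mulrC ltr_pdivrMr //; apply: le_lt_trans (fK h) _.
  rewrite -real_normK ?num_real // expr2 mulrA ltr_pM2r //.
  have : `|h| < e / (K + 1).
    near: h; apply: dnbhs0_lt; rewrite divr_gt0 // ltr_wpDl //.
  rewrite ltr_pdivlMr ?ltr_wpDl // => /(le_lt_trans _); apply.
  by rewrite mulrC ler_wpM2l // lerDl.
apply: DeriveDef; first exact: (cvgP _ c).
exact: (cvg_lim _ c).
Unshelve. all: by end_near.
Qed.

(** With [y = x^-1], the derivative in [x] of [p(y) exp(-y)] is [y^2 (p(y) - p'(y)) exp(-y)], which
    gives the new polynomial. *)
Lemma flat_derive p (x : R) : is_derive x 1 (flat p) (flat ('X^2 * (p - p^`())) x).
Proof.
have [x0|x0|->] := ltgtP x 0.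
- rewrite {2}/flat ltNge (ltW x0) /=.
  apply: near_eq_is_derive (is_derive_cst (0 : R) x (1 : R)).
  near=> y; rewrite /flat ifF //; apply/negbTE; rewrite -leNgt ltW //.
  by near: y; exact: lt_nbhsl.
- rewrite {2}/flat x0.
  have dV : is_derive x 1 (fun y : R => y^-1) (- x ^- 2).
    have : is_derive x 1 (fun y : R => y^-1) (- x ^- 2 *: (1 : R)).
      by apply: (@is_deriveV _ id); rewrite gt_eqF.
    by rewrite /GRing.scale /= mulr1.
  have d1 : is_derive x 1 (fun y : R => p.[y^-1]) (p^`().[x^-1] * (- x ^- 2)).
    exact: (@is_derive1_comp _ (horner p) (fun y => y^-1)).
  have d2 : is_derive x 1 (fun y : R => expR (- y^-1)) (expR (- x^-1) * (x ^- 2)).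
    apply: (@is_derive1_comp _ expR (fun y => - y^-1)).
    by rewrite -[x ^- 2]opprK; exact: is_deriveN.
  apply: near_eq_is_derive (is_derive_eq (is_deriveM d1 d2) _).
    near=> y; rewrite /flat ifT //; near: y; exact: lt_nbhsr.
  rewrite -[LHS]/(p.[x^-1] * (expR (- x^-1) * x ^- 2) + expR (- x^-1) * (p^`().[x^-1] * - x ^- 2)).
  by rewrite hornerM hornerXn hornerD hornerN exprVn; ring.
- rewrite {2}/flat ltxx.
  (* Bounding [y^2 p(y) exp(-y)] at [y = h^-1] says that [flat p h] is at most [K h^2]; the factor
     ['X^2] is there to produce this quadratic bound at 0. *)
  have [K K0 pK] := horner_expR_bounded ('X^2 * p).
  apply: (is_derive0_quadratic K0) => h.
  rewrite /flat; case: ifPn => [h0|_]; last by rewrite normr0 mulr_ge0 ?sqr_ge0.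
  have hi : 0 < h^-1 by rewrite invr_gt0.
  have := pK _ (ltW hi).
  rewrite hornerM hornerXn exprVn -mulrA normrM normfV [`|h ^+ 2|]ger0_norm ?sqr_ge0 //.
  by rewrite ler_pdivrMl ?exprn_gt0 // [_ ^+ 2 * _]mulrC.
Unshelve. all: by end_near.
Qed.

Lemma smooth1_flat p : smooth1 (flat p).
Proof.
move=> k; elim: k p => [//|k IH] p.
by exists (flat ('X^2 * (p - p^`()))); [exact: flat_derive|exact: IH].
Qed.

Lemma smooth1M f g : smooth1 f -> smooth1 g -> smooth1 (fun x => f x * g x).
Proof. by move=> sf sg k; exact: CkM. Qed.

Lemma smooth1_affine f a b : smooth1 f -> smooth1 (fun x => f (a * x + b)).
Proof. by move=> sf k; exact: Ck_affine. Qed.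

(* Increases to the indicator of [`]a, b[] as [m] tends to infinity. *)
Definition sbump (a b : R) (m : nat) (x : R) : R :=
  flat 1 (m.+1%:R * (x - a)) * flat 1 (m.+1%:R * (b - x)).

Lemma smooth1_sbump a b m : smooth1 (sbump a b m).
Proof.
have -> : sbump a b m = fun x => flat 1 (m.+1%:R * x + - (m.+1%:R * a)) *
    flat 1 (- m.+1%:R * x + m.+1%:R * b).
  by apply/funext => x; rewrite /sbump !mulrBr mulNr addrC [_ * b - _]addrC.
by apply: smooth1M; apply: smooth1_affine; exact: smooth1_flat.
Qed.

Lemma flat1_itv (x : R) : 0 <= flat 1 x <= 1.
Proof.
rewrite /flat hornerC; case: ifPn => [x0|_]; last by rewrite lexx ler01.
by rewrite mul1r expR_ge0 /= expR_le1 oppr_le0 invr_ge0 ltW.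
Qed.

Lemma sbump_itv a b m x : 0 <= sbump a b m x <= 1.
Proof.
have /andP[h1 h2] := flat1_itv (m.+1%:R * (x - a)).
have /andP[h3 h4] := flat1_itv (m.+1%:R * (b - x)).
by rewrite /sbump mulr_ge0 //= -[leRHS]mulr1 ler_pM.
Qed.

Lemma sbump_eq0 a b m x : ~~ (a < x < b) -> sbump a b m x = 0.
Proof.
rewrite /sbump /flat negb_and => /orP[h|h].
  by rewrite pmulr_rgt0 // subr_gt0 (negbTE h) mul0r.
by rewrite [X in _ * X]ifF ?mulr0 // pmulr_rgt0 // subr_gt0 (negbTE h).
Qed.

Lemma sbump_cvg a b x : a < x < b -> sbump a b m x @[m --> \oo] --> (1 : R).
Proof.
move=> /andP[ax xb].
have fl (c : R) : 0 < c -> flat 1 (m.+1%:R * c) @[m --> \oo] --> (1 : R).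
  move=> c0.
  have -> : (fun m : nat => flat 1 (m.+1%:R * c)) = (fun m : nat => expR (- (m.+1%:R^-1 * c^-1))).
    by apply/funext => m; rewrite /flat hornerC pmulr_rgt0 // c0 mul1r invfM.
  rewrite -{2}(@expR0 R) -oppr0 -(mul0r c^-1).
  apply: (@cvg_comp _ _ _ (fun m : nat => - (m.+1%:R^-1 * c^-1)) expR _ (nbhs (- (0 / c)))).
    by apply: cvgN; apply: cvgMr_tmp; exact: cvg_harmonic.
  exact: continuous_expR.
by rewrite -[X in _ --> X]mulr1; apply: cvgM; apply: fl; rewrite subr_gt0.
Qed.

End smooth_functions_of_one_variable.

Section product_functions.
Context {R : realType} {n : nat}.
Implicit Types psi : 'I_n -> R -> R.
Local Notation E := 'rV[R]_n.

Definition prodfun psi (x : E) : R := \prod_(j < n) psi j (x ord0 j).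

Lemma continuous_prodfun psi : (forall j, continuous (psi j)) -> continuous (prodfun psi).
Proof.
move=> cpsi; rewrite /prodfun.
have mc : continuous (fun z : R * R => z.1 * z.2) by move=> z; exact: mul_continuous.
refine (continuous_big mc _) => j _ x.
apply: (@continuous_comp _ _ _ (fun x : E => x ord0 j) (psi j)); last exact: cpsi.
exact: coord_continuous.
Qed.

Lemma is_derive_line (f : E -> R) (x v : E) df :
  is_derive (0 : R) 1 (fun h : R => f (h *: v + x)) df -> is_derive x v f df.
Proof.
case=> d1 d2.
have e : (fun h : R => h^-1 *: ((f \o shift x) (h *: v) - f x)) =
  (fun h : R => h^-1 *: (((fun h : R => f (h *: v + x)) \o shift 0) (h *: (1 : R))
     - f ((0 : R) *: v + x))).
  by apply/funext => h /=; rewrite addr0 scale0r add0r /GRing.scale /= mulr1.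
by apply: DeriveDef; rewrite /derivable /derive e.
Qed.

Lemma is_derive_along (f : E -> R) (x v : E) (s df : R) :
  is_derive (x + s *: v) v f df -> is_derive s 1 (fun s : R => f (x + s *: v)) df.
Proof.
case=> d1 d2.
have e : (fun h : R => h^-1 *: (((fun s : R => f (x + s *: v)) \o shift s) (h *: (1 : R)) -
    f (x + s *: v))) =
  (fun h : R => h^-1 *: ((f \o shift (x + s *: v)) (h *: v) - f (x + s *: v))).
  apply/funext => k /=; congr (_ *: (f _ - _)).
  by rewrite /GRing.scale /= mulr1 -/(GRing.scale _ _) scalerDl addrCA.
by apply: DeriveDef; rewrite /derivable /derive e.
Qed.

Lemma is_derive_translate (f : E -> R) (x v a : E) (df : R) :
  is_derive (x - a) v f df -> is_derive x v (fun y => f (y - a)) df.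
Proof.
case=> d1 d2.
have e : (fun h : R => h^-1 *: (((fun y => f (y - a)) \o shift x) (h *: v) - f (x - a))) =
  (fun h : R => h^-1 *: ((f \o shift (x - a)) (h *: v) - f (x - a))).
  by apply/funext => k /=; rewrite addrA.
by apply: DeriveDef; rewrite /derivable /derive e.
Qed.

Definition upd psi (i : 'I_n) (g : R -> R) : 'I_n -> R -> R :=
  fun j => if j == i then g else psi j.

Lemma is_derive_prodfun psi (i : 'I_n) (x : E) : smooth1 (psi i) ->
  is_derive x (basis_vec i) (prodfun psi) (prodfun (upd psi i (derive1 (psi i))) x).
Proof.
move=> spsi; apply: is_derive_line.
pose C := \prod_(j < n | j != i) psi j (x ord0 j).
have -> : (fun h : R => prodfun psi (h *: basis_vec i + x)) =
    (fun h : R => psi i (1 * h + x ord0 i) * C).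
  apply/funext => h; rewrite /prodfun (bigD1 i) //=; congr (_ * _).
    by rewrite !mxE !eqxx mulr1 mul1r.
  by apply: eq_bigr => j ji; rewrite !mxE eqxx (negbTE ji) mulr0 add0r.
rewrite {1}/prodfun (bigD1 i) //= /upd eqxx.
rewrite (eq_bigr (fun j => psi j (x ord0 j))); last by move=> j /negbTE ->.
have d : is_derive (0 : R) 1 (fun h : R => psi i (1 * h + x ord0 i)) (derive1 (psi i) (x ord0 i)).
  have := @is_derive1_comp R (psi i) (fun h => 1 * h + x ord0 i) 0 (derive1 (psi i) (x ord0 i)) 1.
  rewrite mulr1; apply; rewrite ?mulr0 ?add0r; first exact: smooth1_derivable.
  by apply: is_derive_eq; rewrite /= addr0 /GRing.scale /= !mulr1.
apply: (is_derive_eq (is_deriveM d (is_derive_cst C _ _))).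
by rewrite scaler0 add0r /GRing.scale /= mulrC.
Qed.

(** Products of smooth functions of one variable are closed under partial derivatives: each one
    replaces a single factor by its derivative. *)
Lemma smooth_prodfun psi : (forall j, smooth1 (psi j)) -> smooth (prodfun psi).
Proof.
move=> spsi s.
have [psi' spsi' ->] : exists2 psi' : 'I_n -> R -> R,
    (forall j, smooth1 (psi' j)) & iter_partial s (prodfun psi) = prodfun psi'.
  elim: s => [|i s [psi' spsi' IH]]; first by exists psi.
  exists (upd psi' i (derive1 (psi' i))).
    by move=> j; rewrite /upd; case: eqP => // _; exact: smooth1_derive.
  rewrite /= IH; apply/funext => x.
  by have [_ ->] := @is_derive_prodfun psi' i x (spsi' i).
split; first by apply: continuous_prodfun => j; exact: smooth1_continuous.
by move=> i x; have [] := @is_derive_prodfun psi' i x (spsi' i).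
Qed.

End product_functions.

(** The measurable sets [A] for which the integral over [D] intersected with [A] vanishes form a
    Dynkin system; stability under complements uses that the integral over [D] is 0. *)
Lemma ae_eq0_pi_system d (T : measurableType d) (R : realType)
    (mu : {measure set T -> \bar R}) (D : set T) (G : set (set T)) (f : T -> R) :
  measurable D -> mu.-integrable D (EFin \o f) ->
  setI_closed G -> measurable `<=` <<s G >> -> G `<=` measurable ->
  (\int[mu]_(x in D) (f x)%:E = 0)%E ->
  (forall A, G A -> \int[mu]_(x in D `&` A) (f x)%:E = 0)%E ->
  {ae mu, forall x, D x -> f x = 0}.
Proof.
move=> mD intf GI mG Gm f0 fG.
pose H A := measurable A /\ (\int[mu]_(x in D `&` A) (f x)%:E = 0)%E.
have dH : dynkin H.
  split.
  - by split => //; rewrite setIT.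
  - move=> A [mA fA]; split; first exact: measurableC.
    have : (\int[mu]_(x in (D `&` A) `|` (D `&` ~` A)) (f x)%:E = 0)%E.
      by rewrite -setIUr setUv setIT.
    rewrite integral_setU //; last 4 first.
    - exact: measurableI.
    - by apply: measurableI => //; exact: measurableC.
    - by rewrite -setIUr setUv setIT; exact: measurable_int intf.
    - by apply/disj_setPS; rewrite setIACA setICr setI0.
    by rewrite fA add0e.
  - move=> F tF HF; split; first by apply: bigcupT_measurable => k; have [] := HF k.
    rewrite setI_bigcupr integral_bigcup.
    - by apply: eseries0 => k _ _; have [] := HF k.
    - by apply/trivIsetP => i j _ _ ij; move/trivIsetP : tF => /(_ i j I I ij);
        rewrite setIACA => ->; rewrite setI0.
    - by move=> k; apply: measurableI => //; have [] := HF k.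
    - apply: integrableS intf => //.
      by apply: bigcupT_measurable => k; apply: measurableI => //; have [] := HF k.
      by move=> x [k _ []].
have mH A : measurable A -> H A.
  move=> /mG; rewrite -setI_closed_g_dynkin_g_sigma_algebra //; apply; split => //.
  by move=> B GB; split; [exact: Gm|exact: fG].
have : ae_eq mu D (EFin \o f) (cst 0%E).
  apply: (integral_ae_eq mD intf); first exact: measurable_cst.
  move=> E ED mE; rewrite integral0; have [_] := mH _ mE.
  by rewrite setIidr.
by apply: filterS => x h /h /= [].
Qed.

Section fundamental_lemma.
Context {R : realType} {n : nat}.
Local Notation E := 'rV[R]_n.
Local Notation mu := (@lebesgue_rV R n).

Definition obox (a b : E) : set E := [set x | forall i, a ord0 i < x ord0 i < b ord0 i].

Lemma ball_obox (c : E) r : 0 < r -> ball c r = obox (c - const_mx r) (c + const_mx r).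
Proof.
move=> r0; rewrite ball_rVE //; apply/seteqP; split => x /= h i; have := h i;
  by rewrite !mxE ltr_norml => /andP[h1 h2]; apply/andP; split; lra.
Qed.

Lemma oboxI (a b a' b' : E) : obox a b `&` obox a' b' =
  obox (\row_i Num.max (a ord0 i) (a' ord0 i)) (\row_i Num.min (b ord0 i) (b' ord0 i)).
Proof.
apply/seteqP; split => [x [/= h1 h2] i|x /= h].
  have /andP[? ?] := h1 i; have /andP[? ?] := h2 i; rewrite !mxE gt_max lt_min; lra.
by split => i; have := h i; rewrite !mxE gt_max lt_min; lra.
Qed.

Lemma measurable_obox (a b : E) : measurable (obox a b).
Proof.
rewrite (_ : obox a b = \bigcap_(i in [set: 'I_n])
    (@rV_coord R n i @^-1` `]a ord0 i, b ord0 i[)).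
  apply: fin_bigcap_measurable => // i _; rewrite -[X in measurable X]setTI.
  by apply: measurable_rV_coord.
apply/seteqP; split => x /= h i; first by move=> _ /=; rewrite in_itv /=; exact: h.
by have := h i I; rewrite /= in_itv.
Qed.

(** The preimage of an open interval under a coordinate is open, hence a countable union of rational
    sup-norm balls, which are boxes. *)
Lemma measurable_rV_sub_obox : @measurable _ E `<=` <<s [set A | exists a b, A = obox a b] >>.
Proof.
set G := [set A | _].
have ballG c r : 0 < r -> <<s G >> (ball c r).
  by move=> r0; apply: sub_sigma_algebra; rewrite ball_obox //; do 2 eexists.
apply: smallest_sub; first exact: smallest_sigma_algebra.
move=> A.
rewrite -bigcup_seq => -[i _ [B mB <-]]; rewrite setTI.
have : measurable_fun (setT : set (g_sigma_algebraType G)) (@rV_coord R n i).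
  apply: (measurability _ (RGenOpens.measurableE R)) => //.
  move=> _ [_ [a [b ->]] <-]; rewrite setTI.
  have oA : open (@rV_coord R n i @^-1` `]a, b[).
    apply: open_comp; last exact: interval_open.
    by move=> x _; exact: coord_continuous.
  rewrite (open_rat_balls oA) bigcup_mkcond.
  apply: countable_bigcupT_measurable; first exact: countableP.
  move=> q; case: ifPn => [|_]; last exact: measurable0.
  by rewrite inE => -[q0 _]; exact: ballG.
by move=> /(_ measurableT _ mB); rewrite setTI.
Qed.

(** Product bumps suffice as test functions: they converge boundedly to indicators of open boxes,
    and boxes are stable under intersection and generate the Borel sets. *)
Lemma ball_fundamental_lemma (c : E) (r : R) (g : E -> R) :
  0 < r -> mu.-integrable (ball c r) (EFin \o g) ->
  (forall psi : 'I_n -> R -> R, (forall j, smooth1 (psi j)) ->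
    (forall j y, psi j y != 0 -> `|y - c ord0 j| < r) ->
    (\int[mu]_(x in ball c r) (g x * prodfun psi x)%:E = 0)%E) ->
  {ae mu, forall x, ball c r x -> g x = 0}.
Proof.
move=> r0 intg h.
have box0 a b : obox a b `<=` ball c r -> (\int[mu]_(x in obox a b) (g x)%:E = 0)%E.
  move=> sub.
  have [[y aby]|/set0P] := pselect (obox a b !=set0); last first.
    by move=> /negP; rewrite negbK => /eqP ->; rewrite integral_set0.
  have mg := measurable_int _ intg.
  pose psi m j := sbump (a ord0 j) (b ord0 j) m.
  (* The point [y] of the box supplies the remaining coordinates, so each side of the box lies in
     the corresponding side of the ball. *)
  have bd j z : a ord0 j < z < b ord0 j -> `|z - c ord0 j| < r.
    move=> az; pose x : E := \row_i (if i == j then z else y ord0 i).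
    have : ball c r x.
      by apply: sub => i; rewrite mxE; case: eqP => [->|_]; [exact: az|exact: aby].
    by rewrite ball_rVE //= => /(_ j); rewrite mxE eqxx.
  have z0 m : (\int[mu]_(x in ball c r) (g x * prodfun (psi m) x)%:E = 0)%E.
    apply: h => [j|j z nz]; first exact: smooth1_sbump.
    by apply: bd; apply: contraNT nz => /sbump_eq0 h0; rewrite /psi h0.
  have mpsi m : measurable_fun setT (prodfun (psi m)).
    apply: continuous_measurable_rV; apply: continuous_prodfun => j.
    by apply: smooth1_continuous; exact: smooth1_sbump.
  have psi01 m x : 0 <= prodfun (psi m) x <= 1.
    apply: (big_ind (fun y : R => 0 <= y <= 1)) => [|y1 y2|j _]; last exact: sbump_itv.
      by rewrite ler01 lexx.
    move=> /andP[y10 y11] /andP[y20 y21]; rewrite mulr_ge0 //=.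
    by rewrite -[leRHS]mulr1 ler_pM.
  have := @dominated_cvg _ _ _ mu (ball c r) (measurable_ball_rV c r)
    (fun m x => (g x * prodfun (psi m) x)%:E) (fun x => (g x * \1_(obox a b) x)%:E)
    (fun x => `|g x|%:E).
  move=> dc; have {}dc : (\int[mu]_(x in ball c r) (g x * prodfun (psi m) x)%:E)%E @[m --> \oo] -->
      (\int[mu]_(x in ball c r) (g x * \1_(obox a b) x)%:E)%E.
    apply: dc => //.
    - move=> m; apply/measurable_EFinP; apply: measurable_funM; first exact/measurable_EFinP.
      exact: measurable_funTS.
    - move=> x xB; apply: cvg_EFin; first exact: nearW.
      apply: cvgM; [exact: cvg_cst|rewrite indicE]; case: (boolP (x \in _)) => [/set_mem xU|xU].
        have -> : true%:R = \prod_(j < n) (1 : R) by rewrite big1.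
        apply: cvg_big => [|j _]; first by move=> z; exact: mul_continuous.
        exact: sbump_cvg.
      apply: cvg_near_cst; apply: nearW => m.
      have [j nj] : exists j, ~~ (a ord0 j < x ord0 j < b ord0 j).
        by move: xU; rewrite notin_setE => /existsNP[j /negP hj]; exists j.
      by rewrite /prodfun (bigD1 j) //= /psi sbump_eq0 ?mul0r.
    - exact: (integrable_abse intg).
    - move=> m x _; rewrite /= lee_fin normrM.
      have /andP[p0 p1] := psi01 m x.
      by rewrite (ger0_norm p0) ler_piMr.
  have {}dc : (\int[mu]_(x in ball c r) (g x * \1_(obox a b) x)%:E = 0)%E.
    move: dc; under eq_fun do rewrite z0.
    by move=> /(cvg_unique _ (@cvg_cst _ _ _ _ _)) <- //.
  rewrite -dc.
  rewrite [LHS]integral_mkcond [RHS]integral_mkcond; apply: eq_integral => x _.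
  rewrite !patchE indicE; case: (boolP (x \in obox a b)) => xU.
    by rewrite (mem_set (sub _ (set_mem xU))) mulr1.
  by case: ifPn => //; rewrite mulr0.
apply: (@ae_eq0_pi_system _ _ _ mu _ [set A | exists a b, A = obox a b]) => //.
- exact: measurable_ball_rV.
- by move=> _ _ [a [b ->]] [a' [b' ->]]; rewrite oboxI; do 2 eexists.
- exact: measurable_rV_sub_obox.
- by move=> _ [a [b ->]]; exact: measurable_obox.
- by rewrite ball_obox //; apply: box0; rewrite -ball_obox.
- move=> _ [a [b ->]]; have sub := @subIsetl _ (ball c r) (obox a b).
  by move: sub; rewrite {1 3}ball_obox // oboxI; exact: box0.
Qed.

End fundamental_lemma.

(** * Test functions, the Euclidean norm and local integrability *)

Section test_functions.
Context {R : realType} {n : nat}.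
Variable S : set 'rV[R]_n.
Hypothesis oS : open S.
Local Notation E := 'rV[R]_n.
Local Notation mu := (@lebesgue_rV R n).
Implicit Types (f g phi h : E -> R) (G H : E -> E).

Let mS : measurable S. Proof. exact: open_measurable_rV. Qed.

Lemma continuous_bounded_off_compact h (K : set E) : continuous h -> compact K ->
  (forall x, ~ K x -> h x = 0) -> exists2 M : R, 0 <= M & forall x, `|h x| <= M.
Proof.
move=> ch cK hK.
have /compact_bounded[M [_ hM]] : compact (h @` K).
  by apply: continuous_compact => //; exact: continuous_subspaceT.
have M1 : M < `|M| + 1 by rewrite ltr_pwDr // ler_norm.
exists (`|M| + 1); first by rewrite addr_ge0.
move=> x; have [Kx|nKx] := pselect (K x); first by apply: (hM _ M1); exists x.
by rewrite hK // normr0 addr_ge0.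
Qed.

Lemma integrable_mul_off_compact f h (K : set E) : measurable_fun S f ->
  compact K -> K `<=` S -> mu.-integrable K (EFin \o f) ->
  continuous h -> (forall x, ~ K x -> h x = 0) ->
  mu.-integrable S (fun x => (f x * h x)%:E).
Proof.
move=> mf cK KS intf ch hK.
have [M M0 hM] := continuous_bounded_off_compact ch cK hK.
have mK := compact_measurable_rV cK.
apply: (@le_integrable _ _ _ mu S mS _ (fun x => (M%:E * ((EFin \o f) \_ K) x)%E)).
- apply/measurable_EFinP/measurable_funM => //.
  by apply: measurable_funTS; exact: continuous_measurable_rV.
- move=> x _; rewrite patchE; case: ifPn => [_|].
    by rewrite -EFinM !abse_EFin lee_fin !normrM mulrC (ger0_norm M0) ler_wpM2r.
  by rewrite notin_setE => /hK ->; rewrite mulr0 mule0.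
apply: integrableZl => //; apply/integrable_mkcond => //.
rewrite (_ : _ \_ _ = (EFin \o f) \_ K); first exact: ((integrable_mkcond _ mK).1 intf).
apply/funext => x; rewrite !patchE; case: ifPn => // xS; case: ifPn => // /set_mem /KS.
by move: xS; rewrite notin_setE.
Qed.

Record test_data phi (K : set E) : Prop := TestData {
  test_compact : compact K;
  test_sub : K `<=` S;
  test_cont : continuous phi;
  test_off : forall x, ~ K x -> phi x = 0;
  test_derivable : forall i x, derivable phi x (basis_vec i);
  test_Dcont : forall i, continuous ('D_(basis_vec i) phi);
  test_Doff : forall i x, ~ K x -> 'D_(basis_vec i) phi x = 0 }.

Lemma test_functionP phi : test_function S phi ->
  test_data phi (closure [set x | phi x != 0]).
Proof.
move=> [sphi cK KS]; set K := closure _ in cK KS *.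
have off x : ~ K x -> phi x = 0.
  by move=> nK; apply/eqP/negPn/negP => h; apply: nK; exact: subset_closure.
have [c0 d0] := sphi [::].
split=> //; first by move=> i; have [] := sphi [:: i].
move=> i x nK; rewrite -(derive_cst (0 : R) x (basis_vec i)).
apply: near_eq_derive.
have : nbhs x (~` K) by apply: open_nbhs_nbhs; split => //; exact/closed_openC/closed_closure.
by apply: filterS => y /off.
Qed.

Lemma line_mean_value phi (x v : E) (h M : R) :
  0 <= h -> (forall y, derivable phi y v) -> (forall y, `|'D_v phi y| <= M) ->
  `|phi (x + h *: v) - phi x| <= M * h.
Proof.
move=> h0 dphi DM.
have dl s : is_derive (s : R) 1 (fun s : R => phi (x + s *: v)) ('D_v phi (x + s *: v)).
  by apply: is_derive_along; exact: derivableP.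
have cl : {within `[0, h], continuous (fun s : R => phi (x + s *: v))}.
  by apply: derivable_within_continuous => s _; have [] := dl s.
have [c _ ] := MVT_segment h0 (fun s _ => dl s) cl.
rewrite scale0r addr0 subr0 => ->; rewrite normrM (ger0_norm h0).
by rewrite ler_wpM2r.
Qed.

(** By translation invariance every difference quotient has integral 0, and dominated convergence
    passes to the derivative. *)
Lemma integral_partial0 phi (K : set E) i : test_data phi K ->
  (\int[mu]_x ('D_(basis_vec i) phi x)%:E = 0)%E.
Proof.
move=> [cK KS cphi off dphi cD Doff].
have [M M0 DM] := continuous_bounded_off_compact (cD i) cK (Doff i).
have [B _ KB] : exists2 B : R, 0 <= B & K `<=` cube 0 B.
  have [B [_ hB]] := compact_bounded cK; exists (`|B| + 1); first by rewrite addr_ge0.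
  move=> x Kx j; rewrite mxE subr0; apply: le_trans (normr_coord_le _ _) _.
  by apply: hB => //; rewrite ltr_pwDr // ler_norm.
pose e : E := basis_vec i.
pose q (m : nat) (x : E) : R := m.+1%:R * (phi (x + m.+1%:R^-1 *: e) - phi x).
have mphi : measurable_fun setT phi by exact: continuous_measurable_rV.
have mphit a : measurable_fun setT (fun x : E => phi (x + a)).
  exact: (measurableT_comp mphi (@measurable_translation R n a)).
have [Mp Mp0 phiM] := continuous_bounded_off_compact cphi cK off.
have iphi : mu.-integrable setT (EFin \o phi).
  have mK := compact_measurable_rV cK.
  rewrite (_ : EFin \o phi = (EFin \o phi) \_ K).
    refine ((integrable_mkcond _ mK).1 _); apply: measurable_bounded_integrable => //.
    + exact: compact_lebesgue_rV.
    + exact: measurable_funTS.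
    + by exists Mp; split; [exact: num_real|move=> M' /ltW MM' x _; exact: le_trans MM'].
  apply/funext => x; rewrite patchE; case: ifPn => //=.
  by rewrite notin_setE => /off ->.
have iphit a : mu.-integrable setT (fun x : E => (phi (x + a))%:E).
  exact: (integrable_translation a iphi).
have q0 m : (\int[mu]_x (q m x)%:E = 0)%E.
  under eq_integral do rewrite EFinM EFinB.
  rewrite integralZl //; last exact: integrableB.
  rewrite integralB // (integral_translation _ (f := EFin \o phi)); last exact/measurable_EFinP.
  by rewrite subee ?mule0 //; exact: integrable_fin_num.
(* The steps [m.+1%:R^-1] are at most 1, so all quotients vanish off the cube enlarged by 1; inside
   it the mean value theorem bounds them by [M]. *)
have := @dominated_cvg _ _ _ mu setT measurableT (fun m x => (q m x)%:E)
  (fun x => ('D_e phi x)%:E) (fun x => (M%:E * (\1_(cube (0 : E) (B + 1)) x)%:E)%E).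
move=> dc; have {}dc : (\int[mu]_x (q m x)%:E)%E @[m --> \oo] -->
    (\int[mu]_x ('D_e phi x)%:E)%E.
  apply: dc => //.
  - move=> m; apply/measurable_EFinP; apply: measurable_funM => //.
    exact: measurable_funB.
  - move=> x _; apply: cvg_EFin; first exact: nearW.
    have /cvgr_dnbhsP : (fun h : R => h^-1 *: ((phi \o shift x) (h *: e) - phi x)) @ 0^' -->
        'D_e phi x by exact: dphi.
    have -> : fine \o (fun m => (q m x)%:E) = (fun m : nat =>
        (m.+1%:R^-1)^-1 *: ((phi \o shift x) (m.+1%:R^-1 *: e) - phi x)).
      by apply/funext => m; rewrite /= /q invrK [x + _]addrC.
    by apply; split; [move=> m; rewrite invr_neq0|exact: cvg_harmonic].
  - have mc := measurable_cube (0 : E) (B + 1).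
    apply: (@integrableZl _ _ _ mu setT measurableT _ (EFin \o \1_(cube (0 : E) (B + 1)))).
    apply/integrableP; split; first exact/measurable_EFinP.
    rewrite (eq_integral (fun x => (\1_(cube (0 : E) (B + 1)) x)%:E)).
      by rewrite integral_indic // setIT; exact: lebesgue_rV_cube.
    by move=> x _; rewrite /= ger0_norm.
  - move=> m x _; rewrite /= lee_fin /q indicE.
    case: (boolP (x \in _)) => [_|].
      rewrite mulr1 normrM ger0_norm // mulrC -ler_pdivlMr ?ltr0n //.
      by apply: line_mean_value; [rewrite invr_ge0|exact: dphi|exact: DM].
    rewrite notin_setE => nx; rewrite mulr0 !off ?subr0 ?mulr0 ?normr0 //.
      by move=> /KB xB; apply: nx => j; apply: le_trans (xB j) _; rewrite lerDl.
    move=> /KB xB; apply: nx => j; have := xB j; rewrite !mxE eqxx !subr0 /= => hj.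
    rewrite -[x _ _](addrK (m.+1%:R^-1 * (j == i)%:R)); apply: le_trans (ler_normB _ _) _.
    apply: lerD => //; rewrite ger0_norm ?mulr_ge0 ?invr_ge0 //.
    by rewrite -[leRHS]mulr1 ler_pM ?invr_ge0 ?invf_le1 ?ltr0n ?ler1n // lern1 leq_b1.
move: dc; under eq_fun do rewrite q0.
by move=> /(cvg_unique _ (@cvg_cst _ _ _ _ _)) <-.
Qed.

Lemma prodfun_support (c : E) r (psi : 'I_n -> R -> R) :
  (forall j y, psi j y != 0 -> `|y - c ord0 j| <= r) ->
  closure [set x | prodfun psi x != 0] `<=` cube c r.
Proof.
move=> suppsi; rewrite [X in _ `<=` X](iffLR (closure_id _) (@cube_closed R n c r)).
by apply: closureS => x /= /prodf_neq0 nz j; apply: suppsi; exact: nz.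
Qed.

Lemma prodfun_test (c : E) r (psi : 'I_n -> R -> R) : cube c r `<=` S ->
  (forall j, smooth1 (psi j)) -> (forall j y, psi j y != 0 -> `|y - c ord0 j| <= r) ->
  test_function S (prodfun psi).
Proof.
move=> cS spsi suppsi; have sub := prodfun_support suppsi.
split; [exact: smooth_prodfun| |exact: subset_trans sub cS].
refine (subclosed_compact (@closed_closure _ _) (@cube_compact R n c r) sub).
Qed.

Lemma normr_coord_le_enorm (x : E) i : `|x ord0 i| <= enorm x.
Proof.
rewrite -sqrtr_sqr /enorm ler_wsqrtr // /dotv (bigD1 i) //= -expr2 lerDl.
by apply: sumr_ge0 => j _; rewrite -expr2 sqr_ge0.
Qed.

Lemma enorm_ge0 (x : E) : 0 <= enorm x.
Proof. exact: sqrtr_ge0. Qed.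

Lemma enorm_sqr (x : E) : enorm x ^+ 2 = dotv x x.
Proof.
rewrite sqr_sqrtr //; apply: sumr_ge0 => j _; by rewrite -expr2 sqr_ge0.
Qed.

Lemma enorm_le_sum (x : E) : enorm x <= \sum_(i < n) `|x ord0 i|.
Proof.
rewrite -(@ler_pXn2r _ 2) ?nnegrE ?enorm_ge0 ?sumr_ge0 // enorm_sqr.
rewrite expr2 mulr_sumr; apply: ler_sum => i _.
rewrite (le_trans (ler_norm _)) // normrM ler_wpM2r //.
by rewrite (bigD1 i) //= lerDl sumr_ge0.
Qed.

Lemma enormZ (a : R) (x : E) : enorm (a *: x) = `|a| * enorm x.
Proof.
rewrite /enorm /dotv -sqrtr_sqr -sqrtrM ?sqr_ge0 //; congr Num.sqrt.
by rewrite mulr_sumr; apply: eq_bigr => i _; rewrite !mxE expr2 mulrACA.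
Qed.

Lemma measurable_coord D G i : measurable_fun D G ->
  measurable_fun D (fun x => G x ord0 i).
Proof. by move=> mG; apply: (measurableT_comp (measurable_rV_coord i) mG). Qed.

Lemma measurable_rV_of_coord D G : measurable D ->
  (forall i, measurable_fun D (fun x => G x ord0 i)) -> measurable_fun D G.
Proof.
move=> mD mG.
have h : measurable_fun setT (fun x => if x \in D then G x else 0).
  apply: measurable_fun_rVP => i.
  apply: (eq_measurable_fun ((fun x => G x ord0 i) \_ D)).
    by move=> x _; rewrite patchE /= /rV_coord; case: ifPn => //; rewrite mxE.
  exact: ((measurable_restrictT _ mD).1 (mG i)).
apply: (eq_measurable_fun (fun x => if x \in D then G x else 0)); last exact: measurable_funTS.
by move=> x ->.
Qed.

Lemma measurable_dotv D G H : measurable_fun D G -> measurable_fun D H ->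
  measurable_fun D (fun x => dotv (G x) (H x)).
Proof.
move=> mG mH; apply: measurable_sum => i.
by apply: measurable_funM; exact: measurable_coord.
Qed.

Lemma measurable_enorm D G : measurable_fun D G -> measurable_fun D (enorm \o G).
Proof.
move=> mG; apply: (@measurableT_comp _ _ _ _ _ _ (@Num.sqrt R)); last exact: measurable_dotv.
by apply: continuous_measurable_fun; exact: sqrt_continuous.
Qed.

Lemma inL1locP f : inL1loc S f <-> measurable_fun S f /\
  forall K, compact K -> K `<=` S -> mu.-integrable K (EFin \o f).
Proof.
split=> -[mf h]; split => // K cK KS; have mK := compact_measurable_rV cK.
  apply/integrableP; split; last exact: h.
  by apply/measurable_EFinP; exact: measurable_funS mf.
by have /integrableP[] := h K cK KS.
Qed.

Lemma inL1loc_vecP G : inL1loc_vec S G <-> measurable_fun S G /\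
  forall i K, compact K -> K `<=` S -> mu.-integrable K (fun x => (G x ord0 i)%:E).
Proof.
split=> -[mG h]; split => //.
  move=> i K cK KS; have mK := compact_measurable_rV cK.
  have mGK : measurable_fun K G by exact: measurable_funS mG.
  apply/integrableP; split; first by apply/measurable_EFinP; exact: (measurable_coord i mGK).
  apply: le_lt_trans (h K cK KS); apply: ge0_le_integral => //=.
  - by apply/measurable_EFinP; apply: measurableT_comp => //; exact: (measurable_coord i mGK).
  - by apply/measurable_EFinP; exact: measurable_enorm.
  - by move=> x _; rewrite lee_fin normr_coord_le_enorm.
move=> K cK KS; have mK := compact_measurable_rV cK.
have mGK : measurable_fun K G by exact: measurable_funS mG.
have intS : mu.-integrable K (fun x => (\sum_(i < n) `|G x ord0 i|%:E)%E).
  by apply: integrable_sum => // i _; exact: (integrable_abse (h i K cK KS)).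
have /integrableP[ms] := intS; apply: le_lt_trans; apply: ge0_le_integral => //=.
- by move=> x _; rewrite lee_fin enorm_ge0.
- by apply/measurable_EFinP; exact: measurable_enorm.
- exact: measurableT_comp.
- move=> x _; rewrite sumEFin /= lee_fin; apply: le_trans (ler_norm _).
  exact: enorm_le_sum.
Qed.

End test_functions.

(** * Weak gradients and their locality *)

Section weak_gradients.
Context {R : realType} {n : nat}.
Variable S : set 'rV[R]_n.
Hypothesis oS : open S.
Local Notation E := 'rV[R]_n.
Local Notation mu := (@lebesgue_rV R n).
Implicit Types (f g phi h : E -> R) (G H : E -> E).

Let mS : measurable S. Proof. exact: open_measurable_rV. Qed.

Lemma integrable_weak f phi i : inL1loc S f -> test_function S phi ->
  mu.-integrable S (EFin \o (fun x => f x * 'D_(basis_vec i) phi x)).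
Proof.
move=> /(inL1locP oS)[mf hf] /test_functionP [cK KS cphi off dphi cD Doff].
exact: (integrable_mul_off_compact oS mf cK KS (hf _ cK KS) (cD i) (Doff i)).
Qed.

Lemma integrable_weak_vec G phi i : inL1loc_vec S G -> test_function S phi ->
  mu.-integrable S (EFin \o (fun x => G x ord0 i * phi x)).
Proof.
move=> /(inL1loc_vecP oS)[mG hG] /test_functionP [cK KS cphi off dphi cD Doff].
exact: (integrable_mul_off_compact oS (measurable_coord i mG) cK KS (hG i _ cK KS) cphi off).
Qed.

Lemma integrable_partial phi i : test_function S phi ->
  mu.-integrable S (EFin \o 'D_(basis_vec i) phi).
Proof.
move=> /test_functionP [cK KS cphi off dphi cD Doff].
have := @integrable_mul_off_compact R n S oS (cst 1) _ _ _ cK KS _ (cD i) (Doff i).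
move=> /(_ (measurable_cst _)) h.
suff /h : mu.-integrable (closure [set x | phi x != 0]) (EFin \o cst (1 : R)).
  by apply: eq_integrable => // x _; rewrite /= mul1r.
apply: measurable_bounded_integrable => //.
- exact: compact_measurable_rV.
- exact: compact_lebesgue_rV.
- by exists 1; split => // M /ltW M1 x _; rewrite /= normr1.
Qed.

Lemma Rintegral_partial0 phi i : test_function S phi ->
  \int[mu]_(x in S) 'D_(basis_vec i) phi x = 0.
Proof.
move=> /test_functionP tp; have [cK KS cphi off dphi cD Doff] := tp.
rewrite /Rintegral integral_mkcond (eq_integral (fun x => ('D_(basis_vec i) phi x)%:E)).
  by rewrite (integral_partial0 i tp).
move=> x _; rewrite patchE; case: ifPn => //; rewrite notin_setE => nS.
by rewrite Doff // => /KS.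
Qed.

Lemma is_weak_gradient_lin f g G H (a b d : R) :
  is_weak_gradient S f G -> is_weak_gradient S g H ->
  is_weak_gradient S (fun x => a * f x + b * g x + d)
    (fun x => a *: G x + b *: H x).
Proof.
move=> [lf lG wf] [lg lH wg]; split.
- have [mf hf] := (inL1locP oS f).1 lf; have [mg hg] := (inL1locP oS g).1 lg.
  apply/inL1locP => //; split.
    by apply: measurable_funD => //; apply: measurable_funD; exact: measurable_funM.
  move=> K cK KS; have mK := compact_measurable_rV cK.
  have ic : mu.-integrable K (EFin \o cst d).
    apply: measurable_bounded_integrable => //; first exact: compact_lebesgue_rV.
    by exists `|d|; split => // M /ltW M1 x _.
  have := integrableD mK (integrableD mK (integrableZl mK a (hf K cK KS))
    (integrableZl mK b (hg K cK KS))) ic.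
  by apply: eq_integrable.
- have [mG hG] := (inL1loc_vecP oS G).1 lG; have [mH hH] := (inL1loc_vecP oS H).1 lH.
  apply/inL1loc_vecP => //; split.
    apply: measurable_rV_of_coord => // i.
    apply: (eq_measurable_fun (fun x => a * G x ord0 i + b * H x ord0 i)).
      by move=> x _; rewrite !mxE.
    by apply: measurable_funD; apply: measurable_funM => //; exact: measurable_coord.
  move=> i K cK KS; have mK := compact_measurable_rV cK.
  have := integrableD mK (integrableZl mK a (hG i K cK KS)) (integrableZl mK b (hH i K cK KS)).
  by apply: eq_integrable => // x _ /=; rewrite !mxE EFinD !EFinM.
- move=> phi tphi i.
  have if' := integrable_weak i lf tphi; have ig' := integrable_weak i lg tphi.
  have iG' := integrable_weak_vec i lG tphi; have iH' := integrable_weak_vec i lH tphi.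
  have ip := integrable_partial i tphi.
  transitivity (\int[mu]_(x in S) (a * (f x * 'D_(basis_vec i) phi x) +
    b * (g x * 'D_(basis_vec i) phi x) + d * 'D_(basis_vec i) phi x)).
    by apply: eq_Rintegral => x _; rewrite !mulrDl !mulrA.
  have iaf := integrableZl mS a if'; have ibg := integrableZl mS b ig'.
  have idp := integrableZl mS d ip.
  rewrite RintegralD //; last exact: (integrableD mS iaf ibg).
  rewrite RintegralD // !RintegralZl // Rintegral_partial0 // mulr0 addr0 wf // wg //.
  rewrite !mulrN -opprD -!RintegralZl //.
  rewrite -RintegralD //; [|exact: (integrableZl mS a iG')|exact: (integrableZl mS b iH')].
  by congr (- _); apply: eq_Rintegral => x _; rewrite !mxE mulrDl !mulrA.
Qed.

Lemma is_weak_gradient_cst (d : R) : is_weak_gradient S (cst d) (cst 0).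
Proof.
split.
- apply/inL1locP => //; split; first exact: measurable_cst.
  move=> K cK KS; have mK := compact_measurable_rV cK.
  apply: measurable_bounded_integrable => //; first exact: compact_lebesgue_rV.
  by exists `|d|; split => // M /ltW M1 x _.
- apply/inL1loc_vecP => //; split; first exact: measurable_cst.
  move=> i K cK KS; have mK := compact_measurable_rV cK.
  have := @integrable0 _ E R mu K.
  by apply: eq_integrable => // x _ /=; rewrite mxE.
- move=> phi tphi i; under eq_Rintegral do rewrite /=.
  rewrite RintegralZl //; last exact: integrable_partial.
  rewrite Rintegral_partial0 // mulr0; apply/esym/eqP; rewrite oppr_eq0; apply/eqP.
  by under eq_Rintegral do rewrite mxE mul0r; rewrite Rintegral_cst // mul0r.
Qed.

(** Product bumps on a ball whose doubled cube lies in [S] are test functions, so the fundamental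
    lemma applies to each coordinate of [G], ball by ball. *)
Lemma weak_gradient_zero G : is_weak_gradient S (cst 0) G ->
  {ae mu, forall x, S x -> G x = 0}.
Proof.
move=> [_ lG w]; have [mG hG] := (inL1loc_vecP oS G).1 lG.
have hi i : {ae mu, forall x, S x -> G x ord0 i = 0}.
  apply: ae_open_rat_balls => // c r r0 crS.
  have c2 : ball c r `<=` cube c (2 * r).
    rewrite ball_rVE // => x xc j; apply: le_trans (ltW (xc j)) _.
    by rewrite ler_peMl ?ler1n // ltW.
  have ig : mu.-integrable (ball c r) (EFin \o (fun x => G x ord0 i)).
    apply: integrableS (hG i _ (@cube_compact R n c (2 * r)) crS) => //.
    - exact: measurable_cube.
    - exact: measurable_ball_rV.
  apply: (ball_fundamental_lemma r0 ig) => psi spsi suppsi.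
  have tp : test_function S (prodfun psi).
    apply: (prodfun_test crS) => // j y /suppsi /ltW h; apply: le_trans h _.
    by rewrite ler_peMl ?ler1n // ltW.
  have ip := integrable_weak_vec i lG tp.
  have := w _ tp i; rewrite (_ : \int[mu]_(x in S) _ = 0); last first.
    by under eq_Rintegral do rewrite /= mul0r; rewrite Rintegral_cst // mul0r.
  move=> /eqP; rewrite eq_sym oppr_eq0 => /eqP h0.
  transitivity (\int[mu]_(x in S) (G x ord0 i * prodfun psi x)%:E)%E; last first.
    by rewrite -[LHS]fineK ?integrable_fin_num // -/(Rintegral _ _ _) h0.
  rewrite [LHS]integral_mkcond [RHS]integral_mkcond; apply: eq_integral => x _.
  rewrite !patchE; case: ifPn => [/set_mem xb|].
    by rewrite (mem_set (crS _ (c2 _ xb))).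
  rewrite notin_setE ball_rVE // => /existsNP[j hj].
  have -> : prodfun psi x = 0.
    apply/eqP; rewrite /prodfun prodf_seq_eq0; apply/hasP; exists j => /=.
      by rewrite mem_index_enum.
    by apply/negPn/negP => /suppsi.
  by rewrite mulr0; case: ifPn.
have : {ae mu, forall x i, S x -> G x ord0 i = 0} by apply: ae_forall_count.
apply: filterS => x hx Sx; apply/rowP => i; rewrite mxE; exact: hx.
Qed.

Lemma weak_gradient_unique f G H : is_weak_gradient S f G -> is_weak_gradient S f H ->
  {ae mu, forall x, S x -> G x = H x}.
Proof.
move=> wG wH; have := is_weak_gradient_lin 1 (-1) 0 wG wH.
have -> : (fun x => 1 * f x + -1 * f x + 0) = cst 0.
  by apply/funext => x; rewrite mul1r mulN1r subrr add0r.
move=> /weak_gradient_zero; apply: filterS => x h /h /eqP.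
by rewrite scale1r scaleN1r subr_eq0 => /eqP.
Qed.

Lemma wgradP f : weakly_differentiable S f -> is_weak_gradient S f (wgrad S f).
Proof. by move=> [G wG]; rewrite /wgrad; case: xgetP => [//|/(_ G)]. Qed.

Lemma wgradE f G : is_weak_gradient S f G -> {ae mu, forall x, S x -> wgrad S f x = G x}.
Proof.
by move=> wG; apply: (weak_gradient_unique _ wG); apply: wgradP; exists G.
Qed.

End weak_gradients.

(** * Increments and averages along lines *)

Section locality.
Context {R : realType} {n : nat}.
Local Notation E := 'rV[R]_n.
Local Notation mu := (@lebesgue_rV R n).
Local Notation leb1 := (@lebesgue_measure R).

Lemma strip_finite (h : R) : (leb1 `[0%R, h] < +oo)%E.
Proof. by rewrite lebesgue_measure_itv /=; case: ifP; rewrite ltry. Qed.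

Lemma measurable_line_comp (e : E) (g : E -> R) : measurable_fun setT g ->
  measurable_fun setT (fun z : measurableTypeR R * E => g (z.2 + (z.1 : R) *: e)).
Proof. by move=> mg; exact: (measurableT_comp mg (measurable_line e)). Qed.

Lemma integral_bounded_mul (f phi : E -> R) (M : R) :
  measurable_fun setT phi -> (forall x, `|phi x| <= M) ->
  mu.-integrable setT (EFin \o f) ->
  (\int[mu]_x `|f x * phi x|%:E <= M%:E * \int[mu]_x `|f x|%:E)%E.
Proof.
move=> mphi phiM /integrableP[/measurable_EFinP mf _].
have M0 : 0 <= M by apply: le_trans (phiM 0).
rewrite -ge0_integralZl //; last by apply/measurable_EFinP; exact: measurableT_comp.
apply: ge0_le_integral => //.
- by apply/measurable_EFinP; apply: measurableT_comp => //; exact: measurable_funM.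
- by apply/measurable_EFinP; apply: measurable_funM => //; exact: measurableT_comp.
- by move=> x _; rewrite -EFinM lee_fin normrM mulrC ler_wpM2r.
Qed.

Lemma integrable_mul_bounded (f phi : E -> R) (M : R) :
  measurable_fun setT phi -> (forall x, `|phi x| <= M) ->
  mu.-integrable setT (EFin \o f) -> mu.-integrable setT (fun x => (f x * phi x)%:E).
Proof.
move=> mphi phiM if'.
apply: (integrableMl measurableT if' mphi).
by exists M; split; [exact: num_real|move=> M' /ltW MM' x _; exact: le_trans MM'].
Qed.

(** The integral of [g] along the segment from [x] to [x + h e]. Where it is infinite, on a null set
    of [x] if [g] is integrable, the value is the default 0. *)
Definition line_int (g : E -> R) (e : E) (h : R) (x : E) : R :=
  \int[leb1]_(s in `[0, h]) g (x + s *: e).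

Section increments.
Variables (f g phi phi' : E -> R) (e : E) (h Mphi : R).
Hypotheses (if_ : mu.-integrable setT (EFin \o f))
  (ig_ : mu.-integrable setT (EFin \o g)) (h0 : 0 < h)
  (cphi : continuous phi) (cphi' : continuous phi')
  (phiM : forall x, `|phi x| <= Mphi) (phi'M : forall x, `|phi' x| <= Mphi)
  (dphi : forall x (s : R), is_derive s 1 (fun s : R => phi (x - s *: e)) (- phi' (x - s *: e)))
  (weak : forall s, 0 <= s <= h ->
    (\int[mu]_x (f x * phi' (x - s *: e))%:E = - \int[mu]_x (g x * phi (x - s *: e))%:E)%E).

Let mf : measurable_fun setT f.
Proof. by have /integrableP[/measurable_EFinP] := if_. Qed.
Let mg : measurable_fun setT g.
Proof. by have /integrableP[/measurable_EFinP] := ig_. Qed.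
Let mphi : measurable_fun setT phi.
Proof. exact: continuous_measurable_rV. Qed.
Let mphi' : measurable_fun setT phi'.
Proof. exact: continuous_measurable_rV. Qed.
Let mphit (a : E) : measurable_fun setT (fun x : E => phi (x + a)).
Proof. exact: (measurableT_comp mphi (@measurable_translation R n a)). Qed.
Let mphi't (a : E) : measurable_fun setT (fun x : E => phi' (x + a)).
Proof. exact: (measurableT_comp mphi' (@measurable_translation R n a)). Qed.
Let M0 : 0 <= Mphi. Proof. by apply: le_trans (phiM 0). Qed.

Let nrm_fin (k : E -> R) : mu.-integrable setT (EFin \o k) ->
  exists2 C : R, 0 <= C & (Mphi%:E * \int[mu]_x `|k x|%:E = C%:E)%E.
Proof.
move=> /integrableP[mk ik].
have fi : (\int[mu]_x `|k x|%:E)%E \is a fin_num.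
  by rewrite ge0_fin_numE //; exact: integral_ge0.
exists (Mphi * fine (\int[mu]_x `|k x|%:E)%E); last by rewrite EFinM fineK.
by rewrite mulr_ge0 // fine_ge0 // integral_ge0.
Qed.

Let int_phi'_cont x : continuous (fun s : R => phi' (x - s *: e)).
Proof.
move=> s; apply: (@continuous_comp _ _ _ (fun s : R => x - s *: e) phi'); last exact: cphi'.
apply: continuousB; first exact: cst_continuous.
by move=> t; apply: cvgZr_tmp; exact: cvg_id.
Qed.

Let int_phi'_integrable c x :
  leb1.-integrable `[0, h] (fun s => (c * phi' (x - s *: e))%:E).
Proof.
apply: (@integrableZl _ _ _ leb1 _ _ c (fun s => (phi' (x - s *: e))%:E)) => //.
apply: continuous_compact_integrable; first exact: segment_compact.
apply: continuous_subspaceT; exact: int_phi'_cont.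
Qed.

Let int_phi' c x : (\int[leb1]_(s in `[0%R, h]) (c * phi' (x - s *: e))%:E =
  (c * (phi x - phi (x - h *: e)))%:E)%E.
Proof.
pose F (s : R) := - phi (x - s *: e).
have dF (s : R) : is_derive s 1 F (phi' (x - s *: e)).
  by rewrite -[phi' _]opprK; apply: is_deriveN.
have cF : continuous F.
  by move=> s; apply/differentiable_continuous/derivable1_diffP; have [] := dF s.
under eq_integral do rewrite EFinM.
rewrite integralZl //; last first.
  by have := int_phi'_integrable 1 x; apply: eq_integrable => // s _; rewrite mul1r.
rewrite (@continuous_FTC2 _ _ F) //.
- by rewrite -EFinB -EFinM /F scale0r subr0 opprK addrC.
- by apply: continuous_subspaceT; exact: int_phi'_cont.
- split; first by move=> s _; have [] := dF s.
  + by apply: cvg_at_right_filter; exact: cF.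
  + by apply: cvg_at_left_filter; exact: cF.
- by move=> s _; rewrite derive1E; have [_ ->] := dF s.
Qed.

Lemma line_int_integrable : mu.-integrable setT (EFin \o line_int g e h) /\
  {ae mu, forall x, leb1.-integrable `[0, h] (fun s => (g (x + s *: e))%:E)}.
Proof.
have mI : measurable (`[0, h]%classic : set (measurableTypeR R)) by exact: measurable_itv.
have [C C0 Ce] : exists2 C : R, 0 <= C & (\int[mu]_x `|g x|%:E = C%:E)%E.
  have /integrableP[mk ik] := ig_.
  have fi : (\int[mu]_x `|g x|%:E)%E \is a fin_num.
    by rewrite ge0_fin_numE //; exact: integral_ge0.
  exists (fine (\int[mu]_x `|g x|%:E)%E); last by rewrite fineK.
  by rewrite fine_ge0 // integral_ge0.
have bd (s : measurableTypeR R) : `[0, h]%classic s ->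
    (\int[mu]_x `|g (x + (s : R) *: e)|%:E <= C%:E)%E.
  move=> _; rewrite (ge0_integral_translation _ (f := fun x => `|g x|%:E)) ?Ce //.
  by apply/measurable_EFinP; exact: measurableT_comp.
have [ae1 i1 _] := @strip_fubini R n (fun z => g (z.2 + (z.1 : R) *: e)) `[0, h]%classic C
  C0 (measurable_line_comp e mg) mI (strip_finite h) bd.
split=> //; have /integrableP[m1 h1] := i1.
have mlin : measurable_fun setT (line_int g e h).
  exact: (measurableT_comp (@fine_measurable R setT measurableT) m1).
apply: (le_integrable measurableT _ _ i1); first exact/measurable_EFinP.
(* [fine] sends infinite values to 0, so it can only lower the absolute value. *)
by move=> x _ /=; rewrite /line_int /Rintegral; case: integral => [r||] //=; rewrite normr0 leey.
Qed.

(** A weak form of the fundamental theorem of calculus on segments. The weak identity tested with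
    [phi(x - s e)] is integrated over [s] in [[0, h]]: the [f] term is a total derivative in [s],
    and translating [x] moves the shifts from [phi] onto [f] and [g]. *)
Lemma weak_increment :
  (\int[mu]_x ((f x - f (x + h *: e) + line_int g e h x) * phi x)%:E = 0)%E.
Proof.
have [Cf Cf0 Cfe] := nrm_fin if_; have [Cg Cg0 Cge] := nrm_fin ig_.
have mI : measurable (`[0, h]%classic : set (measurableTypeR R)) by exact: measurable_itv.
pose k (z : measurableTypeR R * E) : R :=
  f z.2 * phi' (z.2 - (z.1 : R) *: e) + g (z.2 + (z.1 : R) *: e) * phi z.2.
have mk : measurable_fun setT k.
  apply: measurable_funD; apply: measurable_funM.
  - exact: (measurableT_comp mf measurable_snd).
  - apply: (eq_measurable_fun (fun z : measurableTypeR R * E => phi' (z.2 + (z.1 : R) *: (- e)))).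
      by move=> z _; rewrite scalerN.
    exact: measurable_line_comp.
  - exact: measurable_line_comp.
  - exact: (measurableT_comp mphi measurable_snd).
have mt (l : E -> R) (a : E) : measurable_fun setT l -> measurable_fun setT (fun x : E => l (x + a)).
  by move=> ml; exact: (measurableT_comp ml (@measurable_translation R n a)).
have i1 s : mu.-integrable setT (fun x => (f x * phi' (x - s *: e))%:E).
  by apply: (integrable_mul_bounded (M := Mphi)).
have igt a : mu.-integrable setT (EFin \o (fun x : E => g (x + a))).
  exact: (integrable_translation a ig_).
have ift a : mu.-integrable setT (EFin \o (fun x : E => f (x + a))).
  exact: (integrable_translation a if_).
have i2 s : mu.-integrable setT (fun x => (g (x + s *: e) * phi x)%:E).
  by apply: (integrable_mul_bounded (M := Mphi)).
have bd (s : measurableTypeR R) : `[0, h]%classic s ->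
    (\int[mu]_x `|k (s, x)|%:E <= (Cf + Cg)%:E)%E.
  move=> _.
  apply: (@le_trans _ _ (\int[mu]_x (`|f x * phi' (x - (s : R) *: e)|%:E +
     `|g (x + (s : R) *: e) * phi x|%:E)))%E.
    apply: ge0_le_integral => //.
    - apply/measurable_EFinP; apply: measurableT_comp => //.
      exact: (measurableT_comp mk (pair1_measurable s)).
    - apply: emeasurable_funD; apply/measurable_EFinP; apply: measurableT_comp => //.
      + by apply: measurable_funM.
      + by apply: measurable_funM => //; exact: mt.
    - by move=> x _; rewrite -EFinD lee_fin ler_normD.
  rewrite ge0_integralD //; last 2 first.
  - by apply/measurable_EFinP; apply: measurableT_comp => //; exact: measurable_funM.
  - by apply/measurable_EFinP; apply: measurableT_comp => //; apply: measurable_funM => //; exact: mt.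
  rewrite EFinD -Cfe -Cge; apply: leeD; first exact: integral_bounded_mul.
  rewrite -(ge0_integral_translation (s *: e) (f := fun x => `|g x|%:E)) //; last first.
    by apply/measurable_EFinP; exact: measurableT_comp.
  exact: integral_bounded_mul.
have [_ ik] := @strip_fubini R n k `[0, h]%classic (Cf + Cg) (addr_ge0 Cf0 Cg0) mk mI (strip_finite h) bd.
(* For each fixed [s] the integral over [x] is already 0: translating the right side of the weak
   identity by [s e] gives the [g] term of [k]. *)
rewrite integral0_eq; last first.
  move=> s; rewrite /= in_itv /= => sh; rewrite /k /=.
  under eq_integral do rewrite EFinD.
  rewrite integralD // weak //.
  rewrite -(integral_translation (s *: e) (f := fun x => (g x * phi (x - s *: e))%:E)); last first.
    by apply/measurable_EFinP; exact: measurable_funM.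
  under [X in (- X + _)%E]eq_integral do rewrite addrK.
  by rewrite addeC subee //; exact: integrable_fin_num.
have [il aeg] := line_int_integrable.
have il' : mu.-integrable setT (fun x => (line_int g e h x * phi x)%:E).
  by apply: (integrable_mul_bounded (M := Mphi)).
have ip' : mu.-integrable setT (fun x => (f x * phi x)%:E).
  by apply: (integrable_mul_bounded (M := Mphi)).
have ip'' : mu.-integrable setT (fun x => (f x * phi (x - h *: e))%:E).
  by apply: (integrable_mul_bounded (M := Mphi)).
have ift' : mu.-integrable setT (fun x => (f (x + h *: e) * phi x)%:E).
  by apply: (integrable_mul_bounded (M := Mphi)).
move=> /esym inner.
(* In the other order of integration, the integral over [s] is explicit: a difference of values of
   [phi] for the [f] term, [line_int] for the [g] term. *)
have {inner} : (\int[mu]_x ((f x * phi x)%:E - (f x * phi (x - h *: e))%:E +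
    (line_int g e h x * phi x)%:E) = 0)%E.
  rewrite -inner; apply: ae_eq_integral => //.
  - apply: emeasurable_funD; last exact: (measurable_int _ il').
    by apply: emeasurable_funB; [exact: (measurable_int _ ip')|exact: (measurable_int _ ip'')].
  - exact: (measurable_int _ ik).
  apply: filterS aeg => x ix _; rewrite /k /=.
  have ix' : leb1.-integrable `[0, h] (fun s => (f x * phi' (x - s *: e))%:E).
    exact: int_phi'_integrable.
  under [RHS]eq_integral do rewrite EFinD.
  rewrite integralD //; last first.
    by have := integrableZr mI (phi x) ix; apply: eq_integrable.
  rewrite int_phi'; under [in RHS]eq_integral do rewrite EFinM.
  rewrite integralZr // -EFinB -mulrBr; congr (_ + _)%E.
  by rewrite EFinM /line_int /Rintegral fineK //; exact: integrable_fin_num.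
move=> inner.
have shift : (\int[mu]_x (f x * phi (x - h *: e))%:E = \int[mu]_x (f (x + h *: e) * phi x)%:E)%E.
  rewrite -(integral_translation (h *: e) (f := fun x => (f x * phi (x - h *: e))%:E)).
    by apply: eq_integral => x _; rewrite addrK.
  exact: (measurable_int _ ip'').
under eq_integral do rewrite mulrDl mulrBl EFinD EFinB.
rewrite integralD //; last exact: integrableB.
rewrite integralB // -shift -integralB // -integralD //; last exact: integrableB.
Qed.

End increments.

Lemma lebesgue_integral_translation (a : R) (f : R -> \bar R) :
  measurable_fun [set: measurableTypeR R] (f : measurableTypeR R -> \bar R) ->
  (forall x, 0 <= f x)%E -> (\int[leb1]_x f (x + a)%R = \int[leb1]_x f x)%E.
Proof.
move=> mf f0.
have ma : @measurable_fun _ _ (measurableTypeR R) (measurableTypeR R) setT (fun x => x + a).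
  exact: measurable_funD.
rewrite -(@ge0_integral_pushforward _ _ _ _ _ _ ma leb1 setT f) //.
apply: eq_measure_integral => A mA _; rewrite /= /pushforward.
exact: lebesgue_measure_translation.
Qed.

Lemma lebesgue_Rintegral_translation (a q : R) (k : R -> R) :
  measurable_fun [set: measurableTypeR R] (k : measurableTypeR R -> R) ->
  \int[leb1]_(s in `[0, q]) k (s + a) = \int[leb1]_(s in `[a, a + q]) k s.
Proof.
move=> mk; congr fine.
have mI (x y : R) : measurable (`[x, y]%classic : set (measurableTypeR R)) by exact: measurable_itv.
have inI x : (x + a \in `[a, a + q]) = (x \in `[0, q]).
  by rewrite !in_itv /=; apply/idP/idP => /andP[h1 h2]; apply/andP; split; lra.
rewrite integralE [RHS]integralE; congr (_ - _)%E.
  rewrite [LHS]integral_mkcond [RHS]integral_mkcond.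
  rewrite -[RHS](lebesgue_integral_translation a).
  - apply: eq_integral => x _; rewrite !patchE !mem_setE inI.
    by rewrite !funeposE.
  - refine ((measurable_restrictT _ (mI _ _)).1 _).
  apply: measurable_funTS; apply: measurable_funepos.
    exact/measurable_EFinP.
  - by move=> x; rewrite patchE; case: ifP.
rewrite [LHS]integral_mkcond [RHS]integral_mkcond.
rewrite -[RHS](lebesgue_integral_translation a).
- apply: eq_integral => x _; rewrite !patchE !mem_setE inI.
  by rewrite !funenegE.
- refine ((measurable_restrictT _ (mI _ _)).1 _).
  apply: measurable_funTS; apply: measurable_funeneg.
  exact/measurable_EFinP.
- by move=> x; rewrite patchE; case: ifP.
Qed.

(** At almost every [s] the primitive of [k] has derivative [k s], while its difference quotients
    along the given steps, which tend to 0, all vanish. *)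
Lemma null_right_averages (k : R -> R) : leb1.-integrable setT (EFin \o k) ->
  {ae leb1, forall s, (forall m : nat, exists q : rat,
    [/\ 0 < ratr q :> R, ratr q < m.+1%:R^-1 :> R &
       \int[leb1]_(x in `[s, s + ratr q]) k x = 0]) -> k s = 0}.
Proof.
move=> ik; have /integrableP[/measurable_EFinP mk _] := ik.
have iS (A : set (measurableTypeR R)) : measurable A -> leb1.-integrable A (EFin \o k).
  by move=> mA; apply: integrableS ik.
have lk : locally_integrable setT k.
  split; [by []|exact: openT|move=> K _ cK].
  have mK : measurable (K : set (measurableTypeR R)) by exact: compact_measurable.
  by have /integrableP[] := iS K mK.
have := FTC1Ny (fun y => iS _ (measurable_itv `]-oo, y])) lk.
set F := fun x => \int[leb1]_(t in _) k t.
cbv zeta; apply: (@filterS _ _ (ae_filter_ringOfSetsType leb1)) => s [dF F's] hs; rewrite -F's derive1E.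
have [q hq] := choice hs.
pose u m : R := ratr (q m).
have u0 : u @ \oo --> (0 : R).
  apply: (@squeeze_cvgr _ _ _ _ (cst 0) (fun m => m.+1%:R^-1)).
  - by apply: nearW => m; have [h1 h2 _] := hq m; rewrite /u !ltW.
  - exact: cvg_cst.
  - exact: cvg_harmonic.
have /cvgr_dnbhsP : (fun h : R => h^-1 *: ((F \o shift s) (h *: (1 : R)) - F s)) @ 0^' --> 'D_1 F s.
  exact: dF.
move=> /(_ u); have -> : (fun m => (u m)^-1 *: ((F \o shift s) (u m *: (1 : R)) - F s)) = cst 0.
  apply/funext => m; have [h1 h2 h3] := hq m.
  rewrite /= /GRing.scale /= mulr1 [u m + s]addrC /F Rintegral_itvB ?bnd_simp //.
  - by rewrite Rintegral_itv_obnd_cbnd ?h3 ?mulr0 //; apply: iS; exact: measurable_itv.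
  - by apply: iS; exact: measurable_itv.
  - by rewrite lerDl ltW.
move=> h; have {h} : (0 : R) @[m --> \oo] --> 'D_1 F s.
  by apply: h; split => // m; have [h1 _ _] := hq m; rewrite gt_eqF.
by move=> /(cvg_unique _ (@cvg_cst _ _ _ _ _)) <-.
Qed.

(** Tonelli reduces the claim to single lines: the measure of the exceptional set is the average of
    the measures of its translates along [e], and almost every line meets it in a null set by
    [null_right_averages]. Rational step lengths make the exceptional set measurable. *)
Lemma null_line_averages (g : E -> R) (e : E) : mu.-integrable setT (EFin \o g) ->
  {ae mu, forall z, (forall m : nat, exists q : rat,
    [/\ 0 < ratr q :> R, ratr q < m.+1%:R^-1 :> R & line_int g e (ratr q) z = 0]) ->
    g z = 0}.
Proof.
move=> ig; have /integrableP[/measurable_EFinP mg _] := ig.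
pose A (q : rat) := [set z | line_int g e (ratr q) z = 0].
have mA q : measurable (A q).
  have [/integrableP[/measurable_EFinP ml _] _] := line_int_integrable e (ratr q) ig.
  by have := ml measurableT _ (measurable_set1 0); rewrite setTI.
pose N := [set z | g z != 0] `&` \bigcap_m \bigcup_(q in [set q : rat |
  0 < ratr q :> R /\ ratr q < m.+1%:R^-1 :> R]) A q.
have mN : measurable N.
  apply: measurableI.
    have := mg measurableT _ (measurableC (measurable_set1 0)); rewrite setTI.
    by congr measurable; apply/seteqP; split => z /= /eqP.
  apply: bigcapT_measurable => m; rewrite bigcup_mkcond.
  by apply: bigcupT_measurable_rat => q; case: ifP.
exists N; split => //; last first.
  move=> z /= /not_implyP[h gz]; split; first exact/eqP.
  by move=> m _; have [q [h1 h2 h3]] := h m; exists q.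
(* A strip of width 1, so that integrating over the shifts reproduces [mu N] exactly. *)
pose J : set (measurableTypeR R) := `]0, 1[%classic.
have mJ : measurable J by exact: measurable_itv.
pose f (z : measurableTypeR R * E) : \bar R := (\1_J z.1 * \1_N (z.2 + (z.1 : R) *: e))%:E.
have mf : measurable_fun setT f.
  apply/measurable_EFinP; apply: measurable_funM; last exact: measurable_line_comp.
  by apply: (@measurableT_comp _ _ _ _ _ _ (\1_J : _ -> R) _ fst).
have f0 z : (0 <= f z)%E by rewrite lee_fin mulr_ge0.
have := @fubini_tonelli _ _ _ _ _ leb1 mu f mf f0.
have -> : (\int[leb1]_s \int[mu]_z f (s, z) = mu N)%E.
  transitivity (\int[leb1]_(s in J) mu N)%E.
    rewrite [RHS]integral_mkcond; apply: eq_integral => s _; rewrite patchE /f /= indicE.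
    case: ifPn => [_|_]; last first.
      by rewrite integral0_eq // => x _; rewrite mul0r.
    under eq_integral do rewrite mul1r.
    rewrite (ge0_integral_translation (s *: e) (f := fun x => (\1_N x)%:E)) //.
      by rewrite integral_indic // setIT.
    exact/measurable_EFinP.
  transitivity (mu N * leb1 J)%E; first by rewrite integral_cst.
  by rewrite lebesgue_measure_itv /= lte_fin ltr01 oppr0 adde0 mule1.
move=> ->; rewrite (ae_eq_integral (cst 0%E)) ?integral0 //.
  exact: (@measurable_fun_fubini_tonelli_G _ _ _ _ _ leb1 f mf f0).
have [_] := line_int_integrable e 2 ig; apply: filterS => z iz _ /=.
(* Segments that start at [s < 1] and have length at most 1 stay in [[0, 2]]; cutting off there
   makes the restriction to the line integrable. *)
pose k (s : R) : R := if s \in `[0, 2] then g (z + s *: e) else 0.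
have kE : EFin \o k = (fun s => (g (z + s *: e))%:E) \_ `[0, 2].
  by apply/funext => s; rewrite patchE mem_setE /k /=; case: ifP.
have ik : leb1.-integrable setT (EFin \o k).
  have m02 : measurable (`[0%R, 2%R]%classic : set (measurableTypeR R)) by exact: measurable_itv.
  by rewrite kE; refine ((integrable_mkcond _ m02).1 iz).
have mfz : measurable_fun setT (fun s => f (s, z)).
  exact: (measurableT_comp mf (pair2_measurable z)).
rewrite (ae_eq_integral (cst 0%E)) ?integral0 //.
apply: (@filterS _ _ (ae_filter_ringOfSetsType leb1) _ _ _ (null_right_averages ik)) => s hs _.
rewrite /f /=; apply/eqP; rewrite eqe mulf_eq0 !indicE.
have [sJ|sJ] := boolP (s \in J); last by rewrite eqxx.
have [sN|sN] := boolP (_ \in N); last by rewrite eqxx orbT.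
exfalso; move: sJ sN => /set_mem; rewrite /J /= in_itv /= => /andP[s0 s1] /set_mem[/= gz hz].
have s02 : s \in `[0, 2] by rewrite in_itv /=; apply/andP; split; lra.
move: gz; rewrite (_ : g _ = k s); last by rewrite /k s02.
rewrite hs ?eqxx // => m; have [q /= [q0 qm] Aq] := hz m I; exists q; split => //.
have q1 : ratr q <= 1 :> R by apply: le_trans (ltW qm) _; rewrite invf_le1 ?ler1n ?ltr0n.
rewrite -Aq /line_int.
have mk : measurable_fun setT (k : measurableTypeR R -> R).
  by have /integrableP[/measurable_EFinP] := ik.
rewrite -lebesgue_Rintegral_translation //; apply: eq_Rintegral => x.
rewrite inE /= in_itv /= => /andP[x0 xq].
rewrite /k ifT; first by rewrite scalerDl addrAC addrA.
by rewrite in_itv /=; apply/andP; split; lra.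
Qed.

(* Otherwise infinitely many translates of a set of positive measure would be disjoint inside a
   bounded set. *)
Lemma no_return (Z : set E) (e : E) (d M : R) : measurable Z -> 0 < d -> Z `<=` cube 0 M ->
  {ae mu, forall z, Z z -> exists q : rat, [/\ 0 < ratr q :> R, ratr q < d & Z (z + ratr q *: e)]}.
Proof.
move=> mZ d0 ZM.
have mtr (a : E) (A : set E) : measurable A -> measurable ((fun x => x + a) @^-1` A).
  by move=> mA; rewrite -[X in measurable X]setTI; exact: measurable_translation.
pose Q := [set q : rat | 0 < ratr q :> R /\ ratr q < d].
pose B := Z `\` \bigcup_(q in Q) ((fun x => x + ratr q *: e) @^-1` Z).
have mB : measurable B.
  apply: measurableD => //; rewrite bigcup_mkcond.
  by apply: bigcupT_measurable_rat => q; case: ifP => // _; exact: mtr.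
exists B; split => //; last first.
  move=> z /= /not_implyP[Zz h]; split => //= -[q [q0 qd] Zq]; apply: h; by exists q.
have [d' /itvP d'P] := rat_in_itvoo d0.
have d'0 : 0 < ratr d' :> R by rewrite d'P.
pose q (m : nat) : rat := d' / m.+1%:R.
have qE m : ratr (q m) = ratr d' / m.+1%:R :> R by rewrite /q rmorphM fmorphV rmorph_nat.
have qpos m : 0 < ratr (q m) :> R by rewrite qE divr_gt0.
have qd m : ratr (q m) < d.
  apply: le_lt_trans (_ : ratr d' < d); last by rewrite d'P.
  by rewrite qE ler_pdivrMr ?ltr0n // ler_peMr ?ler1n //; exact: ltW.
pose F m := (fun x => x - ratr (q m) *: e) @^-1` B.
have mF m : measurable (F m) by exact: mtr.
have muF m : mu (F m) = mu B by exact: lebesgue_rV_translation.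
have lt_q i j : (i < j)%N -> ratr (q j) < ratr (q i) :> R.
  by move=> ij; rewrite !qE ltr_pM2l // ltf_pV2 ?posrE ?ltr0n // ltr_nat.
(* A common point would give a point of [B] the return time [q i - q j], again a positive rational
   below [d]. *)
have disj i j z : (i < j)%N -> F i z -> F j z -> False.
  move=> ij [Zi nBi] [Zj nBj]; apply: nBi => //=.
  exists (q i - q j) => /=.
    rewrite /Q /= rmorphB /=; have := lt_q _ _ ij; have := qd i; have := qpos j; lra.
  by rewrite rmorphB /= scalerBl addrA subrK.
have tF : trivIset setT F.
  apply/trivIsetP => i j _ _ ij; rewrite -subset0 => z [Fi Fj].
  by move: ij; rewrite neq_ltn => /orP[] h; [exact: (disj _ _ _ h Fi Fj)|exact: (disj _ _ _ h Fj Fi)].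
(* The shifts are shorter than [d], so this larger cube contains every translate. *)
pose C := M + d * `|e|.
have FC m : F m `<=` cube 0 C.
  move=> z [Zz _] i; have := ZM _ Zz i; rewrite !mxE !subr0 => hz.
  rewrite -[z _ _](subrK (ratr (q m) * e ord0 i)); apply: le_trans (ler_normD _ _) _.
  apply: lerD => //; rewrite normrM ger0_norm ?ler_pM ?normr_coord_le //; exact: ltW.
have cfin : mu (cube 0 C) \is a fin_num by rewrite ge0_fin_numE // lebesgue_rV_cube.
have Bfin : mu B \is a fin_num.
  rewrite ge0_fin_numE // -(muF 0%N); apply: le_lt_trans (lebesgue_rV_cube n C).
  by apply: le_measure; rewrite ?inE //; exact: measurable_cube.
have muB k : k%:R * fine (mu B) <= fine (mu (cube (0 : E) C)).
  rewrite -lee_fin fineK //; apply: (@le_trans _ _ (mu (\big[setU/set0]_(i < k) F i))).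
    rewrite measure_bigsetU // (eq_bigr (fun=> (fine (mu B))%:E)); last first.
      by move=> i _; rewrite fineK //; exact: muF.
    by rewrite sumEFin sumr_const card_ord mulr_natl.
  apply: le_measure; rewrite ?inE.
  - by apply: bigsetU_measurable => i _; exact: mF.
  - exact: measurable_cube.
  - by rewrite -bigcup_mkord => z [m _ /FC].
apply/eqP; rewrite eq_le measure_ge0 andbT leNgt -(fineK Bfin) lte_fin; apply/negP => b0.
have := archi_boundP (divr_ge0 (fine_ge0 (measure_ge0 mu (cube (0 : E) C))) (ltW b0)).
by rewrite ltr_pdivrMr // ltNge muB.
Qed.

End locality.

Section locality_theorem.
Context {R : realType} {n : nat}.
Variable S : set 'rV[R]_n.
Hypothesis oS : open S.
Local Notation E := 'rV[R]_n.
Local Notation mu := (@lebesgue_rV R n).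
Implicit Types (f g : E -> R) (G H : E -> E).

Let mS : measurable S. Proof. exact: open_measurable_rV. Qed.

Section in_a_ball.
Variables (f : E -> R) (G : E -> E) (c : E) (r : R) (i : 'I_n).
Hypotheses (wfG : is_weak_gradient S f G) (r0 : 0 < r) (cS : cube c (2 * r) `<=` S).
Local Notation K := (cube c (2 * r)).
Local Notation e := (@basis_vec R n i).
Let fK : E -> R := f \_ K.
Let gK : E -> R := (fun x => G x ord0 i) \_ K.

Let cK : compact K. Proof. exact: cube_compact. Qed.
Let mK : measurable K. Proof. exact: measurable_cube. Qed.

Let ballK : ball c r `<=` K.
Proof.
rewrite ball_rVE // => x xc j; apply: le_trans (ltW (xc j)) _.
by rewrite ler_peMl ?ler1n // ltW.
Qed.

Let ifK : mu.-integrable setT (EFin \o fK).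
Proof.
have [lf _ _] := wfG; have [_ h] := (inL1locP oS f).1 lf.
have := (integrable_mkcond _ mK).1 (h _ cK cS).
by apply: eq_integrable => // x _; rewrite /fK /= !patchE; case: ifP.
Qed.

Let igK : mu.-integrable setT (EFin \o gK).
Proof.
have [_ lG _] := wfG; have [_ h] := (inL1loc_vecP oS G).1 lG.
have := (integrable_mkcond _ mK).1 (h i _ cK cS).
by apply: eq_integrable => // x _; rewrite /gK /= !patchE; case: ifP.
Qed.

(** [f] and [G] are cut off to the cube, where they are integrable. Bumps supported in the ball and
    translated by [s <= h < r] remain supported in the cube, so they are test functions on [S] and
    do not see the cut-off; [weak_increment] and the fundamental lemma conclude. *)
Lemma ae_increment (h : R) : 0 < h -> h < r ->
  {ae mu, forall x, ball c r x -> fK x - fK (x + h *: e) + line_int gK e h x = 0}.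
Proof.
move=> h0 hr.
have [il _] := line_int_integrable e h igK.
have ift : mu.-integrable setT (EFin \o (fun x : E => fK (x + h *: e))).
  exact: (integrable_translation _ ifK).
have iD : mu.-integrable setT (EFin \o (fun x => fK x - fK (x + h *: e) + line_int gK e h x)).
  have := integrableD measurableT (integrableB measurableT ifK ift) il.
  by apply: eq_integrable.
apply: (ball_fundamental_lemma r0).
  by apply: integrableS iD => //; exact: measurable_ball_rV.
move=> psi spsi suppsi.
pose phi := prodfun psi; pose phi' := prodfun (upd psi i (derive1 (psi i))).
(* Translation along [e] changes only the [i]-th factor, so the translated bump is again a product
   function. *)
pose psis s := upd psi i (fun y => psi i (1 * y + - s)).
have phisE s : prodfun (psis s) = fun x => phi (x - s *: e).
  apply/funext => x; rewrite /phi /prodfun; apply: eq_bigr => j _.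
  rewrite /psis /upd !mxE eqxx /=; case: eqP => [->|_].
    by rewrite mul1r mulr1.
  by rewrite mulr0 subr0.
have dphi x : is_derive x e phi (phi' x) by exact: is_derive_prodfun.
have Dphis s x : 'D_e (prodfun (psis s)) x = phi' (x - s *: e).
  by rewrite phisE; have [_ ->] := is_derive_translate (dphi (x - s *: e)).
have supps s : 0 <= s <= h -> forall j y, psis s j y != 0 -> `|y - c ord0 j| <= 2 * r.
  move=> /andP[s0 sh] j y; rewrite /psis /upd; have [->|_] := eqVneq j i => /suppsi.
    by rewrite !ltr_norml ler_norml => /andP[h1 h2]; apply/andP; split; lra.
  by move=> /ltW hy; apply: le_trans hy _; rewrite ler_peMl ?ler1n // ltW.
have tests s : 0 <= s <= h -> test_function S (prodfun (psis s)).
  move=> sh; apply: (prodfun_test cS) (supps s sh) => j.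
  by rewrite /psis /upd; case: eqP => // _; exact: smooth1_affine.
have offs s x : 0 <= s <= h -> ~ K x -> phi (x - s *: e) = 0 /\ phi' (x - s *: e) = 0.
  move=> sh nK; have := test_functionP (tests s sh) => -[_ _ _ off _ _ Doff].
  have nc : ~ closure [set x | prodfun (psis s) x != 0] x.
    by move=> /(prodfun_support (supps s sh)).
  by rewrite -(Dphis s) Doff // -[phi _]/((fun x => phi (x - s *: e)) x) -phisE off.
have cphi : continuous phi by apply: continuous_prodfun => j; exact: smooth1_continuous.
have cphi' : continuous phi'.
  apply: continuous_prodfun => j; apply: smooth1_continuous.
  by rewrite /upd; case: eqP => // _; exact: smooth1_derive.
have h00 : 0 <= (0 : R) <= h by rewrite lexx ltW.
have off0 x : ~ K x -> phi x = 0 /\ phi' x = 0.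
  by move=> /(offs 0 x h00); rewrite scale0r subr0.
have [M1 M10 phiM1] := continuous_bounded_off_compact cphi cK (fun x hx => (off0 x hx).1).
have [M2 M20 phiM2] := continuous_bounded_off_compact cphi' cK (fun x hx => (off0 x hx).2).
have weak s : 0 <= s <= h ->
    (\int[mu]_x (fK x * phi' (x - s *: e))%:E = - \int[mu]_x (gK x * phi (x - s *: e))%:E)%E.
  move=> sh; have [lf lG w] := wfG.
  have i1 := integrable_weak oS i lf (tests s sh).
  have i2 := integrable_weak_vec oS i lG (tests s sh).
  have := congr1 EFin (w _ (tests s sh) i).
  rewrite /Rintegral EFinN !fineK ?integrable_fin_num // => ws.
  transitivity (\int[mu]_(x in S) (f x * 'D_e (prodfun (psis s)) x)%:E)%E.
    rewrite [RHS]integral_mkcond; apply: eq_integral => x _.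
    rewrite patchE Dphis /fK patchE; case: ifPn => [/set_mem xK|].
      by rewrite (mem_set (cS xK)).
    rewrite notin_setE => /(offs s x sh)[_ ->]; rewrite !mulr0; by case: ifP.
  rewrite ws; congr (- _)%E.
  rewrite [LHS]integral_mkcond; apply: eq_integral => x _.
  rewrite patchE phisE /gK patchE; case: ifPn => [xS|xS].
    case: ifPn => // xK; move: xK; rewrite notin_setE => /(offs s x sh)[-> _].
    by rewrite !mulr0.
  by rewrite ifF ?mul0r //; apply/negbTE; apply: contra xS => /set_mem/cS/mem_set.
have := @weak_increment R n fK gK phi phi' e h (Num.max M1 M2) ifK igK h0 cphi cphi' _ _ _ weak.
have -> : (\int[mu]_(x in ball c r) ((fK x - fK (x + h *: e) + line_int gK e h x) * prodfun psi x)%:E =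
    \int[mu]_x ((fK x - fK (x + h *: e) + line_int gK e h x) * phi x)%:E)%E.
  rewrite [LHS]integral_mkcond; apply: eq_integral => x _.
  rewrite patchE; case: ifPn => //; rewrite notin_setE ball_rVE // => /existsNP[j hj].
  have -> : phi x = 0.
    apply/eqP; rewrite /phi /prodfun prodf_seq_eq0; apply/hasP; exists j => /=.
      by rewrite mem_index_enum.
    by apply/negPn/negP => /suppsi.
  by rewrite mulr0.
apply.
- by move=> x; rewrite le_max phiM1.
- by move=> x; rewrite le_max phiM2 orbT.
- move=> x s.
  have d1 : is_derive (- s) 1 (fun t : R => phi (x + t *: e)) (phi' (x - s *: e)).
    by apply: is_derive_along; rewrite scaleNr.
  have d2 : is_derive s 1 (fun t : R => - t) (-1 : R).
    by apply: is_deriveN; exact: is_derive_id.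
  have := is_derive1_comp d1 d2; rewrite mulrN1.
  by under [X in is_derive _ _ X _ -> _]funext do rewrite /= scaleNr.
Qed.

Lemma ball_locality : {ae mu, forall x, ball c r x -> f x = 0 -> G x ord0 i = 0}.
Proof.
pose Z := ball c r `&` [set x | f x = 0].
have mf : measurable_fun S f by case: wfG => -[].
have mB := @measurable_ball_rV R n c r.
have mZ : measurable Z.
  have := measurable_funS mS (subset_trans ballK cS) mf.
  by move=> h; exact: (h mB _ (measurable_set1 0)).
pose M := 2 * r + `|c|.
have ZM : Z `<=` cube 0 M.
  move=> x [/ballK xK _] j; rewrite mxE subr0 -[x _ _](subrK (c ord0 j)).
  by apply: le_trans (ler_normD _ _) _; apply: lerD; [exact: xK|exact: normr_coord_le].
(* The minimum with [r] puts the returns within the range of [ae_increment]; being rational, they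
   leave only countably many null sets to collect. *)
have ae1 : {ae mu, forall x (m : nat), Z x -> exists q : rat,
    [/\ 0 < ratr q :> R, ratr q < Num.min r (m.+1%:R^-1) & Z (x + ratr q *: e)]}.
  apply/ae_foralln => m; apply: (no_return e mZ _ ZM).
  by rewrite lt_min r0 invr_gt0 ltr0n.
have ae2 : {ae mu, forall x (q : rat), 0 < ratr q :> R -> ratr q < r -> ball c r x ->
    fK x - fK (x + ratr q *: e) + line_int gK e (ratr q) x = 0}.
  apply: ae_forall_count => q.
  have [q0|q0] := ltP 0 (ratr q : R); last first.
    by apply: aeW.
  have [qr|qr] := ltP (ratr q : R) r; last first.
    by apply: aeW.
  have := ae_increment q0 qr; apply: filterS => x h _ _; exact: h.
have ae3 := null_line_averages e igK.
apply: filterS3 ae1 ae2 ae3 => x h1 h2 h3 xB fx.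
have Zx : Z x by [].
rewrite -[LHS](_ : gK x = _); last by rewrite /gK patchE (mem_set (ballK xB)).
apply: h3 => m; have [q [q0]] := h1 m Zx; rewrite lt_min => /andP[qr qm] [Zq fq].
exists q; split => //.
have := h2 q q0 qr xB; rewrite /fK !patchE (mem_set (ballK xB)) (mem_set (ballK Zq)).
by rewrite fx (_ : f _ = 0) // subrr add0r.
Qed.

End in_a_ball.

Lemma weak_gradient_locality f G : is_weak_gradient S f G ->
  {ae mu, forall x, S x -> f x = 0 -> G x = 0}.
Proof.
move=> wfG.
have : {ae mu, forall x i, S x -> f x = 0 -> G x ord0 i = 0}.
  apply: ae_forall_count => i; apply: ae_open_rat_balls => // c r r0 cS.
  exact: ball_locality.
apply: filterS => x hx Sx fx; apply/rowP => i; rewrite mxE; exact: hx.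
Qed.

End locality_theorem.

(** * The operators *)

Section lebesgue_spaces.
Context {R : realType} {n : nat}.
Variable S : set 'rV[R]_n.
Hypotheses (mS : measurable S) (Sfin : (lebesgue_rV n S < +oo)%E).
Local Notation E := 'rV[R]_n.
Local Notation mu := (@lebesgue_rV R n).
Implicit Types (f g : E -> R) (G H : E -> E).

Lemma LnormS1E f : LnormS S 1 f = (\int[mu]_(x in S) `|f x|%:E)%E.
Proof.
rewrite /LnormS Lnorm1 [RHS]integral_mkcond; apply: eq_integral => x _.
by rewrite !patchE; case: ifPn => // _; rewrite abse0.
Qed.

Lemma LnormS_EFinE (r : R) f : r != 0 ->
  LnormS S r%:E f = ((\int[mu]_(x in S) (`|f x| `^ r)%:E) `^ r^-1)%E.
Proof.
move=> r0; rewrite /LnormS unlock; congr (_ `^ _)%E.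
rewrite [RHS]integral_mkcond; apply: eq_integral => x _.
by rewrite !patchE; case: ifPn => //= _; rewrite normr0 powR0.
Qed.

Lemma inLp1P f : inLp S 1 f <-> mu.-integrable S (EFin \o f).
Proof.
rewrite /inLp LnormS1E; split=> [[mf h]|/integrableP[mf h]].
  by apply/integrableP; split => //; exact/measurable_EFinP.
by split => //; exact/measurable_EFinP.
Qed.

Definition ess_bounded f := exists M : R, {ae mu, forall x, S x -> `|f x| <= M}.

Lemma inLpyP f : inLp S +oo f <-> measurable_fun S f /\ ess_bounded f.
Proof.
(* The [L^oo] norm is 0 by convention when the whole space has measure 0; every bound then holds
   almost everywhere. *)
rewrite /inLp /LnormS unlock; case: ifPn => [mu0|mu0]; last first.
  split=> [[mf _]|[mf _]]; split => //.
  exists 0; exists setT; split => //.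
  by apply/eqP; rewrite eq_le measure_ge0 andbT leNgt.
split=> -[mf].
  case E0 : (ess_sup _ _) => [M| |] // _; split => //; last first.
    exists 0; have := ess_sup_ge mu (abse \o ((EFin \o f) \_ S)).
    rewrite E0; apply: filterS => x /= h _.
    by have := le_trans (abse_ge0 (((EFin \o f) \_ S) x)) h; rewrite leeNy_eq.
  exists M; have := ess_sup_ge mu (abse \o ((EFin \o f) \_ S)).
  by rewrite E0; apply: filterS => x /= + Sx; rewrite patchE (mem_set Sx) /= lee_fin.
move=> [M hM]; split => //; apply: (@le_lt_trans _ _ `|M|%:E); last exact: ltry.
apply/ess_supP; apply: filterS hM => x /=.
rewrite patchE; case: ifPn => [/set_mem Sx h|_ _] /=; last by rewrite normr0 lee_fin.
by rewrite lee_fin; apply: le_trans (h Sx) (ler_norm M).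
Qed.

Lemma ess_bounded_integral_powR f (r : R) : 0 <= r -> measurable_fun S f -> ess_bounded f ->
  (\int[mu]_(x in S) (`|f x| `^ r)%:E < +oo)%E.
Proof.
move=> r0 mf [M hM].
apply: (@le_lt_trans _ _ (\int[mu]_(x in S) ((`|M| `^ r)%:E))%E); last first.
  by rewrite integral_cst // lte_mul_pinfty // ?lee_fin ?powR_ge0.
apply: ae_ge0_le_integral => //.
- apply/measurable_EFinP; apply: (measurableT_comp (measurable_powR _)).
  exact: measurableT_comp.
- apply: filterS hM => x h Sx; rewrite lee_fin ge0_ler_powR ?nnegrE //.
  exact: le_trans (h Sx) (ler_norm M).
Qed.

Lemma ess_bounded_inLp f (r : R) : 0 < r -> measurable_fun S f -> ess_bounded f ->
  inLp S r%:E f.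
Proof.
move=> r0 mf bf; split => //; rewrite LnormS_EFinE ?gt_eqF //.
by apply: poweR_lty; apply: ess_bounded_integral_powR => //; exact: ltW.
Qed.

Lemma ess_bounded_affine f (a d : R) : ess_bounded f -> ess_bounded (fun x => a * f x + d).
Proof.
move=> [M hM]; exists (`|a| * M + `|d|); apply: filterS hM => x h Sx.
apply: le_trans (ler_normD _ _) _; rewrite lerD2r normrM ler_wpM2l //; exact: h.
Qed.

Lemma integrable_bounded_mul f g (M : R) : mu.-integrable S (EFin \o f) ->
  measurable_fun S g -> (forall x, `|g x| <= M) ->
  mu.-integrable S (fun x => (f x * g x)%:E).
Proof.
move=> if' mg gM; apply: (integrableMl mS if' mg).
by exists M; split; [exact: num_real|move=> M' /ltW MM' x _; exact: le_trans MM'].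
Qed.

End lebesgue_spaces.

Section operators.
Context {R : realType} {n : nat}.
Variables (S : set 'rV[R]_n) (q : R) (gamma : 'rV[R]_n -> R).
Hypotheses (oS : open S) (Sfin : (lebesgue_rV n S < +oo)%E) (q1 : 1 < q).
Hypotheses (gamma_gt0 : forall x, S x -> 0 < gamma x) (mgamma : measurable_fun S gamma).
Local Notation E := 'rV[R]_n.
Local Notation mu := (@lebesgue_rV R n).
Implicit Types (f g phi h : E -> R) (G H : E -> E).

Let mS : measurable S. Proof. exact: open_measurable_rV. Qed.
Let q0 : 0 < q. Proof. exact: lt_trans q1. Qed.

Lemma measurable_energy G : measurable_fun S G ->
  measurable_fun S (fun x => gamma x * enorm (G x) `^ q).
Proof.
move=> mG; apply: measurable_funM => //.
by apply: (measurableT_comp (measurable_powR _)); exact: measurable_enorm.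
Qed.

Lemma measurable_flux_dot G H : measurable_fun S G -> measurable_fun S H ->
  measurable_fun S (fun x => dotv (flux q gamma G x) (H x)).
Proof.
move=> mG mH; apply: measurable_dotv => //.
apply: measurable_rV_of_coord => // i.
apply: (eq_measurable_fun (fun x => gamma x * enorm (G x) `^ (q - 2) * G x ord0 i)).
  by move=> x _; rewrite /flux mxE.
apply: measurable_funM; last exact: measurable_coord.
apply: measurable_funM => //.
by apply: (measurableT_comp (measurable_powR _)); exact: measurable_enorm.
Qed.

Lemma dotvZl (a : R) (x y : E) : dotv (a *: x) y = a * dotv x y.
Proof. by rewrite /dotv mulr_sumr; apply: eq_bigr => i _; rewrite mxE mulrA. Qed.

Lemma flux_dot_same G x : dotv (flux q gamma G x) (G x) = gamma x * enorm (G x) `^ q.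
Proof.
rewrite /flux dotvZl -enorm_sqr -mulrA; congr (_ * _).
have := enorm_ge0 (G x); rewrite le_eqVlt => /predU1P[<-|e0].
  by rewrite expr2 !mulr0 powR0 // gt_eqF.
by rewrite -powR_mulrn ?enorm_ge0 // -powRD ?subrK // gt_eqF // implybT.
Qed.

(** A coordinatewise substitute for Cauchy-Schwarz. It only serves integrability, so the factor [n]
    does not reach the final constant. *)
Lemma dotv_le (x y : E) : `|dotv x y| <= n%:R * (enorm x * enorm y).
Proof.
apply: le_trans (ler_norm_sum _ _ _) _.
apply: (@le_trans _ _ (\sum_(i < n) enorm x * enorm y)).
  by apply: ler_sum => i _; rewrite normrM ler_pM // normr_coord_le_enorm.
by rewrite sumr_const card_ord mulr_natl.
Qed.

(** With [a], [b] the two norms, [a^(q-1) b] is at most the larger of [a^q] and [b^q], hence at most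
    their sum. *)
Lemma flux_dot_le G H x : S x -> `|dotv (flux q gamma G x) (H x)| <=
  n%:R * (gamma x * enorm (G x) `^ q + gamma x * enorm (H x) `^ q).
Proof.
move=> Sx; have g0 := gamma_gt0 Sx.
rewrite /flux dotvZl normrM ger0_norm ?mulr_ge0 ?powR_ge0 ?(ltW g0) //.
rewrite -mulrDr mulrCA -mulrA ler_wpM2l ?(ltW g0) //.
apply: (@le_trans _ _ (enorm (G x) `^ (q - 2) * (n%:R * (enorm (G x) * enorm (H x))))).
  by rewrite ler_wpM2l ?powR_ge0 // dotv_le.
rewrite mulrCA ler_wpM2l // mulrA.
set a := enorm (G x); set b := enorm (H x).
have a0 : 0 <= a := enorm_ge0 _; have b0 : 0 <= b := enorm_ge0 _.
have pw (c d : R) : 0 <= c -> c != 0 -> c `^ d * c = c `^ (d + 1).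
  by move=> c0 cn; rewrite powRD ?cn ?implybT // powRr1.
have [->|an] := eqVneq a 0.
  by rewrite mulr0 mul0r addr_ge0 ?powR_ge0.
rewrite pw // (_ : q - 2 + 1 = q - 1); last by lra.
have [ab|ba] := leP b a.
  apply: (@le_trans _ _ (a `^ (q - 1) * a)); first by rewrite ler_wpM2l ?powR_ge0.
  by rewrite pw // subrK lerDl powR_ge0.
apply: (@le_trans _ _ (b `^ (q - 1) * b)).
  by rewrite ler_wpM2r // ge0_ler_powR ?nnegrE ?(ltW ba) // subr_ge0 ltW.
by rewrite pw ?subrK ?lerDr ?powR_ge0 // gt_eqF // (le_lt_trans a0).
Qed.

Lemma flux_dot_integrable G H : measurable_fun S G -> measurable_fun S H ->
  (\int[mu]_(x in S) (gamma x * enorm (G x) `^ q)%:E < +oo)%E ->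
  (\int[mu]_(x in S) (gamma x * enorm (H x) `^ q)%:E < +oo)%E ->
  mu.-integrable S (EFin \o (fun x => dotv (flux q gamma G x) (H x))).
Proof.
move=> mG mH EG EH.
have en (K : E -> E) : measurable_fun S K -> (\int[mu]_(x in S) (gamma x * enorm (K x) `^ q)%:E < +oo)%E ->
    mu.-integrable S (EFin \o (fun x => gamma x * enorm (K x) `^ q)).
  move=> mK EK; apply/integrableP; split; first by apply/measurable_EFinP; exact: (measurable_energy mK).
  rewrite (eq_integral (fun x => (gamma x * enorm (K x) `^ q)%:E)) // => x /set_mem Sx.
  by rewrite /= ger0_norm // mulr_ge0 ?powR_ge0 // ltW // gamma_gt0.
have := integrableZl mS n%:R (integrableD mS (en G mG EG) (en H mH EH)).
apply: le_integrable => //; first by apply/measurable_EFinP; exact: measurable_flux_dot.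
move=> x Sx; rewrite /= lee_fin [leRHS]ger0_norm; first exact: flux_dot_le.
by rewrite mulr_ge0 // addr_ge0 // mulr_ge0 ?powR_ge0 // ltW // gamma_gt0.
Qed.

Lemma measurable_wgrad f : weakly_differentiable S f -> measurable_fun S (wgrad S f).
Proof. by move=> /wgradP[_ [mG _] _]. Qed.

Lemma weak_gradient_affine f G (a d : R) : is_weak_gradient S f G ->
  is_weak_gradient S (fun x => a * f x + d) (fun x => a *: G x).
Proof.
move=> wG; have := is_weak_gradient_lin oS a 0 d wG wG.
have -> : (fun x => a * f x + 0 * f x + d) = (fun x => a * f x + d).
  by apply/funext => x; rewrite mul0r addr0.
by have -> : (fun x => a *: G x + 0 *: G x) = (fun x => a *: G x)
  by apply/funext => x; rewrite scale0r addr0.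
Qed.

Lemma wgrad_affine f (a d : R) : weakly_differentiable S f ->
  weakly_differentiable S (fun x => a * f x + d) /\
  {ae mu, forall x, S x -> wgrad S (fun x => a * f x + d) x = a *: wgrad S f x}.
Proof.
move=> /wgradP wf; have wa := weak_gradient_affine a d wf; split.
  by exists (fun x => a *: wgrad S f x).
exact: wgradE wa.
Qed.

Lemma wgrad_cst (d : R) : {ae mu, forall x, S x -> wgrad S (cst d) x = 0}.
Proof. exact: (wgradE oS (is_weak_gradient_cst oS d)). Qed.

Lemma inWbounded_affine f (a d : R) : inWbounded S q gamma f ->
  inWbounded S q gamma (fun x => a * f x + d).
Proof.
move=> [[_ wf Ef] /inLpyP[mf bf]].
have maf : measurable_fun S (fun x => a * f x + d).
  by apply: measurable_funD => //; exact: measurable_funM.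
have baf := ess_bounded_affine a d bf.
have [waf Da] := wgrad_affine a d wf.
split; last by apply/inLpyP; split.
split; [exact: (ess_bounded_inLp mS Sfin q0 maf baf)|exact: waf|].
apply: (@le_lt_trans _ _ (\int[mu]_(x in S) ((`|a| `^ q)%:E * (gamma x * enorm (wgrad S f x) `^ q)%:E))%E).
  rewrite (ae_eq_integral (fun x => ((`|a| `^ q)%:E * (gamma x * enorm (wgrad S f x) `^ q)%:E)%E)) //.
  - apply/measurable_EFinP; apply: measurable_energy.
    exact: measurable_wgrad.
  - apply: measurable_funeM; apply/measurable_EFinP.
    by apply: measurable_energy; exact: measurable_wgrad.
  - apply: filterS Da => x h Sx; rewrite h // enormZ powRM ?enorm_ge0 //.
    by rewrite -EFinM mulrCA.
rewrite ge0_integralZl //.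
- by rewrite lte_mul_pinfty // ?lee_fin ?powR_ge0.
- by apply/measurable_EFinP; apply: measurable_energy; exact: measurable_wgrad.
- by move=> x Sx; rewrite lee_fin mulr_ge0 ?powR_ge0 // ltW // gamma_gt0.
Qed.

Lemma inWbounded_cst (d : R) : inWbounded S q gamma (cst d).
Proof.
have bd : ess_bounded S (cst d) by exists `|d|; exact: aeW.
have wd : weakly_differentiable S (cst d) by exists (cst 0); exact: is_weak_gradient_cst.
have md : measurable_fun S (cst d) by exact: measurable_cst.
split; last by apply/inLpyP; split.
split; [exact: (ess_bounded_inLp mS Sfin q0 md bd)|exact: wd|].
rewrite (ae_eq_integral (cst 0%E)) ?integral0 ?ltry //.
  by apply/measurable_EFinP; apply: measurable_energy; exact: measurable_wgrad.
apply: filterS (wgrad_cst d) => x h Sx; rewrite h //=.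
have -> : enorm (0 : E) = 0 by rewrite -(scale0r (0 : E)) enormZ normr0 mul0r.
by rewrite powR0 ?gt_eqF // mulr0.
Qed.

End operators.

(** * Truncations and the generalized gradient *)

Section truncation.
Context {R : realType}.
Implicit Types k s : R.

Lemma truncE k s : 0 < k -> trunc k s = Num.max (- k) (Num.min k s).
Proof.
move=> k0; rewrite /trunc; case: ifPn => [|].
  by rewrite ltr_norml => /andP[h1 h2]; rewrite min_r ?max_r // ltW.
rewrite -leNgt; have [s0|s0|->] := ltgtP s 0.
- rewrite ltr0_norm // ltr0_sg // mulrN1 => h.
  by rewrite min_r ?max_l //; lra.
- by rewrite gtr0_norm // gtr0_sg // mulr1 => h; rewrite min_l ?max_r //; lra.
- by rewrite normr0 => h; have := lt_le_trans k0 h; rewrite ltxx.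
Qed.

Lemma trunc_le k s : 0 < k -> `|trunc k s| <= k.
Proof.
by move=> k0; rewrite truncE // ler_norml le_max lexx /= ge_max ge_min lexx andbT; lra.
Qed.

Lemma trunc_le_norm k s : 0 < k -> `|trunc k s| <= `|s|.
Proof.
move=> k0; rewrite /trunc; case: ifPn => //; rewrite -leNgt => h.
have [->|s0] := eqVneq s 0; first by rewrite sgr0 mulr0.
by rewrite normrM normr_sg s0 mulr1 ger0_norm // ltW.
Qed.

Lemma trunc_lip k s t : 0 < k -> `|trunc k s - trunc k t| <= `|s - t|.
Proof.
move=> k0; rewrite !truncE //.
wlog st : s t / s <= t.
  move=> h; have [|/ltW ts] := leP s t; first exact: h.
  by rewrite distrC [X in _ <= X]distrC; exact: (h t s ts).
have mono : Num.max (- k) (Num.min k s) <= Num.max (- k) (Num.min k t).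
  by rewrite ge_max !le_max lexx /= le_min !ge_min lexx st orbT orbT.
rewrite distrC [leRHS]distrC !ger0_norm ?subr_ge0 //.
rewrite /Num.max /Num.min; do !case: ifPn; rewrite -?leNgt; lra.
Qed.

Lemma trunc_id k s : `|s| < k -> trunc k s = s.
Proof. by rewrite /trunc => ->. Qed.

Lemma measurable_trunc k : 0 < k -> measurable_fun setT (trunc k).
Proof.
move=> k0; apply: (eq_measurable_fun (fun s => Num.max (- k) (Num.min k s))).
  by move=> s _; rewrite truncE.
by apply: measurable_maxr => //; apply: measurable_minr.
Qed.

End truncation.

Section generalized_gradient.
Context {R : realType} {n : nat}.
Variable S : set 'rV[R]_n.
Hypothesis oS : open S.
Local Notation E := 'rV[R]_n.
Local Notation mu := (@lebesgue_rV R n).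
Variable f : E -> R.
Hypotheses (mf : measurable_fun S f)
  (wT : forall k, 0 < k -> weakly_differentiable S (trunc k \o f)).
Local Notation wT_ k := (wgrad S (trunc k \o f)).

Let mS : measurable S. Proof. exact: open_measurable_rV. Qed.

(** Locality applied to the difference of the two truncations, which vanishes where [|f|] is below
    both levels. *)
Lemma wgrad_trunc_eq k l : 0 < k -> 0 < l ->
  {ae mu, forall x, S x -> `|f x| < k -> `|f x| < l -> wT_ k x = wT_ l x}.
Proof.
move=> k0 l0.
have := is_weak_gradient_lin oS 1 (-1) 0 (wgradP (wT k0)) (wgradP (wT l0)).
move=> /(weak_gradient_locality oS); apply: filterS => x h Sx fk fl.
have /= := h Sx; rewrite !trunc_id // mul1r mulN1r subrr addr0 => /(_ erefl) /eqP.
by rewrite scale1r scaleN1r subr_eq0 => /eqP.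
Qed.

(** Locality applied to the truncation plus and minus [k], one of which vanishes at each point with
    [|f| >= k]. *)
Lemma wgrad_trunc_eq0 k : 0 < k ->
  {ae mu, forall x, S x -> k <= `|f x| -> wT_ k x = 0}.
Proof.
move=> k0; have wk := wgradP (wT k0).
have h1 := weak_gradient_locality oS (weak_gradient_affine oS 1 (- k) wk).
have h2 := weak_gradient_locality oS (weak_gradient_affine oS 1 k wk).
apply: filterS2 h1 h2 => x h1 h2 Sx fk; move: (h1 Sx) (h2 Sx).
rewrite /= !scale1r !mul1r /trunc ltNge fk /=.
have [f0|f0|f0] := ltgtP (f x) 0.
- by rewrite ltr0_sg // mulrN1 addNr => _; apply.
- by rewrite gtr0_sg // mulr1 subrr => + _; apply.
- by move: fk; rewrite f0 normr0 leNgt k0.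
Qed.

(** The gradients of the truncations agree wherever two of them are below their levels, so they glue
    to one function. *)
Lemma ggradP : is_gen_gradient S f (ggrad S f).
Proof.
suff [G hG] : exists G, is_gen_gradient S f G.
  by rewrite /ggrad; case: xgetP => [//|/(_ G)].
(* On the shell [m <= |f| < m + 1] the truncation at level [m + 1] is used; countably many shells
   keep [G] measurable. *)
pose G x := wT_ (Num.truncn `|f x|).+1%:R x; exists G; split.
  move=> _ Y mY.
  have -> : S `&` G @^-1` Y = \bigcup_(m in [set: nat]) ((S `&` wT_ m.+1%:R @^-1` Y) `&`
      (S `&` f @^-1` [set y | Num.truncn `|y| == m])).
    apply/seteqP; split => x.
      by move=> [Sx Gx]; exists (Num.truncn `|f x|) => //; split; split => /=.
    by move=> [m _ [[Sx wx] [_ /= /eqP fm]]]; split => //=; rewrite /G fm.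
  apply: bigcup_measurable => m _; apply: measurableI.
    apply: measurable_wgrad => //; exact: wT.
  apply: mf => //.
  have -> : [set y : R | Num.truncn `|y| == m] = (fun y : R => `|y|) @^-1` `[m%:R, m.+1%:R[%classic.
    by apply/funext => y /=; rewrite in_itv /= truncn_eq.
  have mn : measurable_fun setT (fun y : R => `|y|) by exact: normr_measurable.
  by rewrite -[X in measurable X]setTI; apply: mn.
move=> k k0.
have hm (m : nat) : {ae mu, forall x, S x -> `|f x| < k -> `|f x| < m.+1%:R ->
    wT_ k x = wT_ m.+1%:R x} by exact: wgrad_trunc_eq.
have {}hm : {ae mu, forall x (m : nat), S x -> `|f x| < k -> `|f x| < m.+1%:R ->
    wT_ k x = wT_ m.+1%:R x} by apply/ae_foralln.
apply: filterS2 hm (wgrad_trunc_eq0 k0) => x h1 h2 Sx; case: ifPn => [fk|].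
  by apply: h1 => //; exact: truncnS_gt.
by rewrite -leNgt; exact: h2.
Qed.

End generalized_gradient.

(** * Integrable functions with a real-valued norm *)

Section L1_space.
Context {R : realType} {n : nat}.
Variable S : set 'rV[R]_n.
Hypotheses (mS : measurable S) (Sfin : (lebesgue_rV n S < +oo)%E).
Local Notation E := 'rV[R]_n.
Local Notation mu := (@lebesgue_rV R n).
Implicit Types f g h : E -> R.

(** The real-valued counterpart of [LnormS S 1], equal to it on [L^1]; it allows linear arithmetic
    in the estimates. *)
Definition L1norm f : R := \int[mu]_(x in S) `|f x|.

Lemma L1norm_ge0 f : 0 <= L1norm f.
Proof. by apply: Rintegral_ge0. Qed.

Lemma LnormS1_L1norm f : inLp S 1 f -> LnormS S 1 f = (L1norm f)%:E.
Proof.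
move=> [_]; rewrite LnormS1E /L1norm /Rintegral => h; rewrite fineK //.
by rewrite ge0_fin_numE // integral_ge0.
Qed.

Lemma inLp1_lin (a b : R) f g : inLp S 1 f -> inLp S 1 g ->
  inLp S 1 (fun x => a * f x + b * g x).
Proof.
move=> /inLp1P fi /inLp1P gi; apply/inLp1P.
exact: (integrableD mS (integrableZl mS a fi) (integrableZl mS b gi)).
Qed.

Lemma inLp1Z (a : R) f : inLp S 1 f -> inLp S 1 (fun x => a * f x).
Proof. by move=> /inLp1P fi; apply/inLp1P; exact: (integrableZl mS a fi). Qed.

Lemma inLp1D f g : inLp S 1 f -> inLp S 1 g -> inLp S 1 (fun x => f x + g x).
Proof. by move=> /inLp1P fi /inLp1P gi; apply/inLp1P; exact: (integrableD mS fi gi). Qed.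

Lemma inLp1B f g : inLp S 1 f -> inLp S 1 g -> inLp S 1 (fun x => f x - g x).
Proof. by move=> /inLp1P fi /inLp1P gi; apply/inLp1P; exact: (integrableB mS fi gi). Qed.

Lemma inLp1_cst (d : R) : inLp S 1 (cst d).
Proof.
split; first exact: measurable_cst.
rewrite LnormS1E (eq_integral (cst `|d|%:E)) // integral_cst //.
by rewrite lte_mul_pinfty // lee_fin.
Qed.

Lemma inLp1_le f g : measurable_fun S f -> inLp S 1 g ->
  (forall x, S x -> `|f x| <= `|g x|) -> inLp S 1 f.
Proof.
move=> mf /inLp1P gi fg; apply/inLp1P; apply: le_integrable gi => //.
exact/measurable_EFinP.
Qed.

Lemma inLp1_norm f : inLp S 1 f -> inLp S 1 (fun x => `|f x|).
Proof.
move=> fi; apply: inLp1_le (fi) _ => [|x _]; last by rewrite normr_id.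
by apply: measurableT_comp => //; exact: fi.1.
Qed.

Lemma ae_eq_Rintegral f g : measurable_fun S f -> measurable_fun S g ->
  {ae mu, forall x, S x -> f x = g x} ->
  \int[mu]_(x in S) f x = \int[mu]_(x in S) g x.
Proof.
move=> mf mg fg; rewrite /Rintegral; congr fine; apply: ae_eq_integral => //.
- exact/measurable_EFinP.
- exact/measurable_EFinP.
- by apply: filterS fg => x h Sx; rewrite h.
Qed.

Lemma Rintegral_ae_eq0 f : measurable_fun S f ->
  {ae mu, forall x, S x -> f x = 0} -> \int[mu]_(x in S) f x = 0.
Proof.
move=> mf f0; rewrite (ae_eq_Rintegral (g := cst 0)) //.
by rewrite Rintegral_cst // mul0r.
Qed.

Lemma norm_Rintegral_le f : inLp S 1 f -> `|\int[mu]_(x in S) f x| <= L1norm f.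
Proof. by move=> /inLp1P fi; exact: le_normr_Rintegral. Qed.

Lemma le_Rintegral_in f g : inLp S 1 f -> inLp S 1 g ->
  (forall x, S x -> f x <= g x) -> \int[mu]_(x in S) f x <= \int[mu]_(x in S) g x.
Proof. by move=> /inLp1P fi /inLp1P gi; exact: le_Rintegral. Qed.

Lemma Rintegral_lin (a b : R) f g : inLp S 1 f -> inLp S 1 g ->
  \int[mu]_(x in S) (a * f x + b * g x) =
  a * \int[mu]_(x in S) f x + b * \int[mu]_(x in S) g x.
Proof.
move=> /inLp1P fi /inLp1P gi; rewrite -!RintegralZl //.
exact: (RintegralD mS (integrableZl mS a fi) (integrableZl mS b gi)).
Qed.

Lemma L1normZ (a : R) f : inLp S 1 f -> L1norm (fun x => a * f x) = `|a| * L1norm f.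
Proof.
move=> fi; have /inLp1P nf := inLp1_norm fi.
rewrite /L1norm -RintegralZl //.
by apply: eq_Rintegral => x _; rewrite normrM.
Qed.

Lemma L1normD f g : inLp S 1 f -> inLp S 1 g ->
  L1norm (fun x => f x + g x) <= L1norm f + L1norm g.
Proof.
move=> fi gi; have /inLp1P nf := inLp1_norm fi; have /inLp1P ng := inLp1_norm gi.
rewrite /L1norm -RintegralD //.
apply: le_Rintegral_in => [||x _]; last exact: ler_normD.
- exact/inLp1_norm/inLp1D.
- by apply: inLp1D; exact: inLp1_norm.
Qed.

Lemma L1norm_tri f g h : inLp S 1 f -> inLp S 1 g -> inLp S 1 h ->
  L1norm (fun x => f x - h x) <= L1norm (fun x => f x - g x) + L1norm (fun x => g x - h x).
Proof.
move=> fi gi hi; apply: le_trans (L1normD (inLp1B fi gi) (inLp1B gi hi)).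
rewrite le_eqVlt; apply/orP; left; apply/eqP; congr L1norm.
by apply/funext => x; rewrite addrA subrK.
Qed.

Lemma L1norm_sym f g : L1norm (fun x => f x - g x) = L1norm (fun x => g x - f x).
Proof. by apply: eq_Rintegral => x _; rewrite distrC. Qed.

Lemma L1norm_mean f : inLp S 1 f ->
  L1norm (fun x => f x - mean S f) <= 2 * L1norm f.
Proof.
move=> fi.
have h := L1normD fi (inLp1_cst (- mean S f)).
apply: le_trans h _; rewrite mulr_natl mulr2n lerD2l.
rewrite [X in X <= _](Rintegral_cst mu mS (`|- mean S f|)) normrN /mean normrM ger0_norm ?invr_ge0 ?fine_ge0 //.
have [->|s0] := eqVneq (fine (mu S)) 0; first by rewrite mulr0 L1norm_ge0.
by rewrite -mulrA mulrC -mulrA mulfV // mulr1 norm_Rintegral_le.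
Qed.

Lemma meanB f g : inLp S 1 f -> inLp S 1 g ->
  mean S (fun x => f x - g x) = mean S f - mean S g.
Proof. by move=> /inLp1P fi /inLp1P gi; rewrite /mean RintegralB // mulrBr. Qed.

End L1_space.

(** * Scaling, mass and energy for the operators *)

Section operator_identities.
Context {R : realType} {n : nat}.
Variables (S : set 'rV[R]_n) (q : R) (gamma : 'rV[R]_n -> R).
Hypotheses (oS : open S) (Sfin : (lebesgue_rV n S < +oo)%E) (q1 : 1 < q).
Hypotheses (gamma_gt0 : forall x, S x -> 0 < gamma x) (mgamma : measurable_fun S gamma).
Local Notation E := 'rV[R]_n.
Local Notation mu := (@lebesgue_rV R n).
Implicit Types (f g phi h : E -> R) (G H : E -> E).

Let mS : measurable S. Proof. exact: open_measurable_rV. Qed.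
Let q0 : 0 < q. Proof. exact: lt_trans q1. Qed.

Lemma dotv0 (x : E) : dotv x 0 = 0.
Proof. by rewrite /dotv big1 // => i _; rewrite [(0 : E) _ _]mxE mulr0. Qed.

Lemma fluxZ (a : R) G H x : 0 < a -> H x = a *: G x ->
  flux q gamma H x = a `^ (q - 1) *: flux q gamma G x.
Proof.
move=> a0 HG; rewrite /flux HG enormZ gtr0_norm // powRM ?enorm_ge0 ?(ltW a0) //.
rewrite !scalerA; congr (_ *: _).
have -> : q - 1 = (q - 2) + 1 by lra.
have an : a != 0 by rewrite gt_eqF.
have -> : a `^ (q - 2 + 1) = a `^ (q - 2) * a.
  by rewrite powRD ?an ?implybT // (powRr1 (ltW a0)).
ring.
Qed.

Lemma inLp1_mul_ess f g : inLp S 1 f -> measurable_fun S g -> ess_bounded S g ->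
  inLp S 1 (fun x => f x * g x).
Proof.
move=> fi mg [M hM]; have [mf] := inLp1Z mS M fi; rewrite !LnormS1E => h.
split; first by apply: measurable_funM => //; exact: fi.1.
rewrite LnormS1E; apply: le_lt_trans h; apply: ae_ge0_le_integral => //.
- apply/measurable_EFinP; apply: measurableT_comp => //.
  by apply: measurable_funM => //; exact: fi.1.
- by apply/measurable_EFinP; apply: measurableT_comp.
- apply: filterS hM => x h Sx; rewrite lee_fin mulrC !normrM ler_wpM2r //.
  exact: le_trans (h Sx) (ler_norm M).
Qed.

(** The gradient is multiplied by [a] and the flux by [a^(q-1)], both almost everywhere, as [wgrad]
    picks a representative. *)
Lemma opA_affine h hhat (a d : R) : 0 < a -> opA S q gamma h hhat ->
  opA S q gamma (fun x => a * h x + d) (fun x => a `^ (q - 1) * hhat x).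
Proof.
move=> a0 [wh ih hE]; have wah := inWbounded_affine oS Sfin q1 gamma_gt0 mgamma a d wh.
split => // [|phi wphi]; first exact: inLp1Z.
have [[_ wdh Eh] _] := wh; have [[_ wdp Ep] _] := wphi.
have [waf Da] := wgrad_affine oS a d wdh.
have mG := measurable_wgrad wdh; have mP := measurable_wgrad wdp.
have fi := flux_dot_integrable oS q1 gamma_gt0 mgamma mG mP Eh Ep.
rewrite (ae_eq_Rintegral mS (g := fun x => a `^ (q - 1) *
    dotv (flux q gamma (wgrad S h) x) (wgrad S phi x))).
- rewrite RintegralZl // hE //.
  transitivity (\int[mu]_(x in S) (a `^ (q - 1) * (hhat x * phi x))).
    have [_ /inLpyP[mphi bphi]] := wphi.
    by have /inLp1P hphi := inLp1_mul_ess ih mphi bphi; rewrite RintegralZl.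
  by apply: eq_Rintegral => x _; rewrite mulrA.
- by apply: measurable_flux_dot => //; exact: measurable_wgrad.
- apply: measurable_funM => //; exact: measurable_flux_dot.
- by apply: filterS Da => x h0 Sx; rewrite (fluxZ a0 (h0 Sx)) dotvZl.
Qed.

Lemma opA_cst (d : R) : opA S q gamma (cst d) (cst 0).
Proof.
have wd := inWbounded_cst oS Sfin q1 mgamma d.
split => // [|phi wphi]; first exact: inLp1_cst.
have [[_ wdd _] _] := wd; have [[_ wdp _] _] := wphi.
rewrite (Rintegral_ae_eq0 mS); first 1 last.
- by apply: measurable_flux_dot => //; exact: measurable_wgrad.
- apply: filterS (wgrad_cst oS d) => x h Sx; rewrite /flux h // scaler0.
  by rewrite -(scale0r (0 : E)) dotvZl mul0r.
rewrite (Rintegral_ae_eq0 mS) //; last by apply: aeW => x _; rewrite mul0r.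
apply: measurable_funM => //; case: wphi => _ [mphi _]; exact: mphi.
Qed.

(** The constant 1 is an admissible test function, with gradient 0. *)
Lemma opA_integral0 h hhat : opA S q gamma h hhat -> \int[mu]_(x in S) hhat x = 0.
Proof.
move=> [wh ih hE].
have w1 := inWbounded_cst oS Sfin q1 mgamma 1.
have [[_ wdh _] _] := wh; have [[_ wdp _] _] := w1.
have := hE _ w1; rewrite (Rintegral_ae_eq0 mS); first 1 last.
- by apply: measurable_flux_dot => //; exact: measurable_wgrad.
- apply: filterS (wgrad_cst oS 1) => x h0 Sx; rewrite h0 //.
  by rewrite dotv0.
by move=> ->; apply: eq_Rintegral => x _; rewrite mulr1.
Qed.

Hypothesis cl : forall f fhat,
  opAcal S q gamma f fhat <-> graph_closure S (opA S q gamma) f fhat.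

Lemma opA_sub f fhat : opA S q gamma f fhat -> opAcal S q gamma f fhat.
Proof.
move=> A; apply/cl; have [[wf bf] ifh _] := A.
have /inLpyP[mf be] := bf.
have if1 : inLp S 1 f by exact: ess_bounded_inLp.
split => //.
have z g : inLp S 1 g -> LnormS S 1 (fun x => g x - g x) = 0%E.
  move=> _; rewrite LnormS1E (eq_integral (cst 0%E)) ?integral0 // => x _.
  by rewrite subrr normr0.
by move=> e e0; exists f, fhat; split => //; rewrite z // lte_fin.
Qed.

Lemma graph_closure_L1 f fhat : graph_closure S (opA S q gamma) f fhat ->
  forall e, 0 < e -> exists h hhat, [/\ opA S q gamma h hhat, inLp S 1 h, inLp S 1 hhat,
    L1norm S (fun x => f x - h x) < e & L1norm S (fun x => fhat x - hhat x) < e].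
Proof.
move=> [if1 ifh c] e e0; have [h [hh [A h1 h2]]] := c e e0.
have [ih _] := (cl h hh).1 (opA_sub A).
have [_ ihh _] := A.
exists h, hh; split => //.
- by move: h1; rewrite LnormS1_L1norm ?lte_fin //; exact: inLp1B.
- by move: h2; rewrite LnormS1_L1norm ?lte_fin //; exact: inLp1B.
Qed.

(** [opA_affine] sends approximating pairs in [A] to approximating pairs, so the [L^1] closure
    inherits the rule. *)
Lemma opAcal_affine f fhat (a d : R) : 0 < a -> opAcal S q gamma f fhat ->
  opAcal S q gamma (fun x => a * f x + d) (fun x => a `^ (q - 1) * fhat x).
Proof.
move=> a0 /cl c; apply/cl; have [if1 ifh _] := c; split.
- by apply: inLp1D => //; [exact: inLp1Z|exact: inLp1_cst].
- exact: inLp1Z.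
move=> e e0; set b := a `^ (q - 1); have b0 : 0 < b by rewrite powR_gt0.
(* The first components get multiplied by [a], the second ones by [b]. *)
have m0 : 0 < Num.min (e / a) (e / b) by rewrite lt_min !divr_gt0.
have [h [hh [A ih ihh]]] := graph_closure_L1 c m0.
rewrite !lt_min => /andP[h1 _] /andP[_ h2].
exists (fun x => a * h x + d), (fun x => b * hh x); split; first exact: opA_affine.
- have -> : (fun x => a * f x + d - (a * h x + d)) = (fun x => a * (f x - h x)).
    by apply/funext => x; ring.
  rewrite LnormS1_L1norm; last by apply: inLp1Z => //; exact: inLp1B.
  rewrite L1normZ //; last exact: inLp1B.
  by rewrite gtr0_norm // lte_fin mulrC -ltr_pdivlMr.
- have -> : (fun x => b * fhat x - (b * hh x)) = (fun x => b * (fhat x - hh x)).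
    by apply/funext => x; ring.
  rewrite LnormS1_L1norm; last by apply: inLp1Z => //; exact: inLp1B.
  rewrite L1normZ //; last exact: inLp1B.
  by rewrite gtr0_norm // lte_fin mulrC -ltr_pdivlMr.
Qed.

Lemma opAcal_cst (d : R) : opAcal S q gamma (cst d) (cst 0).
Proof. exact: opA_sub (opA_cst d). Qed.

(** The integral is continuous on [L^1], so conservation of mass passes from [A] to its closure. *)
Lemma opAcal_integral0 f fhat : opAcal S q gamma f fhat ->
  \int[mu]_(x in S) fhat x = 0.
Proof.
move=> /cl c; have [if1 ifh _] := c; apply/eqP; rewrite -normr_le0.
apply/ler_addgt0Pl => e e0; rewrite addr0.
have [h [hh [A ih ihh _ h2]]] := graph_closure_L1 c e0.
rewrite -[X in `|X|]subr0 -(opA_integral0 A) -RintegralB //; [|exact/inLp1P..].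
by apply: le_trans (norm_Rintegral_le mS (inLp1B mS ifh ihh)) (ltW h2).
Qed.

(** For [phi = 0] the tested function is [trunc k f]. Its gradient equals [ggrad S f] where
    [|f| < k] and is 0 elsewhere, so the pairing with the flux is exactly its energy. *)
Lemma opAcal_energy f fhat (k : R) : 0 < k -> opAcal S q gamma f fhat ->
  (\int[mu]_(x in S) (gamma x * enorm (wgrad S (trunc k \o f) x) `^ q)%:E <=
   (\int[mu]_(x in S) (fhat x * trunc k (f x)))%:E)%E.
Proof.
move=> k0 [if1 ifh wT hE].
have wTd l : 0 < l -> weakly_differentiable S (trunc l \o f) by move=> /wT[].
have [mG GP] := ggradP oS if1.1 wTd.
have [_ wk Ek] := wT _ k0; have mw := measurable_wgrad wk.
have := hE _ _ k0 (inWbounded_cst oS Sfin q1 mgamma 0).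
have -> : (fun y => trunc k (f y - cst 0 y)) = trunc k \o f.
  by apply/funext => y /=; rewrite subr0.
have -> : \int[mu]_(x in S) (fhat x * trunc k (f x - cst 0 x)) =
    \int[mu]_(x in S) (fhat x * trunc k (f x)).
  by apply: eq_Rintegral => x _; rewrite subr0.
rewrite (ae_eq_Rintegral mS (g := fun x => gamma x * enorm (wgrad S (trunc k \o f) x) `^ q)).
(* The energy is finite by [inWweighted], so the real integral does not hide an infinite value
   behind the default 0 of [fine]. *)
- move=> h; rewrite -[leLHS]fineK ?lee_fin //.
  rewrite ge0_fin_numE // integral_ge0 // => x Sx.
  by rewrite lee_fin mulr_ge0 ?powR_ge0 // ltW // gamma_gt0.
- exact: measurable_flux_dot.
- exact: measurable_energy.
- apply: filterS (GP k k0) => x h Sx; have := h Sx.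
  case: ifPn => [fk wG|_ ->].
    by rewrite -flux_dot_same // /flux wG.
  have -> : enorm (0 : E) = 0 by rewrite -(scale0r (0 : E)) enormZ normr0 mul0r.
  rewrite powR0 ?gt_eqF // mulr0.
  by rewrite dotv0.
Qed.

End operator_identities.

(** * Weighted Hoelder inequality and Poincare inequality *)

Section poincare.
Context {R : realType} {n : nat}.
Variables (S : set 'rV[R]_n) (q : R) (gamma : 'rV[R]_n -> R).
Hypotheses (oS : open S) (Sfin : (lebesgue_rV n S < +oo)%E) (q1 : 1 < q).
Hypotheses (gamma_gt0 : forall x, S x -> 0 < gamma x) (mgamma : measurable_fun S gamma).
Local Notation E := 'rV[R]_n.
Local Notation mu := (@lebesgue_rV R n).
Implicit Types (f g phi h : E -> R) (G H : E -> E).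

Let mS : measurable S. Proof. exact: open_measurable_rV. Qed.
Let q0 : 0 < q. Proof. exact: lt_trans q1. Qed.

Lemma LnormS_hoelder (r s : R) f g : measurable_fun S f -> measurable_fun S g ->
  0 < r -> 0 < s -> r^-1 + s^-1 = 1 ->
  (LnormS S 1 (fun x => f x * g x)%R <= LnormS S r%:E f * LnormS S s%:E g)%E.
Proof.
move=> mf mg r0 s0 rs.
have res h : EFin \o (h \_ S) = (EFin \o h) \_ S.
  by apply/funext => x; rewrite /= !patchE; case: ifP.
have mfS : measurable_fun setT (f \_ S) by refine ((measurable_restrictT _ mS).1 _).
have mgS : measurable_fun setT (g \_ S) by refine ((measurable_restrictT _ mS).1 _).
have := hoelder mu mfS mgS r0 s0 rs; rewrite !res.
have -> : EFin \o ((f \_ S) \* (g \_ S))%R = (EFin \o (fun x => f x * g x)) \_ S.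
  by apply/funext => x; rewrite /= !patchE; case: ifP => //; rewrite mulr0.
by [].
Qed.

(** Hoelder with exponents [q] and [q / (q - 1)] for the factors [gamma^(1/q) |G|] and
    [gamma^(-1/q)]; the conjugate power of the latter is [gamma^(1/(1-q))]. *)
Lemma gradient_hoelder G : measurable_fun S G ->
  (LnormS S 1 (enorm \o G) <=
   (\int[mu]_(x in S) (gamma x `^ (1 / (1 - q)))%:E) `^ ((q - 1) / q) *
   (\int[mu]_(x in S) (gamma x * enorm (G x) `^ q)%:E) `^ q^-1)%E.
Proof.
move=> mG.
have qn : q != 0 by rewrite gt_eqF.
have q1n : q - 1 != 0 by rewrite subr_eq0 gt_eqF.
have q1n' : 1 - q != 0 by rewrite subr_eq0 lt_eqF.
have mp r : measurable_fun S (fun x => gamma x `^ r).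
  exact: (measurableT_comp (measurable_powR _) mgamma).
have me : measurable_fun S (fun x => gamma x `^ q^-1 * enorm (G x)).
  by apply: measurable_funM => //; exact: measurable_enorm.
have q10 : 0 < q - 1 by rewrite subr_gt0.
have s0 : 0 < q / (q - 1) by rewrite divr_gt0.
have rs : q^-1 + (q / (q - 1))^-1 = 1 by field; rewrite qn q1n.
have := LnormS_hoelder me (mp (- q^-1)) q0 s0 rs.
have -> : LnormS S 1 (fun x => gamma x `^ q^-1 * enorm (G x) * gamma x `^ (- q^-1)) =
    LnormS S 1 (enorm \o G).
  rewrite !LnormS1E; apply: eq_integral => x /set_mem Sx.
  congr (`|_|%:E); rewrite mulrAC -powRD ?subrr ?powRr0 ?mul1r //.
  by rewrite (gt_eqF (gamma_gt0 Sx)) implybT.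
rewrite [LnormS S q%:E _]LnormS_EFinE // [LnormS S (q / (q - 1))%:E _]LnormS_EFinE ?gt_eqF //.
rewrite muleC invf_div.
have -> : (\int[mu]_(x in S) (`|gamma x `^ (- q^-1)| `^ (q / (q - 1)))%:E =
    \int[mu]_(x in S) (gamma x `^ (1 / (1 - q)))%:E)%E.
  apply: eq_integral => x _; congr EFin.
  rewrite ger0_norm ?powR_ge0 // -powRrM; congr (_ `^ _).
  by field; rewrite q1n q1n' qn.
have -> // : (\int[mu]_(x in S) (`|gamma x `^ q^-1 * enorm (G x)| `^ q)%:E =
    \int[mu]_(x in S) (gamma x * enorm (G x) `^ q)%:E)%E.
apply: eq_integral => x /set_mem Sx; congr EFin.
rewrite ger0_norm ?mulr_ge0 ?powR_ge0 ?enorm_ge0 //.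
by rewrite powRM ?powR_ge0 ?enorm_ge0 // -powRrM mulVf // powRr1 // ltW // gamma_gt0.
Qed.

Variable C : R.
Hypotheses (gamma_L1 : inLp S 1 (fun x => gamma x `^ (1 / (1 - q))))
  (C0 : 0 < C) (pC : poincare_ineq S C).

Let W : \bar R := ((\int[mu]_(x in S) (gamma x `^ (1 / (1 - q)))%:E) `^ ((q - 1) / q))%E.

Lemma weight_fin_num : W \is a fin_num.
Proof.
rewrite ge0_fin_numE ?poweR_ge0 //; apply: poweR_lty.
case: gamma_L1 => _; rewrite LnormS1E; congr (is_true (_ < _)%E).
by apply: eq_integral => x _; rewrite ger0_norm // powR_ge0.
Qed.

(** Finiteness of the weight integral turns finite energy into an integrable gradient, which places
    [g] in [W^(1,1)]. *)
Lemma poincare_energy g (B : R) : measurable_fun S g -> ess_bounded S g ->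
  weakly_differentiable S g ->
  (\int[mu]_(x in S) (gamma x * enorm (wgrad S g x) `^ q)%:E <= B%:E)%E ->
  (LnormS S 1 (fun x => g x - mean S g)%R <= C%:E * (W * (B `^ q^-1)%:E))%E.
Proof.
move=> mg bg wg EB; have mw := measurable_wgrad wg.
have h : (LnormS S 1 (enorm \o wgrad S g) <= W * (B `^ q^-1)%:E)%E.
  apply: le_trans (gradient_hoelder mw) _; apply: lee_wpmul2l; first exact: poweR_ge0.
  rewrite -poweR_EFin; apply: gt0_ler_poweR => //.
  - by rewrite invr_ge0 ltW.
  - rewrite in_itv /= leey andbT; apply: integral_ge0 => x Sx.
    by rewrite lee_fin mulr_ge0 ?powR_ge0 // ltW // gamma_gt0.
  - rewrite in_itv /= leey andbT; apply: le_trans EB; apply: integral_ge0 => x Sx.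
    by rewrite lee_fin mulr_ge0 ?powR_ge0 // ltW // gamma_gt0.
apply: le_trans (pC _) _; last by apply: lee_wpmul2l => //; rewrite lee_fin ltW.
split => //; first exact: ess_bounded_inLp.
split => //; apply: le_lt_trans h _.
by rewrite ltey_eq fin_numM // weight_fin_num.
Qed.

(** Dominated convergence, with [2 |f|] as dominating function. The threshold [k0] reserves the
    right to take only large levels. *)
Lemma trunc_L1_approx f (k0 e : R) : inLp S 1 f -> 0 < e ->
  exists k, [/\ 0 < k, k0 < k & L1norm S (fun x => f x - trunc k (f x)) < e].
Proof.
move=> fi e0.
pose F (m : nat) (x : E) : \bar R := `|f x - trunc m.+1%:R (f x)|%:E.
have mt (k : R) : 0 < k -> measurable_fun S (fun x => trunc k (f x)).
  by move=> kp; exact: (measurableT_comp (measurable_trunc kp) fi.1).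
have it (k : R) : 0 < k -> inLp S 1 (fun x => f x - trunc k (f x)).
  move=> kp; apply: (inLp1B mS fi); apply: (inLp1_le mS (mt k kp) fi).
  by move=> x _; exact: trunc_le_norm.
have mF m : measurable_fun S (F m).
  by apply/measurable_EFinP; exact: (inLp1_norm mS (it m.+1%:R (ltr0Sn _ _))).1.
have F0 x : S x -> F ^~ x @ \oo --> cst 0%E x.
  move=> Sx; apply: cvg_near_cst; exists (Num.truncn `|f x|) => // m /= fm.
  rewrite /F trunc_id ?subrr ?normr0 //; apply: lt_le_trans (truncnS_gt _) _.
  by rewrite ler_nat.
have /inLp1P ig := inLp1Z mS 2 (inLp1_norm mS fi).
have Fg m x : S x -> (`|F m x| <= (2 * `|f x|)%:E)%E.
  move=> Sx; rewrite /F abse_EFin normr_id lee_fin.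
  apply: le_trans (ler_normB _ _) _; rewrite mulr_natl mulr2n lerD2l.
  exact: trunc_le_norm.
have fing x : S x -> (EFin \o (fun x => 2 * `|f x|)) x \is a fin_num by [].
have := dominated_cvg mS mF F0 fing ig Fg.
rewrite integral0 => /fine_cvgP[_] /cvgr0Pnorm_lt /(_ e e0) [m1 _ h1].
pose m := (maxn m1 (Num.truncn `|k0|)); exists m.+1%:R; split => //.
  apply: le_lt_trans (ler_norm k0) _; apply: lt_le_trans (truncnS_gt _) _.
  by rewrite ler_nat ltnS leq_maxr.
have := h1 m (leq_maxl _ _); rewrite ger0_norm //.
by apply: fine_ge0; apply: integral_ge0 => x _; rewrite lee_fin.
Qed.

(** [f] comes with a generalized gradient only, so Poincare is applied to truncations whose energy
    bound [B] does not depend on the level; the remainder is small in [L^1]. *)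
Lemma poincare_truncations f fhat (k0 B : R) : opAcal S q gamma f fhat ->
  (forall k, 0 < k -> k0 < k -> \int[mu]_(x in S) (fhat x * trunc k (f x)) <= B) ->
  (LnormS S 1 (fun x => f x - mean S f)%R <= C%:E * (W * (B `^ q^-1)%:E))%E.
Proof.
move=> Af hB; have [fi _ wT _] := Af.
have Wf := weight_fin_num.
rewrite LnormS1_L1norm; last by apply: inLp1B => //; exact: inLp1_cst.
rewrite -(fineK Wf) -!EFinM lee_fin; set X := (leRHS).
apply/ler_addgt0Pr => e e0.
(* Half of [e], because subtracting the mean at most doubles the [L^1] norm. *)
have [k [kp kk0 hk]] := trunc_L1_approx k0 fi (divr_gt0 e0 (ltr0Sn R 1)).
have mt : measurable_fun S (trunc k \o f) := measurableT_comp (measurable_trunc kp) fi.1.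
have bt : ess_bounded S (trunc k \o f).
  by exists k; apply: aeW => x _; exact: trunc_le.
have ti : inLp S 1 (trunc k \o f) by exact: ess_bounded_inLp.
have di : inLp S 1 (fun x => f x - (trunc k \o f) x) by exact: inLp1B.
have [_ wk _] := wT k kp.
have EB := le_trans (opAcal_energy oS Sfin q1 gamma_gt0 mgamma kp Af)
  (_ : (_ <= B%:E)%E).
have := poincare_energy mt bt wk (EB _); rewrite lee_fin => /(_ (hB k kp kk0)).
have ci d : inLp S 1 (fun=> d) := inLp1_cst mS Sfin d.
rewrite LnormS1_L1norm; last by apply: inLp1B => //; exact: ti.
rewrite -(fineK Wf) -!EFinM lee_fin -/X => h1.
have -> : (fun x => f x - mean S f) = (fun x => ((trunc k \o f) x - mean S (trunc k \o f)) +
    ((f x - (trunc k \o f) x) - mean S (fun x => f x - (trunc k \o f) x))).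
  by apply/funext => x; rewrite meanB //; ring.
apply: le_trans (L1normD mS _ _) _; [by apply: inLp1B..|].
apply: lerD => //; apply: le_trans (L1norm_mean mS Sfin di) _.
by rewrite mulrC -ler_pdivlMr // ltW.
Qed.

End poincare.

(** * Contraction and smoothing of the evolution *)

Section dini.
Context {R : realType}.
Local Notation leb1 := (@lebesgue_measure R).
Implicit Types (a b e s t x y : R) (l : seq (R * R)).

(** Sorted lists, because the covering argument moves leftwards and adds each new interval at the
    head. *)
Fixpoint disjoint_intervals a b l : bool :=
  if l is (x, y) :: l' then [&& a <= x, x <= y & disjoint_intervals y b l'] else a <= b.

Lemma disjoint_intervals_nth a b l : disjoint_intervals a b l -> forall i, (i < size l)%N ->
  [/\ a <= (nth (0, 0) l i).1, (nth (0, 0) l i).1 <= (nth (0, 0) l i).2 &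
      (nth (0, 0) l i).2 <= b].
Proof.
have le c d k : disjoint_intervals c d k -> c <= d.
  elim: k c => [|[x y] k IH] c //= /and3P[h1 h2 /IH h3].
  exact: le_trans h1 (le_trans h2 h3).
elim: l a => [|[x y] l IH] a //= /and3P[h1 h2 h3] [_|i] /=.
  by split => //; exact: le h3.
by move=> /(IH _ h3)[h4 h5 h6]; split => //; exact: le_trans h1 (le_trans h2 h4).
Qed.

Lemma disjoint_intervals_lt a b l : disjoint_intervals a b l ->
  forall i j, (i < j)%N -> (j < size l)%N ->
  (nth (0, 0) l i).2 <= (nth (0, 0) l j).1.
Proof.
elim: l a => [|[x y] l IH] a //= /and3P[h1 h2 h3] [|i] [|j] //=.
  by move=> _ /(disjoint_intervals_nth h3)[].
exact: IH h3 i j.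
Qed.

Lemma lebesgue_null_cover (N : set R) (e : R) : leb1.-negligible N -> 0 < e ->
  exists U, [/\ open U, N `<=` U & (leb1 U < e%:E)%E].
Proof.
move=> [M [mM M0 NM]] e0.
have fM : (leb1 M < +oo)%E by rewrite M0.
have [U [oU MU hU]] := lebesgue_regularity_outer mM fM e0.
exists U; split => //; first exact: subset_trans MU.
have mU : measurable (U : set (measurableTypeR R)) by exact: open_measurable.
have := @measureU2 _ _ _ leb1 _ _ mM (measurableD mU mM).
by rewrite (setDUK MU) [X in (X + _)%E]M0 add0e => /le_lt_trans; exact.
Qed.

Variable Phi : R -> R.
Hypothesis ac : forall a b e, 0 < a -> a <= b -> 0 < e -> exists2 d : R, 0 < d &
  forall m (s t : 'I_m -> R),
    (forall i, [/\ a <= s i, s i <= t i & t i <= b]) ->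
    (forall i j, i != j -> t i <= s j \/ t j <= s i) ->
    \sum_(i < m) (t i - s i) < d ->
    \sum_(i < m) `|Phi (t i) - Phi (s i)| < e.
Hypothesis dini : {ae leb1, forall t : R, 0 < t -> forall e, 0 < e ->
  exists2 d : R, 0 < d & forall h, 0 < h -> h < d -> Phi t <= Phi (t - h) + e * h}.

Let ac_seq a b e : 0 < a -> a <= b -> 0 < e -> exists2 d : R, 0 < d &
  forall l, disjoint_intervals a b l -> \sum_(p <- l) (p.2 - p.1) < d ->
    \sum_(p <- l) `|Phi p.2 - Phi p.1| < e.
Proof.
move=> a0 ab e0; have [d d0 hd] := ac a0 ab e0; exists d => // l hl.
rewrite !(big_nth (0, 0)) !big_mkord => hs.
apply: (hd _ (fun i : 'I_(size l) => (nth (0, 0) l i).1)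
  (fun i : 'I_(size l) => (nth (0, 0) l i).2)) => // [i|i j ij].
  exact: disjoint_intervals_nth hl _ (ltn_ord i).
have [lt|lt|/val_inj ijE] := ltngtP i j; last by rewrite ijE eqxx in ij.
  by left; exact: disjoint_intervals_lt hl _ _ lt (ltn_ord j).
by right; exact: disjoint_intervals_lt hl _ _ lt (ltn_ord i).
Qed.

Let ac_cvg a b e t : 0 < a -> a <= t -> t <= b -> 0 < e -> exists2 d : R, 0 < d &
  forall s, t <= s -> s <= b -> s - t < d -> `|Phi s - Phi t| < e.
Proof.
move=> a0 at_ tb e0; have [d d0 hd] := ac_seq a0 (le_trans at_ tb) e0.
exists d => // s ts sb st; have := hd [:: (t, s)].
by rewrite /= !big_seq1 at_ ts sb; exact.
Qed.

(* The variation of [Phi] on the exceptional null set is paid for by intervals inside an open set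
   of small measure, which absolute continuity controls. *)
Lemma ac_dini_nonincreasing a b : 0 < a -> a <= b -> Phi b <= Phi a.
Proof.
move=> a0 ab; apply/ler_addgt0Pr => e0 e00.
(* Three errors are shared out: slope [e] over the length [b - a], variation less than [e] inside
   the open set, and a slack of [e]. *)
pose e := e0 / (b - a + 2).
have D0 : 0 < b - a + 2 by lra.
have e_gt0 : 0 < e by rewrite divr_gt0.
have [d d0 hd] := ac_seq a0 ab e_gt0.
have [U [oU NU hU]] := lebesgue_null_cover dini d0.
have mU : measurable (U : set (measurableTypeR R)) by exact: open_measurable.
have mUI t : measurable (U `&` `]t, b]%classic : set (measurableTypeR R)).
  by apply: measurableI => //; exact: measurable_itv.
(* [l] collects the subintervals of [[t, b]] where the slope bound is not at hand; the part of [U]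
   to the right of [t] pays for their length, and [eta] is slack for passing to limits in [t]. *)
pose good t eta l := [/\ disjoint_intervals t b l,
  ((\sum_(p <- l) (p.2 - p.1))%:E <= leb1 (U `&` `]t, b]%classic))%E &
  Phi b <= Phi t + e * (b - t) + \sum_(p <- l) `|Phi p.2 - Phi p.1| + eta].
(* Real induction downwards from [b]: [P] contains its infimum, and any [t > a] in [P] can be
   lowered within [P], so the infimum is [a]. *)
pose P := [set t | a <= t <= b /\ forall eta, 0 < eta -> exists l, good t eta l].
have Pb : P b.
  split; first by rewrite ab lexx.
  move=> eta h; exists [::]; split => /=; first by rewrite lexx.
    by rewrite big_nil.
  by rewrite big_nil subrr mulr0; lra.
have lbP : lbound P a by move=> t [/andP[]].
have hiP : has_inf P by split; [exists b|exists a].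
pose c := inf P.
have ac_ : a <= c by apply: lb_le_inf => //; exists b.
have cb : c <= b by apply: ge_inf => //; exists a.
have Pc : P c.
  split; first by rewrite ac_ cb.
  move=> eta eta0; have eta2 : 0 < eta / 2 by lra.
  have [d1 d10 hd1] := ac_cvg a0 ac_ cb eta2.
  have [t Pt tc] : exists2 t, P t & t < c + d1 by apply: inf_adherent.
  have [/andP[at_ tb] /(_ _ eta2)[l [h1 h2 h3]]] := Pt.
  have ct : c <= t by apply: ge_inf => //; exists a.
  exists l; split.
  - by case: l h1 {h2 h3} => [//|[x y] l] /= /and3P[/(le_trans ct) -> -> ->].
  - apply: le_trans h2 _; apply: le_measure; rewrite ?inE //.
    by apply: setIS; apply: subset_itvr; rewrite bnd_simp.
  - have := hd1 t ct tb; rewrite ltrBlDl => /(_ tc) /ltW /ler_normlP[_ hh].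
    have : e * (b - t) <= e * (b - c) by rewrite ler_wpM2l ?(ltW e_gt0) //; lra.
    move: h3 hh; lra.
have step t : P t -> a < t -> exists2 t', P t' & t' < t.
  move=> [/andP[at_ tb] Pt] lt_at.
  (* Inside [U], a short interval ending at [t] joins the list. Outside [U], the one-sided bound at
     [t] covers a short step with slope [e]. *)
  have [Ut|nUt] := pselect (U t).
    have /nbhs_ballP[r /= r0 hr] := open_nbhs_nbhs (conj oU Ut).
    pose h := Num.min (r / 2) (t - a).
    have h0 : 0 < h by rewrite lt_min subr_gt0 lt_at divr_gt0.
    have hr2 : h <= r / 2 by rewrite ge_min lexx.
    have hta : h <= t - a by rewrite ge_min lexx orbT.
    exists (t - h); last by lra.
    split; first by apply/andP; split; lra.
    move=> eta eta0; have [l [h1 h2 h3]] := Pt eta eta0.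
    exists ((t - h, t) :: l); split.
    - by rewrite /= lexx h1 andbT; lra.
    - rewrite big_cons /= opprB addrCA subrr addr0 EFinD.
      have dj : `]t - h, t]%classic `&` (U `&` `]t, b]%classic) = set0.
        rewrite -subset0 => x /= [].
        by rewrite !in_itv /= => /andP[_ xt] [_ /andP[/lt_le_trans /(_ xt)]]; rewrite ltxx.
      apply: (@le_trans _ _ (leb1 (`]t - h, t]%classic `|` (U `&` `]t, b]%classic)))).
        rewrite (@measureU _ _ _ leb1 _ _ (measurable_itv _) (mUI t) dj).
        apply: leeD h2; rewrite [leRHS]lebesgue_measure_itv /= lte_fin ifT ?gtrBl //.
        by rewrite -EFinD lee_fin; lra.
      apply: le_measure; rewrite ?inE //; first exact: measurableU.
      move=> x /= [|[Ux]]; rewrite !in_itv /=.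
        move=> /andP[x1 x2]; split; last by apply/andP; split; lra.
        by apply: hr; rewrite /ball /= ltr_norml; apply/andP; split; lra.
      by move=> /andP[x1 x2]; split => //; apply/andP; split; lra.
    - rewrite big_cons /=.
      have := ler_norm (Phi t - Phi (t - h)).
      have : e * (b - t) <= e * (b - (t - h)) by rewrite ler_wpM2l ?(ltW e_gt0) //; lra.
      move: h3; lra.
  have t0 : 0 < t by lra.
  have [r r0 hr] : exists2 r : R, 0 < r &
      forall h, 0 < h -> h < r -> Phi t <= Phi (t - h) + e * h.
    by apply: contrapT => nh; apply: nUt; apply: NU => /= /(_ t0 e e_gt0).
  pose h := Num.min (r / 2) (t - a).
  have h0 : 0 < h by rewrite lt_min subr_gt0 lt_at divr_gt0.
  have hr2 : h <= r / 2 by rewrite ge_min lexx.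
  have hta : h <= t - a by rewrite ge_min lexx orbT.
  exists (t - h); last by lra.
  split; first by apply/andP; split; lra.
  move=> eta eta0; have [l [h1 h2 h3]] := Pt eta eta0.
  have th : t - h <= t by lra.
  exists l; split.
  - by case: l h1 {h2 h3} => [/= /(le_trans th)|[x y] l] //= /and3P[/(le_trans th) -> -> ->].
  - apply: le_trans h2 _; apply: le_measure; rewrite ?inE //.
    by apply: setIS; apply: subset_itvr; rewrite bnd_simp.
  - have := hr h h0; have hlt : h < r by lra.
    move=> /(_ hlt); have -> : e * (b - (t - h)) = e * (b - t) + e * h by ring.
    move: h3; lra.
have ca : c = a.
  apply/eqP; rewrite eq_le ac_ andbT leNgt; apply/negP => /(step c Pc)[t Pt].
  by rewrite ltNge => /negP; apply; apply: ge_inf => //; exists a.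
move: Pc; rewrite ca => -[_ /(_ e e_gt0)[l [h1 h2 h3]]].
have /(hd l h1) hv : \sum_(p <- l) (p.2 - p.1) < d.
  rewrite -lte_fin; apply: le_lt_trans h2 _; apply: le_lt_trans hU.
  by apply: le_measure; rewrite ?inE //; exact: subIsetl.
have -> : e0 = e * (b - a) + e + e by rewrite /e; field; rewrite gt_eqF.
move: h3 hv; lra.
Qed.

End dini.

(** * Lipschitz convex approximations of the square *)

Section huber.
Context {R : realType}.
Implicit Types m s t a : R.

(* The Legendre form [huber m s = sup_(|a| <= m) (2 a s - a^2)] yields convexity, monotonicity
   in [m] and the Lipschitz bound. *)
Definition huber m s : R := 2 * trunc m s * s - trunc m s ^+ 2.

(** Since [2 a s - a^2 = s^2 - (s - a)^2], this says that [trunc m s] is the point of [[-m, m]]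
    nearest to [s]. *)
Lemma huber_sup m s a : 0 < m -> `|a| <= m -> 2 * a * s - a ^+ 2 <= huber m s.
Proof.
move=> m0 am; suff : (s - trunc m s) ^+ 2 <= (s - a) ^+ 2 by rewrite /huber; lra.
move: am; rewrite ler_norml => /andP[a1 a2].
rewrite /trunc; case: ltP => [_|]; first by rewrite subrr expr0n sqr_ge0.
have [s0|s0|->] := ltgtP s 0; last by rewrite normr0 leNgt m0.
- rewrite ltr0_norm // ltr0_sg // => ms.
  have : 0 <= (a + m) * (a - m - 2 * s) by apply: mulr_ge0; lra.
  lra.
- rewrite gtr0_norm // gtr0_sg // => ms.
  have : 0 <= (m - a) * (2 * s - m - a) by apply: mulr_ge0; lra.
  lra.
Qed.

Lemma huber_ge0 m s : 0 < m -> 0 <= huber m s.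
Proof.
by move=> m0; have := @huber_sup m s 0 m0; rewrite normr0 mulr0 mul0r expr0n subr0 => /(_ (ltW m0)).
Qed.

Lemma huber_le m s : huber m s <= s ^+ 2.
Proof. by rewrite /huber; have := sqr_ge0 (s - trunc m s); lra. Qed.

Lemma huber_id m s : `|s| < m -> huber m s = s ^+ 2.
Proof. by move=> sm; rewrite /huber trunc_id //; ring. Qed.

Lemma huber_mono m m' s : 0 < m -> m <= m' -> huber m s <= huber m' s.
Proof.
move=> m0 mm; apply: huber_sup; first exact: lt_le_trans mm.
exact: le_trans (trunc_le _ m0) mm.
Qed.

Lemma huber0 m : 0 < m -> huber m 0 = 0.
Proof. by move=> m0; rewrite huber_id ?normr0 // expr0n. Qed.

Lemma huber_convex m : 0 < m -> convex_ereal (EFin \o huber m).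
Proof.
move=> m0 x y t /andP[t0 t1]; rewrite /= -!EFinM -EFinD lee_fin.
set z := t * x + (1 - t) * y; have tm := trunc_le z m0.
have h1 := huber_sup x m0 tm; have h2 := huber_sup y m0 tm.
have h3 : t * (2 * trunc m z * x - trunc m z ^+ 2) <= t * huber m x by rewrite ler_wpM2l.
have h4 : (1 - t) * (2 * trunc m z * y - trunc m z ^+ 2) <= (1 - t) * huber m y.
  by rewrite ler_wpM2l // subr_ge0.
apply: le_trans (lerD h3 h4); rewrite /huber {2}/z le_eqVlt; apply/orP; left; apply/eqP; ring.
Qed.

Lemma huber_lip m s t : 0 < m -> `|huber m s - huber m t| <= 2 * m * `|s - t|.
Proof.
move=> m0.
have h a b : huber m a - huber m b <= 2 * m * `|a - b|.
  apply: (@le_trans _ _ (2 * trunc m a * (a - b))).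
    by have := huber_sup b m0 (trunc_le a m0); rewrite {2}/huber; lra.
  apply: le_trans (ler_norm _) _; rewrite !normrM ger0_norm //.
  by rewrite ler_wpM2r // ler_wpM2l // trunc_le.
by rewrite ler_norml h andbT lerNl opprB distrC h.
Qed.

Lemma huber_continuous m : 0 < m -> continuous (huber m).
Proof.
move=> m0 x; apply/cvgrPdist_lt => e e0; near=> y.
apply: le_lt_trans (huber_lip _ _ m0) _; rewrite mulrC -ltr_pdivlMr ?mulr_gt0 //.
near: y; exists (e / (2 * m)) => //=; by rewrite divr_gt0 ?mulr_gt0.
Unshelve. all: by end_near. Qed.

Lemma huber_lsc m : 0 < m -> lower_semicontinuous (EFin \o huber m).
Proof.
move=> m0; apply/lower_semicontinuousP => a.
rewrite (_ : [set x | _] = huber m @^-1` [set y | a < y]); last first.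
  by apply/seteqP; split => x /=; rewrite lte_fin.
by have /continuousP := huber_continuous m0; apply; exact: open_gt.
Qed.

Lemma measurable_huber m : 0 < m -> measurable_fun setT (huber m).
Proof. by move=> m0; apply: continuous_measurable_fun; exact: huber_continuous. Qed.

End huber.

(** * Monotone functionals along strong solutions *)

Section evolution.
Context {R : realType} {n : nat}.
Variable S : set 'rV[R]_n.
Hypotheses (mS : measurable S) (Sfin : (lebesgue_rV n S < +oo)%E).
Local Notation E := 'rV[R]_n.
Local Notation mu := (@lebesgue_rV R n).
Local Notation N := (L1norm S).
Variable B : (E -> R) -> (E -> R) -> Prop.
Hypothesis BL1 : forall f fhat, B f fhat -> inLp S 1 f /\ inLp S 1 fhat.
Implicit Types (f g dv dw : E -> R) (v w : R -> E -> R).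

(** Backward in time, to fit accretivity, which bounds [f - g] by [f - g + alpha (fhat - ghat)]: for
    [fhat = - v'(t)] and [alpha = h] the solution contributes [v(t) - h v'(t)], close to
    [v(t - h)]. *)
Lemma L1_derivative_left v t dv (e : R) : (forall s, 0 <= s -> inLp S 1 (v s)) ->
  0 < t -> L1_derivative S v t dv -> 0 < e ->
  exists2 d : R, 0 < d & forall h, 0 < h -> h < d -> h <= t ->
    N (fun x => v t x - h * dv x - v (t - h) x) <= e * h.
Proof.
move=> iv t0 [idv hd] e0; have [d d0 h1] := hd e e0; exists d => // h h0 hlt ht.
have it : inLp S 1 (v t) by apply: iv; exact: ltW.
have ith : inLp S 1 (v (t - h)) by apply: iv; rewrite subr_ge0.
have hn : h != 0 by rewrite gt_eqF.
have := h1 (- h); rewrite oppr_eq0 hn normrN gtr0_norm // => /(_ isT hlt).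
have iq : inLp S 1 (fun x => (- h)^-1 * (v (t - h) x - v t x) - dv x).
  by apply: (inLp1B mS) => //; apply: (inLp1Z mS); exact: inLp1B.
rewrite LnormS1_L1norm // lte_fin => hlt'.
have -> : (fun x => v t x - h * dv x - v (t - h) x) =
    (fun x => h * ((- h)^-1 * (v (t - h) x - v t x) - dv x)).
  by apply/funext => x; field.
by rewrite L1normZ // gtr0_norm // mulrC ler_wpM2r ?(ltW hlt') // ltW.
Qed.

Section monotone_functional.
Variables (v w : R -> E -> R) (v0 w0 : E -> R) (Phi : R -> R) (L : R).
Hypotheses (sv : strong_solution S B v0 v) (sw : strong_solution S B w0 w) (L0 : 0 < L).
Hypothesis Phi_lip : forall s t, 0 <= s -> 0 <= t ->
  `|Phi t - Phi s| <= L * (N (fun x => v t x - v s x) + N (fun x => w t x - w s x)).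
Hypothesis Phi_dini : forall t dv dw, 0 < t ->
  L1_derivative S v t dv -> B (v t) (fun x => - dv x) ->
  L1_derivative S w t dw -> B (w t) (fun x => - dw x) ->
  forall e, 0 < e -> exists2 d : R, 0 < d &
    forall h, 0 < h -> h < d -> Phi t <= Phi (t - h) + e * h.

Let L1_ac v1 (u1 : E -> R) (a b e : R) : strong_solution S B u1 v1 ->
  0 < a -> a <= b -> 0 < e -> exists2 d : R, 0 < d &
  forall m (s t : 'I_m -> R), (forall i, [/\ a <= s i, s i <= t i & t i <= b]) ->
    (forall i j, i != j -> t i <= s j \/ t j <= s i) ->
    \sum_(i < m) (t i - s i) < d ->
    \sum_(i < m) N (fun x => v1 (t i) x - v1 (s i) x) < e.
Proof.
move=> [iv _ ac _ _] a0 ab e0; have [d d0 hd] := ac a b e a0 ab e0.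
exists d => // m s t hst hdis hs; have := hd m s t hst hdis hs.
rewrite -lte_fin -sumEFin; congr (is_true (_ < _)%E).
apply: eq_bigr => i _; have [h1 h2 h3] := hst i.
by rewrite LnormS1_L1norm //; apply: (inLp1B mS); apply: iv; lra.
Qed.

Let L1_cvg0 v1 (u1 : E -> R) (e : R) : strong_solution S B u1 v1 -> 0 < e ->
  exists2 d : R, 0 < d & forall s, 0 <= s -> s < d -> N (fun x => v1 s x - v1 0 x) < e.
Proof.
move=> [iv ct _ _ _] e0; have [d d0 hd] := ct 0 e (lexx _) e0; exists d => // s s0 sd.
have := hd s s0; rewrite subr0 ger0_norm // => /(_ sd).
by rewrite LnormS1_L1norm ?lte_fin //; apply: (inLp1B mS); exact: iv.
Qed.

(** Through its Lipschitz bound [Phi] inherits absolute continuity on compact subintervals of the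
    positive half-line, and at almost every time both solutions are differentiable, so the one-sided
    bound applies there. *)
Lemma evolution_monotone t : 0 <= t -> Phi t <= Phi 0.
Proof.
rewrite le_eqVlt => /predU1P[<- //|t0].
have mono a b : 0 < a -> a <= b -> Phi b <= Phi a.
  apply: ac_dini_nonincreasing => [{}a {}b e a0 ab e0|].
    have eL : 0 < e / (2 * L) by rewrite divr_gt0 // mulr_gt0.
    have [d d0 hd] := L1_ac sv a0 ab eL; have [d' d'0 hd'] := L1_ac sw a0 ab eL.
    exists (Num.min d d'); first by rewrite lt_min d0.
    move=> m s s' hst hdis; rewrite lt_min => /andP[h1 h2].
    have {}h1 := hd m s s' hst hdis h1; have {}h2 := hd' m s s' hst hdis h2.
    apply: (@le_lt_trans _ _ (\sum_(i < m) L * (N (fun x => v (s' i) x - v (s i) x) +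
        N (fun x => w (s' i) x - w (s i) x)))).
      by apply: ler_sum => i _; have [i1 i2 i3] := hst i; apply: Phi_lip; lra.
    rewrite -mulr_sumr big_split /= mulrC -ltr_pdivlMr //.
    have -> : e / L = e / (2 * L) + e / (2 * L) by field; rewrite gt_eqF.
    exact: ltrD.
  have [_ _ _ av _] := sv; have [_ _ _ aw _] := sw.
  apply: (@filterS2 _ _ (ae_filter_ringOfSetsType (@lebesgue_measure R)) _ _ _ _ av aw).
  move=> s hv hw s0 e e0; have [dv h1 h2] := hv s0; have [dw h3 h4] := hw s0.
  exact: Phi_dini h1 h2 h3 h4 e e0.
(* Absolute continuity stops short of time 0; a small positive time [s] and [L^1] continuity at 0
   close the gap. *)
apply/ler_addgt0Pr => e e0; have eL : 0 < e / (2 * L) by rewrite divr_gt0 // mulr_gt0.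
have [d d0 hd] := L1_cvg0 sv eL; have [d' d'0 hd'] := L1_cvg0 sw eL.
pose s := Num.min t (Num.min d d' / 2).
have m0 : 0 < Num.min d d' by rewrite lt_min d0.
have s0 : 0 < s by rewrite lt_min t0 divr_gt0.
have st : s <= t by rewrite ge_min lexx.
have sm : s < Num.min d d'.
  by apply: (@le_lt_trans _ _ (Num.min d d' / 2)); [rewrite ge_min lexx orbT|lra].
move: sm; rewrite lt_min => /andP[sd sd'].
apply: le_trans (mono s t s0 st) _; rewrite -lerBlDl.
apply: le_trans (ler_norm _) _; apply: le_trans (Phi_lip (lexx 0) (ltW s0)) _.
rewrite mulrC -ler_pdivlMr //.
have -> : e / L = e / (2 * L) + e / (2 * L) by field; rewrite gt_eqF.
by apply: lerD; apply: ltW; [apply: hd|apply: hd'] => //; exact: ltW.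
Qed.

End monotone_functional.

End evolution.

(** * Contraction in L^2 and conservation of mass *)

Section contraction.
Context {R : realType} {n : nat}.
Variable S : set 'rV[R]_n.
Hypotheses (mS : measurable S) (Sfin : (lebesgue_rV n S < +oo)%E).
Local Notation E := 'rV[R]_n.
Local Notation mu := (@lebesgue_rV R n).
Local Notation N := (L1norm S).
Implicit Types (f g dv dw : E -> R) (v w : R -> E -> R).

Lemma inLp1_lip (j : R -> R) (L : R) f : measurable_fun setT j -> j 0 = 0 ->
  (forall s t, `|j s - j t| <= L * `|s - t|) -> inLp S 1 f ->
  inLp S 1 (fun x => j (f x)).
Proof.
move=> mj j0 jL fi; apply: (inLp1_le mS _ (inLp1Z mS L fi)).
  exact: (measurableT_comp mj fi.1).
move=> x _; have := jL (f x) 0; rewrite j0 !subr0 => /le_trans; apply.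
by rewrite normrM ler_wpM2r // ler_norm.
Qed.

Lemma Rintegral_lip (j : R -> R) (L : R) f g : measurable_fun setT j -> j 0 = 0 ->
  (forall s t, `|j s - j t| <= L * `|s - t|) -> inLp S 1 f -> inLp S 1 g ->
  `|\int[mu]_(x in S) j (f x) - \int[mu]_(x in S) j (g x)| <=
    L * N (fun x => f x - g x).
Proof.
move=> mj j0 jL fi gi; have jf := inLp1_lip mj j0 jL fi; have jg := inLp1_lip mj j0 jL gi.
have /inLp1P jf' := jf; have /inLp1P jg' := jg; have fgi := inLp1B mS fi gi.
rewrite -RintegralB //; apply: le_trans (norm_Rintegral_le mS (inLp1B mS jf jg)) _.
have /inLp1P nfg := inLp1_norm mS fgi.
rewrite /L1norm -RintegralZl //; apply: le_Rintegral_in => //.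
- exact/inLp1_norm/inLp1B.
- exact/inLp1Z/inLp1_norm.
Qed.

Variable B : (E -> R) -> (E -> R) -> Prop.
Hypothesis BL1 : forall f fhat, B f fhat -> inLp S 1 f /\ inLp S 1 fhat.

(** Accretivity compares time [t] with a backward Euler step of size [h]; the Lipschitz constant
    turns the [o(h)] error of that step in [L^1] into an [o(h)] error for the integral of [j]. *)
Lemma convex_contraction (j : R -> R) (L : R) v w (v0 w0 : E -> R) t :
  completely_accretive S B -> measurable_fun setT j -> j 0 = 0 -> (forall s, 0 <= j s) ->
  0 < L -> (forall s t, `|j s - j t| <= L * `|s - t|) ->
  convex_ereal (EFin \o j) -> lower_semicontinuous (EFin \o j) ->
  strong_solution S B v0 v -> strong_solution S B w0 w -> 0 <= t ->
  \int[mu]_(x in S) j (v t x - w t x) <= \int[mu]_(x in S) j (v 0 x - w 0 x).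
Proof.
move=> acc mj j0 jge0 L0 jL jc jl sv sw.
have [iv _ _ _ _] := sv; have [iw _ _ _ _] := sw.
apply: (evolution_monotone mS (Phi := fun t => \int[mu]_(x in S) j (v t x - w t x)) sv sw L0).
- move=> {}t s t0 s0.
  have := Rintegral_lip mj j0 jL (inLp1B mS (iv _ s0) (iw _ s0))
    (inLp1B mS (iv _ t0) (iw _ t0)).
  move=> /le_trans; apply; rewrite ler_wpM2l ?(ltW L0) //.
  have -> : (fun x => v s x - w s x - (v t x - w t x)) =
      (fun x => (v s x - v t x) + (-1) * (w s x - w t x)) by apply/funext => x; ring.
  have i1 := inLp1B mS (iv _ s0) (iv _ t0); have i2 := inLp1B mS (iw _ s0) (iw _ t0).
  apply: le_trans (L1normD mS i1 (inLp1Z mS (-1) i2)) _.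
  by rewrite L1normZ // normrN1 mul1r.
- move=> {}t dv dw t0 hv Bv hw Bw e e0.
  have eL : 0 < e / (2 * L) by rewrite divr_gt0 // mulr_gt0.
  have [d d0 hd] := L1_derivative_left mS iv t0 hv eL.
  have [d' d'0 hd'] := L1_derivative_left mS iw t0 hw eL.
  exists (Num.min t (Num.min d d')); first by rewrite !lt_min t0 d0.
  move=> h h0; rewrite !lt_min => /and3P[ht h1 h2].
  have it : inLp S 1 (v t) by apply: iv; exact: ltW.
  have iwt : inLp S 1 (w t) by apply: iw; exact: ltW.
  have ith : inLp S 1 (v (t - h)) by apply: iv; lra.
  have iwth : inLp S 1 (w (t - h)) by apply: iw; lra.
  have [_ idv] := BL1 Bv; have [_ idw] := BL1 Bw.
  pose f x := v t x - w t x + h * (- dv x - - dw x).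
  have fi : inLp S 1 f.
    by apply: (inLp1D mS); [exact: inLp1B|apply: (inLp1Z mS); exact: inLp1B].
  have gi := inLp1B mS ith iwth.
  have h3 : \int[mu]_(x in S) j (v t x - w t x) <= \int[mu]_(x in S) j (f x).
    have /inLp1P jf := inLp1_lip mj j0 jL fi.
    have /inLp1P jg := inLp1_lip mj j0 jL (inLp1B mS it iwt).
    have := acc _ _ _ _ h (EFin \o j) Bv Bw h0 (fun s => jge0 s) (congr1 EFin j0) jc jl.
    move=> /fine_le; apply; exact: integrable_fin_num.
  have := Rintegral_lip mj j0 jL fi gi => /ler_normlP[_].
  have i1 : inLp S 1 (fun x => v t x - h * dv x - v (t - h) x).
    have -> : (fun x => v t x - h * dv x - v (t - h) x) =
        (fun x => v t x - v (t - h) x + h * (- dv x)) by apply/funext => x; ring.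
    by apply: (inLp1D mS); [exact: inLp1B|exact: inLp1Z].
  have i2 : inLp S 1 (fun x => w t x - h * dw x - w (t - h) x).
    have -> : (fun x => w t x - h * dw x - w (t - h) x) =
        (fun x => w t x - w (t - h) x + h * (- dw x)) by apply/funext => x; ring.
    by apply: (inLp1D mS); [exact: inLp1B|exact: inLp1Z].
  have -> : (fun x => f x - (v (t - h) x - w (t - h) x)) =
      (fun x => (v t x - h * dv x - v (t - h) x) + (-1) * (w t x - h * dw x - w (t - h) x)).
    by apply/funext => x; rewrite /f; ring.
  have := L1normD mS i1 (inLp1Z mS (-1) i2); rewrite L1normZ // normrN1 mul1r.
  have := hd h h0 h1 (ltW ht); have := hd' h h0 h2 (ltW ht).
  set a := N _; set b := N _; set c := N _ => ha hb hc.
  have : L * c <= e * h.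
    rewrite mulrC -ler_pdivlMr //; apply: le_trans hc _.
    have -> : e * h / L = e / (2 * L) * h + e / (2 * L) * h by field; rewrite gt_eqF.
    exact: lerD.
  move: h3; lra.
Qed.

(** Equality comes from monotonicity of the integral and of its negative, with [a = 1] and [a = -1];
    the principle for two solutions is used with [w = v]. *)
Lemma integral_conserved v (v0 : E -> R) t :
  (forall f fhat, B f fhat -> \int[mu]_(x in S) fhat x = 0) ->
  strong_solution S B v0 v -> 0 <= t ->
  \int[mu]_(x in S) v t x = \int[mu]_(x in S) v 0 x.
Proof.
move=> B0 sv t0; have [iv _ _ _ _] := sv.
suff h (a : R) : `|a| = 1 -> a * \int[mu]_(x in S) v t x <= a * \int[mu]_(x in S) v 0 x.
  have := h 1 (normr1 _); have := h (-1) (normrN1 _); lra.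
move=> a1; apply: (evolution_monotone mS (Phi := fun t => a * \int[mu]_(x in S) v t x)
  sv sv ltr01) => //.
- move=> s r s0 r0; rewrite mul1r -mulrBr normrM a1 mul1r.
  have /inLp1P is_ := iv s s0; have /inLp1P ir := iv r r0.
  rewrite -RintegralB //; apply: le_trans (norm_Rintegral_le mS (inLp1B mS (iv r r0) (iv s s0))) _.
  by rewrite lerDl L1norm_ge0.
- move=> {t0}t dv _ t0 hv Bv _ _ e e0.
  have [d d0 hd] := L1_derivative_left mS iv t0 hv e0.
  exists (Num.min t d); first by rewrite lt_min t0.
  move=> h h0; rewrite lt_min => /andP[ht h1].
  have it : inLp S 1 (v t) by apply: iv; exact: ltW.
  have ith : inLp S 1 (v (t - h)) by apply: iv; lra.
  have [_ idv] := BL1 Bv; have := B0 _ _ Bv => Z.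
  have := hd h h0 h1 (ltW ht).
  have -> : (fun x => v t x - h * dv x - v (t - h) x) =
      (fun x => 1 * (v t x - v (t - h) x) + h * (- dv x)) by apply/funext => x; ring.
  have i1 := inLp1B mS it ith.
  move=> /(le_trans (norm_Rintegral_le mS (inLp1_lin mS 1 h i1 idv))).
  rewrite Rintegral_lin // Z mulr0 addr0 mul1r.
  have /inLp1P it' := it; have /inLp1P ith' := ith.
  rewrite RintegralB // => hh; rewrite -lerBlDl -mulrBr.
  by apply: le_trans (ler_norm _) _; rewrite normrM a1 mul1r.
Qed.

Lemma L2_le_huber f (M : \bar R) : inLp S 1 f ->
  (forall m : R, 0 < m -> ((\int[mu]_(x in S) huber m (f x))%:E <= M)%E) ->
  (\int[mu]_(x in S) (f x ^+ 2)%:E <= M)%E.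
Proof.
move=> fi hM.
pose g (m : nat) (x : E) : \bar R := (huber m.+1%:R (f x))%:E.
have hi (m : nat) : inLp S 1 (fun x => huber m.+1%:R (f x)).
  have m0 : (0 : R) < m.+1%:R by [].
  exact: (inLp1_lip (measurable_huber m0) (huber0 m0) (fun s t => huber_lip s t m0) fi).
have mg m : measurable_fun S (g m) by apply/measurable_EFinP; exact: (hi m).1.
have g0 m x : S x -> (0 <= g m x)%E by move=> _; rewrite lee_fin huber_ge0.
have nd x : S x -> {homo g^~ x : m k / (m <= k)%N >-> (m <= k)%E}.
  by move=> _ m k mk; rewrite lee_fin huber_mono // ler_nat.
have h' := cvg_monotone_convergence mS mg g0 nd; have h := h' mu.
have <- : limn (fun m => (\int[mu]_(x in S) g m x)%E) = (\int[mu]_(x in S) (f x ^+ 2)%:E)%E.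
  rewrite (cvg_lim _ h) //; apply: eq_integral => x _; apply: cvg_lim => //.
  apply: cvg_near_cst; exists (Num.truncn `|f x|) => // m /= fm; rewrite /g huber_id //.
  by apply: lt_le_trans (truncnS_gt _) _; rewrite ler_nat.
apply: lime_le; first by apply/cvg_ex; eexists; exact: h.
apply: nearW => m; have := hM m.+1%:R (ltr0Sn _ _); rewrite /Rintegral fineK //.
by have /inLp1P him := hi m; exact: integrable_fin_num him.
Qed.

(** The integral of the square may be infinite along [L^1] solutions, so [convex_contraction] is
    applied to the Huber functions, which increase to the square. *)
Lemma L2_contraction v w (v0 w0 : E -> R) t :
  completely_accretive S B ->
  strong_solution S B v0 v -> strong_solution S B w0 w -> 0 <= t ->
  (\int[mu]_(x in S) ((v t x - w t x) ^+ 2)%:E <=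
   \int[mu]_(x in S) ((v 0 x - w 0 x) ^+ 2)%:E)%E.
Proof.
move=> acc sv sw t0; have [iv _ _ _ _] := sv; have [iw _ _ _ _] := sw.
have i0 := inLp1B mS (iv _ (lexx _)) (iw _ (lexx _)).
apply: L2_le_huber => [|m m0]; first by apply: (inLp1B mS); [exact: iv|exact: iw].
have m20 : 0 < 2 * m by rewrite mulr_gt0.
have := convex_contraction acc (measurable_huber m0) (huber0 m0)
  (fun s => huber_ge0 s m0) m20 (fun s t => huber_lip s t m0)
  (huber_convex m0) (huber_lsc m0) sv sw t0.
rewrite -lee_fin => /le_trans; apply.
have hi := inLp1_lip (measurable_huber m0) (huber0 m0) (fun s t => huber_lip s t m0) i0.
have /inLp1P hi' := hi.
rewrite /Rintegral fineK; last exact: integrable_fin_num hi'.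
apply: ge0_le_integral => //.
- by move=> x _; rewrite lee_fin huber_ge0.
- by apply/measurable_EFinP; exact: hi.1.
- by apply/measurable_EFinP; apply: measurable_funX; exact: i0.1.
- by move=> x _; rewrite lee_fin huber_le.
Qed.

End contraction.

(** * Rescaling solutions in space and time *)

Section dilation.
Context {R : realType}.
Local Notation leb1 := (@lebesgue_measure R).

(** The measure of a dilated set scales by a positive factor. This carries differentiability at
    almost every time over to [v(k t)]. *)
Lemma lebesgue_negligible_dilation (k : R) (A : set (measurableTypeR R)) : 0 < k ->
  leb1.-negligible A -> leb1.-negligible ((fun x : measurableTypeR R => k * x) @^-1` A).
Proof.
move=> k0 [M [mM M0 AM]].
have mk : @measurable_fun _ _ (measurableTypeR R) (measurableTypeR R) setT (fun x => k * x).
  exact: measurable_funM.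
exists ((fun x : measurableTypeR R => k * x) @^-1` M); split.
- by rewrite -[X in measurable X]setTI; exact: mk.
- have h : leb1 M = mscale (NngNum (ltW k0))
      (pushforward leb1 (fun x : measurableTypeR R => (k * x) : measurableTypeR R)) M.
    move=> mk'.
    apply: lebesgue_measure_unique => //= _ [[a b]] _ <-.
    have E : (fun x : measurableTypeR R => k * x) @^-1` `]a, b]%classic = `]a / k, b / k]%classic.
      by apply/seteqP; split => x /=; rewrite !in_itv/= ltr_pdivrMr // ler_pdivlMr // mulrC.
    rewrite /mscale /= -[pushforward _ _ _]/(leb1 ((fun x : measurableTypeR R => k * x) @^-1` `]a, b]%classic)) E.
    rewrite !lebesgue_measure_itv /= !lte_fin ltr_pM2r ?invr_gt0 //.
    case: ifP => _; last by rewrite mule0.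
    by rewrite -!EFinB -EFinM; congr EFin; field; rewrite gt_eqF.
  apply/eqP; have := h mk; rewrite [LHS]M0 => /esym/eqP.
  by rewrite mule_eq0 /= eqe gt_eqF.
- by move=> x /=; exact: AM.
Qed.

End dilation.

Section time_scaling.
Context {R : realType} {n : nat}.
Variable S : set 'rV[R]_n.
Hypotheses (mS : measurable S) (Sfin : (lebesgue_rV n S < +oo)%E).
Local Notation E := 'rV[R]_n.
Local Notation mu := (@lebesgue_rV R n).
Variable B : (E -> R) -> (E -> R) -> Prop.

Let LnormS1_affine (a d e : R) (f g : E -> R) : 0 < a ->
  inLp S 1 f -> inLp S 1 g -> (LnormS S 1 (fun x => f x - g x)%R < (e / a)%:E)%E ->
  (LnormS S 1 (fun x => a * f x + d - (a * g x + d))%R < e%:E)%E.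
Proof.
move=> a0 fi gi; have fgi := inLp1B mS fi gi.
have -> : (fun x => a * f x + d - (a * g x + d)) = (fun x => a * (f x - g x)).
  by apply/funext => x; ring.
rewrite !LnormS1_L1norm ?L1normZ //; last exact: (inLp1Z mS a fgi).
by rewrite !lte_fin gtr0_norm // ltr_pdivlMr // mulrC.
Qed.

(** The derivative of [a v(k t) + d] is [a k v'(k t)], hence the factor [a k] asked of [B]; an
    operator homogeneous of degree [p - 1] provides it for [k = a^(p-2)]. *)
Lemma strong_solution_scale (a d k : R) v (v0 : E -> R) : 0 < a -> 0 < k ->
  (forall f fhat, B f fhat ->
    B (fun x => a * f x + d) (fun x => a * k * fhat x)) ->
  strong_solution S B v0 v ->
  strong_solution S B (fun x => a * v0 x + d) (fun t x => a * v (k * t) x + d).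
Proof.
move=> a0 k0 Bs [iv ct ac ae v00].
have kge0 t : 0 <= t -> 0 <= k * t by move=> t0; rewrite mulr_ge0 // ltW.
have ik t : 0 <= t -> inLp S 1 (v (k * t)) by move=> /kge0; exact: iv.
split.
- by move=> t t0; apply: (inLp1D mS); [apply: inLp1Z => //; exact: ik|exact: inLp1_cst].
- move=> t e t0 e0; have ea : 0 < e / a by rewrite divr_gt0.
  have [dl d0 hd] := ct (k * t) (e / a) (kge0 _ t0) ea.
  exists (dl / k); first by rewrite divr_gt0.
  move=> s s0 hs; apply: LnormS1_affine => //; [exact: ik|exact: ik|].
  apply: hd; first exact: kge0.
  by rewrite -mulrBr normrM gtr0_norm // mulrC -ltr_pdivlMr.
- move=> a1 b1 e a10 ab e0; have ea : 0 < e / a by rewrite divr_gt0.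
  have ka1 : 0 < k * a1 by rewrite mulr_gt0.
  have kab : k * a1 <= k * b1 by rewrite ler_pM2l.
  have [dl d0 hd] := ac _ _ (e / a) ka1 kab ea.
  exists (dl / k); first by rewrite divr_gt0.
  move=> m s t hst hdis hs.
  have h1 i : [/\ k * a1 <= k * s i, k * s i <= k * t i & k * t i <= k * b1].
    by have [? ? ?] := hst i; rewrite !ler_pM2l.
  have h2 i j : i != j -> k * t i <= k * s j \/ k * t j <= k * s i.
    by move=> /hdis; rewrite !ler_pM2l.
  have h3 : \sum_(i < m) (k * t i - k * s i) < dl.
    rewrite (eq_bigr (fun i => k * (t i - s i))); last by move=> i _; rewrite mulrBr.
    by rewrite -mulr_sumr mulrC -ltr_pdivlMr.
  have := hd m (fun i => k * s i) (fun i => k * t i) h1 h2 h3.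
  have iB i : inLp S 1 (fun x => v (k * t i) x - v (k * s i) x).
    by have [? ? ?] := hst i; apply: (inLp1B mS); apply: ik; lra.
  rewrite (eq_bigr (fun i => (L1norm S (fun x => v (k * t i) x - v (k * s i) x))%:E)); last first.
    by move=> i _; rewrite LnormS1_L1norm.
  rewrite [X in _ -> (X < _)%E](eq_bigr (fun i =>
    (a * L1norm S (fun x => v (k * t i) x - v (k * s i) x))%:E)); last first.
    move=> i _.
    have -> : (fun x => a * v (k * t i) x + d - (a * v (k * s i) x + d)) =
        (fun x => a * (v (k * t i) x - v (k * s i) x)) by apply/funext => x; ring.
    by rewrite LnormS1_L1norm ?L1normZ ?gtr0_norm //; exact: (inLp1Z mS a (iB i)).
  by rewrite !sumEFin !lte_fin -mulr_sumr ltr_pdivlMr // mulrC.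
- have := lebesgue_negligible_dilation k0 ae; apply: negligibleS => t /=.
  apply: contra_not => h t0; have [dv [idv hd] Bv] := h (mulr_gt0 k0 t0).
  exists (fun x => a * k * dv x); last first.
    have := Bs _ _ Bv; congr (B _ _).
    by apply/funext => x; rewrite mulrN.
  split; first exact: inLp1Z.
  move=> e e0; have ak0 : 0 < a * k by rewrite mulr_gt0.
  have eak : 0 < e / (a * k) by rewrite divr_gt0.
  have [dl d0 h1] := hd _ eak.
  (* The bound [|h'| < t] keeps [t + h'] positive, where [v] is known to be in [L^1]. *)
  exists (Num.min t (dl / k)); first by rewrite lt_min t0 divr_gt0.
  move=> h' hn; rewrite lt_min => /andP[ht hh].
  have kh : `|k * h'| < dl by rewrite normrM gtr0_norm // mulrC -ltr_pdivlMr.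
  have khn : k * h' != 0 by rewrite mulf_neq0 // gt_eqF.
  have := h1 _ khn kh; rewrite -mulrDr.
  move: ht; rewrite ltr_norml => /andP[ht1 ht2].
  have i1 : inLp S 1 (v (k * (t + h'))) by apply: ik; lra.
  have i2 : inLp S 1 (v (k * t)) by apply: ik; exact: ltW.
  have i3 : inLp S 1 (fun x => (k * h')^-1 * (v (k * (t + h')) x - v (k * t) x) - dv x).
    by apply: (inLp1B mS) => //; apply: (inLp1Z mS); exact: inLp1B.
  have -> : (fun x => h'^-1 * (a * v (k * (t + h')) x + d - (a * v (k * t) x + d)) - a * k * dv x) =
     (fun x => a * k * ((k * h')^-1 * (v (k * (t + h')) x - v (k * t) x) - dv x)).
    by apply/funext => x; field; rewrite hn gt_eqF.
  rewrite !LnormS1_L1norm ?L1normZ //; last exact: (inLp1Z mS (a * k) i3).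
  by rewrite !lte_fin gtr0_norm // ltr_pdivlMr // mulrC.
- by apply: filterS v00 => x h Sx; rewrite mulr0 h.
Qed.

Lemma strong_solution_cst (c : R) : B (cst c) (cst 0) ->
  strong_solution S B (cst c) (fun _ => cst c).
Proof.
move=> Bc.
have z : LnormS S 1 (fun x => (cst c : E -> R) x - cst c x) = 0%E.
  by rewrite LnormS1E (eq_integral (cst 0%E)) ?integral0 // => x _; rewrite subrr normr0.
split => //.
- by move=> t _; exact: inLp1_cst.
- by move=> t e _ e0; exists 1 => // s _ _; rewrite z lte_fin.
- move=> a b e _ _ e0; exists 1 => // m s t _ _ _.
  by rewrite big1 ?lte_fin // => i _; rewrite z.
- apply: aeW => t _.
  exists (cst 0); last first.
    by have := Bc; congr (B _ _); apply/funext => x /=; rewrite oppr0.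
  split; first exact: inLp1_cst.
  move=> e e0; exists 1 => // h _ _.
  rewrite LnormS1E (eq_integral (cst 0%E)) ?integral0 ?lte_fin // => x _ /=.
  by rewrite subrr mulr0 subr0 normr0.
- exact: aeW.
Qed.

End time_scaling.

(** A quantitative form of [a^r - 1 ~ r (a - 1)] as [a] tends to 1, with relative error [e]; the
    difference quotient in time is controlled through it. *)
Lemma powR_dilation_choice {R : realType} (r e : R) : r != 0 -> 0 < e < 1 ->
  exists a : R, [/\ 0 < a, a `^ r != 1, `|a `^ r - 1| < e &
    `|a - 1| * `|r| * (1 - e) <= `|a `^ r - 1|].
Proof.
move=> r0 /andP[e0 e1]; pose y := e / 3.
have y0 : 0 < y by rewrite divr_gt0.
have ey : e = 3 * y by rewrite /y; field.
have nr : 0 < `|r| by rewrite normr_gt0.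
(* This makes [a^r] equal to [exp(-y)] or [exp(y)] according to the sign of [r], and
   [1 + x <= exp x] gives [|a - 1| |r| <= y]. *)
pose a := expR (- (y / `|r|)).
have a1 : a < 1 by rewrite -[ltRHS]expR0 ltr_expR oppr_lt0 divr_gt0.
have ha : `|a - 1| * `|r| <= y.
  rewrite ltr0_norm ?subr_lt0 // -ler_pdivlMr // opprB lerBlDr -lerBlDl.
  by have := expR_ge1Dx (- (y / `|r|)); rewrite -/a.
have aE : a `^ r = expR (- y * Num.sg r).
  rewrite /powR gt_eqF ?expR_gt0 // expRK; congr expR.
  rewrite {1}(numEsg r); field; exact: lt0r_neq0.
exists a; rewrite expR_gt0 aE.
have hy := expR_ge1Dx y; have hNy := expR_ge1Dx (- y).
(* The product converts the lower bounds [1 + y <= exp y] and [1 - y <= exp(-y)] into upper bounds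
   for the other factor. *)
have p1 : expR y * expR (- y) = 1 by rewrite -expRD subrr expR0.
have py := expR_gt0 y; have pNy := expR_gt0 (- y).
suff [h0 h1 h2] : [/\ expR (- y * Num.sg r) != 1, `|expR (- y * Num.sg r) - 1| < e &
    y * (1 - e) <= `|expR (- y * Num.sg r) - 1|].
  by split => //; apply: le_trans h2; rewrite ler_wpM2r // subr_ge0 ltW.
have [rn|rp|/eqP] := ltgtP r 0; last by rewrite (negbTE r0).
- rewrite ltr0_sg // mulrNN mulr1; have k1 : 0 < expR y - 1 by lra.
  rewrite gtr0_norm //; split; [by apply/eqP; lra|nra|nra].
- rewrite gtr0_sg // mulr1; have k1 : expR (- y) - 1 < 0 by nra.
  rewrite ltr0_norm //; split; [by apply/eqP; lra|nra|nra].
Qed.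

(** * Square-integrable functions on a set of finite measure *)

Section L2_space.
Context {R : realType} {n : nat}.
Variable S : set 'rV[R]_n.
Hypotheses (oS : open S) (Sfin : (lebesgue_rV n S < +oo)%E).
Local Notation E := 'rV[R]_n.
Local Notation mu := (@lebesgue_rV R n).
Implicit Types (f g : E -> R).

Let mS : measurable S. Proof. exact: open_measurable_rV. Qed.

Lemma LnormS2E f : LnormS S 2 f = ((\int[mu]_(x in S) (f x ^+ 2)%:E) `^ 2^-1)%E.
Proof.
rewrite LnormS_EFinE //; congr (_ `^ _)%E; apply: eq_integral => x _.
by rewrite powR_mulrn // -normrX ger0_norm // sqr_ge0.
Qed.

Lemma integral_sqr_ge0 f : (0 <= \int[mu]_(x in S) (f x ^+ 2)%:E)%E.
Proof. by apply: integral_ge0 => x _; rewrite lee_fin sqr_ge0. Qed.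

Lemma LnormS2_le f (X : R) : 0 <= X ->
  (\int[mu]_(x in S) (f x ^+ 2)%:E <= (X ^+ 2)%:E)%E -> (LnormS S 2 f <= X%:E)%E.
Proof.
move=> X0 h; rewrite LnormS2E.
have -> : X%:E = ((X ^+ 2)%:E `^ 2^-1)%E.
  by rewrite poweR_EFin powR12_sqrt ?sqr_ge0 // sqrtr_sqr ger0_norm.
apply: gt0_ler_poweR => //; rewrite in_itv /= leey andbT ?integral_sqr_ge0 //.
by rewrite lee_fin sqr_ge0.
Qed.

Lemma LnormS2_eq f : (\int[mu]_(x in S) (f x ^+ 2)%:E < +oo)%E -> exists A : R,
  [/\ 0 <= A, LnormS S 2 f = A%:E & (\int[mu]_(x in S) (f x ^+ 2)%:E)%E = (A ^+ 2)%:E].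
Proof.
rewrite LnormS2E; have := integral_sqr_ge0 f.
case: (\int[mu]_(x in S) (f x ^+ 2)%:E)%E => [I| |] //; rewrite lee_fin => I0 _.
by exists (Num.sqrt I); rewrite sqrtr_ge0 poweR_EFin powR12_sqrt // sqr_sqrtr.
Qed.

Lemma cauchy_schwarz f g (X Y : R) : 0 <= X -> 0 <= Y ->
  measurable_fun S f -> measurable_fun S g ->
  (\int[mu]_(x in S) (f x ^+ 2)%:E <= (X ^+ 2)%:E)%E ->
  (\int[mu]_(x in S) (g x ^+ 2)%:E <= (Y ^+ 2)%:E)%E ->
  inLp S 1 (fun x => f x * g x) /\ `|\int[mu]_(x in S) (f x * g x)| <= X * Y.
Proof.
move=> X0 Y0 mf mg /(LnormS2_le X0) hX /(LnormS2_le Y0) hY.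
have two : (2 : R)^-1 + 2^-1 = 1 by field.
have h : (LnormS S 1 (fun x => f x * g x)%R <= (X * Y)%:E)%E.
  apply: le_trans (LnormS_hoelder oS mf mg (ltr0Sn _ 1) (ltr0Sn _ 1) two) _.
  by rewrite EFinM; apply: lee_pmul => //; exact: Lnorm_ge0.
have i : inLp S 1 (fun x => f x * g x).
  by split; [exact: measurable_funM|exact: le_lt_trans h (ltry _)].
split => //; apply: le_trans (norm_Rintegral_le mS i) _.
by move: h; rewrite LnormS1_L1norm.
Qed.

Lemma inLp2_inLp1 f : inLp S 2 f -> inLp S 1 f.
Proof.
move=> [mf h]; split => //; rewrite LnormS1E.
have {}h : (\int[mu]_(x in S) (f x ^+ 2)%:E < +oo)%E.
  by apply: lty_poweRy (_ : (_ `^ 2^-1 < +oo)%E); [rewrite invr_neq0|rewrite -LnormS2E].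
apply: (@le_lt_trans _ _ (\int[mu]_(x in S) ((1 : R)%:E + (f x ^+ 2)%:E))%E).
  apply: ge0_le_integral => //.
  - by apply/measurable_EFinP; exact: measurableT_comp.
  - by apply/measurable_EFinP; apply: measurable_funD => //; exact: measurable_funX.
  - move=> x _; rewrite -EFinD lee_fin -real_normK ?num_real //.
    have := sqr_ge0 (`|f x| - 1); have := normr_ge0 (f x); lra.
rewrite ge0_integralD //.
- by rewrite integral_cst // lte_add_pinfty // lte_mul_pinfty // lee_fin.
- by move=> x _; rewrite lee_fin sqr_ge0.
- by apply/measurable_EFinP; exact: measurable_funX.
Qed.

Lemma integral_sqr_subr f (c : R) : inLp S 2 f ->
  (\int[mu]_(x in S) ((f x - c) ^+ 2)%:E < +oo)%E.
Proof.
move=> [mf h].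
have {}h : (\int[mu]_(x in S) (f x ^+ 2)%:E < +oo)%E.
  by apply: lty_poweRy (_ : (_ `^ 2^-1 < +oo)%E); [rewrite invr_neq0|rewrite -LnormS2E].
apply: (@le_lt_trans _ _ (\int[mu]_(x in S) ((2 * c ^+ 2)%:E + 2%:E * (f x ^+ 2)%:E))%E).
  apply: ge0_le_integral => //.
  - by move=> x _; rewrite lee_fin sqr_ge0.
  - apply/measurable_EFinP; apply: measurable_funX.
    by apply: measurable_funB => //; exact: measurable_cst.
  - apply/measurable_EFinP; apply: measurable_funD => //.
    by apply: measurable_funM => //; exact: measurable_funX.
  - by move=> x _; rewrite -EFinM -EFinD lee_fin; have := sqr_ge0 (f x + c); lra.
have c2 : 0 <= 2 * c ^+ 2 by rewrite mulr_ge0 // sqr_ge0.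
have m2 : measurable_fun S (fun x => (f x ^+ 2)%:E).
  by apply/measurable_EFinP; exact: measurable_funX.
rewrite ge0_integralD //.
- rewrite integral_cst // ge0_integralZl //.
    by rewrite lte_add_pinfty // lte_mul_pinfty // lee_fin.
  by move=> x _; rewrite lee_fin sqr_ge0.
- by move=> x _; rewrite -EFinM lee_fin mulr_ge0 // sqr_ge0.
- exact: measurable_funeM.
Qed.

End L2_space.

(** * The Benilan-Crandall bound on the time derivative *)

Section smoothing.
Context {R : realType} {n : nat}.
Variable S : set 'rV[R]_n.
Hypotheses (oS : open S) (Sfin : (lebesgue_rV n S < +oo)%E).
Local Notation E := 'rV[R]_n.
Local Notation mu := (@lebesgue_rV R n).
Implicit Types (f g dv : E -> R) (v : R -> E -> R).

Let mS : measurable S. Proof. exact: open_measurable_rV. Qed.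

Variable B : (E -> R) -> (E -> R) -> Prop.
Variable r : R.
Hypotheses (BL1 : forall f fhat, B f fhat -> inLp S 1 f /\ inLp S 1 fhat)
  (acc : completely_accretive S B)
  (B0 : forall f fhat, B f fhat -> \int[mu]_(x in S) fhat x = 0)
  (Bc : forall d, B (cst d) (cst 0))
  (Bs : forall f fhat (a d : R), 0 < a -> B f fhat ->
     B (fun x => a * f x + d) (fun x => a * a `^ r * fhat x))
  (r0 : r != 0).
Variables (v : R -> E -> R) (v0 : E -> R) (c A : R).
Hypotheses (sv : strong_solution S B v0 v) (A0 : 0 <= A)
  (v0A : (\int[mu]_(x in S) ((v 0 x - c) ^+ 2)%:E = (A ^+ 2)%:E)%E).

Let iv t : 0 <= t -> inLp S 1 (v t). Proof. by case: sv => h _ _ _ _; exact: h. Qed.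
Let ic : inLp S 1 (cst c). Proof. exact: inLp1_cst. Qed.
Let ivc t : 0 <= t -> inLp S 1 (fun x => v t x - c).
Proof. by move=> t0; apply: (inLp1B mS) => //; exact: iv. Qed.

(** The constant [c] is itself a solution, so this is contraction against it. *)
Lemma L2_nonincreasing t : 0 <= t ->
  (\int[mu]_(x in S) ((v t x - c) ^+ 2)%:E <= (A ^+ 2)%:E)%E.
Proof.
move=> t0; rewrite -v0A.
exact: (L2_contraction mS BL1 acc sv (strong_solution_cst mS Sfin (Bc c)) t0).
Qed.

(* The rescaled solution starts at distance [|1 - a| A] from [v 0]. *)
Lemma L2_scaling_defect (a : R) t : 0 < a -> 0 <= t ->
  (\int[mu]_(x in S) ((v t x - (a * v (a `^ r * t) x + (c - a * c))) ^+ 2)%:E <=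
   ((`|1 - a| * A) ^+ 2)%:E)%E.
Proof.
move=> a0 t0; have k0 : 0 < a `^ r by rewrite powR_gt0.
have sw := strong_solution_scale mS Sfin a0 k0
  (fun f fhat => @Bs f fhat a (c - a * c) a0) sv.
apply: le_trans (L2_contraction mS BL1 acc sv sw t0) _; rewrite mulr0.
rewrite (eq_integral (fun x => (((1 - a) ^+ 2)%:E * ((v 0 x - c) ^+ 2)%:E)%E)); last first.
  by move=> x _; rewrite -EFinM; congr EFin; ring.
rewrite ge0_integralZl //.
- by rewrite v0A -EFinM lee_fin exprMn real_normK ?num_real.
- by apply/measurable_EFinP; apply: measurable_funX; exact: (ivc (lexx 0)).1.
- by move=> x _; rewrite lee_fin sqr_ge0.
- by rewrite lee_fin sqr_ge0.
Qed.

(** The increment splits into minus the scaling defect and [(1 - a) (v(a^r t) - c)]. Paired with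
    [f], each contributes at most [|1 - a| A^2] by Cauchy-Schwarz; hence the factor 2. *)
Lemma time_increment (a : R) t f : 0 < a -> 0 <= t -> measurable_fun S f ->
  (\int[mu]_(x in S) (f x ^+ 2)%:E <= (A ^+ 2)%:E)%E ->
  `|\int[mu]_(x in S) ((v (a `^ r * t) x - v t x) * f x)| <= 2 * `|1 - a| * A ^+ 2.
Proof.
move=> a0 t0 mf fA; have k0 : 0 <= a `^ r * t by rewrite mulr_ge0 // powR_ge0.
pose f1 x := v t x - (a * v (a `^ r * t) x + (c - a * c)).
have f1i : inLp S 1 f1.
  apply: (inLp1B mS); first exact: iv.
  by apply: (inLp1D mS); [apply: (inLp1Z mS); exact: iv|exact: inLp1_cst].
have aA : 0 <= `|1 - a| * A by rewrite mulr_ge0.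
have [i1 h1] := cauchy_schwarz oS aA A0 f1i.1 mf (L2_scaling_defect a0 t0) fA.
have [i2 h2] := cauchy_schwarz oS A0 A0 (ivc k0).1 mf (L2_nonincreasing k0) fA.
rewrite (_ : \int[mu]_(x in S) _ = \int[mu]_(x in S) ((-1) * (f1 x * f x) +
    (1 - a) * ((v (a `^ r * t) x - c) * f x))); last first.
  by apply: eq_Rintegral => x _; rewrite /f1; ring.
rewrite Rintegral_lin // mulN1r; apply: le_trans (ler_normD _ _) _.
rewrite normrN normrM.
have h3 : `|1 - a| * `|\int[mu]_(x in S) ((v (a `^ r * t) x - c) * f x)| <= `|1 - a| * (A * A).
  by rewrite ler_wpM2l.
move: h1 h3; rewrite expr2; lra.
Qed.

(** Boundedness of [f] lets difference quotients converging in [L^1] be paired with it. Its bound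
    [M] multiplies only a vanishing error, so the final constant involves [A] alone. *)
Lemma derivative_bound t dv f (M : R) : 0 < t -> L1_derivative S v t dv ->
  measurable_fun S f -> (forall x, `|f x| <= M) ->
  (\int[mu]_(x in S) (f x ^+ 2)%:E <= (A ^+ 2)%:E)%E ->
  `|\int[mu]_(x in S) (dv x * f x)| <= 2 / (`|r| * t) * A ^+ 2.
Proof.
move=> t0 [idv hd] mf fM fA; set X := `|_|; set K := _ * A ^+ 2.
have X0 : 0 <= X by exact: normr_ge0.
have M0 : 0 <= M by exact: le_trans (normr_ge0 _) (fM 0).
have nr : 0 < `|r| by rewrite normr_gt0.
have mul_i g : inLp S 1 g -> inLp S 1 (fun x => g x * f x) /\
    `|\int[mu]_(x in S) (g x * f x)| <= M * L1norm S g.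
  move=> gi; have /inLp1P gi' := gi.
  have i : inLp S 1 (fun x => g x * f x) by apply/inLp1P; exact: integrable_bounded_mul gi' mf fM.
  split => //; apply: le_trans (norm_Rintegral_le mS i) _.
  have Mg := inLp1Z mS M gi; rewrite -[M]ger0_norm // -L1normZ //.
  apply: (le_Rintegral_in mS (inLp1_norm mS i) (inLp1_norm mS Mg)) => x _.
  by rewrite !normrM mulrC ler_wpM2r // (ger0_norm M0).
(* The factor [1 - e] is the relative error of [powR_dilation_choice], and [M e] bounds the pairing
   of [f] with the error of the difference quotient. *)
suff h e : 0 < e < 1 -> X * (1 - e) <= K + M * e.
  apply/ler_addgt0Pr => d d0; pose e := Num.min (1 / 2) (d / (M + X + 1)).
  have D0 : 0 < M + X + 1 by lra.
  have e0 : 0 < e by rewrite lt_min; apply/andP; split; [lra|exact: divr_gt0].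
  have e1 : e <= 1 / 2 by rewrite ge_min lexx.
  have ed : e * (M + X + 1) <= d by rewrite -ler_pdivlMr // ge_min lexx orbT.
  have := h e; rewrite e0 /=; have -> : e < 1 by lra.
  move=> /(_ isT); nra.
move=> /andP[e0 e1]; have [d d0 h1] := hd e e0.
(* The step [h = (a^r - 1) t] must be shorter than [d], so [|a^r - 1|] has to stay below [d / t]. *)
pose e' := Num.min e (d / t).
have e'0 : 0 < e' by rewrite lt_min e0 divr_gt0.
have e'e : e' <= e by rewrite ge_min lexx.
have e'd : e' * t <= d by rewrite -ler_pdivlMr // ge_min lexx orbT.
have e'01 : 0 < e' < 1 by rewrite e'0 (le_lt_trans e'e).
have [a [a0 a1 a2 a3]] := powR_dilation_choice r0 e'01.
set k := a `^ r in a1 a2 a3; pose h := k * t - t.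
have k0 : 0 < k by rewrite powR_gt0.
have hE : h = (k - 1) * t by rewrite /h; ring.
have hn : h != 0 by rewrite hE mulf_neq0 ?subr_eq0 // gt_eqF.
have hN : 0 < `|h| by rewrite normr_gt0.
have hd' : `|h| < d.
  by apply: lt_le_trans e'd; rewrite hE normrM (gtr0_norm t0) ltr_pM2r.
have tk : t + h = k * t by rewrite /h; ring.
have i1 : inLp S 1 (fun x => v (k * t) x - v t x).
  by apply: (inLp1B mS); apply: iv; [rewrite mulr_ge0 ?ltW|exact: ltW].
have iq := inLp1B mS (inLp1Z mS h^-1 i1) idv.
have := h1 h hn hd'; rewrite tk LnormS1_L1norm // lte_fin => hq.
have [iqf hqf] := mul_i _ iq; have [i1f _] := mul_i _ i1.
have inc := time_increment a0 (ltW t0) mf fA.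
have XE : X <= `|h|^-1 * (2 * `|1 - a| * A ^+ 2) + M * e.
  rewrite /X (_ : \int[mu]_(x in S) _ = \int[mu]_(x in S) (h^-1 * ((v (k * t) x - v t x) * f x) +
     (-1) * ((h^-1 * (v (k * t) x - v t x) - dv x) * f x))); last first.
    by apply: eq_Rintegral => x _; ring.
  rewrite Rintegral_lin //; apply: le_trans (ler_normD _ _) _; apply: lerD.
    by rewrite normrM normfV ler_wpM2l ?invr_ge0.
  rewrite mulN1r normrN; apply: le_trans hqf _; rewrite ler_wpM2l //; exact: ltW.
have KE : `|h|^-1 * (2 * `|1 - a| * A ^+ 2) * (1 - e) <= K.
  rewrite /K -mulrA ler_pdivrMl // hE normrM (gtr0_norm t0).
  have -> : `|k - 1| * t * (2 / (`|r| * t) * A ^+ 2) = `|k - 1| * (2 * A ^+ 2) / `|r|.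
    by field; rewrite !gt_eqF.
  rewrite ler_pdivlMr //.
  have h3 : `|a - 1| * `|r| * (1 - e) <= `|k - 1|.
    by apply: le_trans a3; rewrite ler_wpM2l ?mulr_ge0 // lerB.
  have : `|a - 1| * `|r| * (1 - e) * (2 * A ^+ 2) <= `|k - 1| * (2 * A ^+ 2).
    by rewrite ler_wpM2r // mulr_ge0 // sqr_ge0.
  by rewrite (distrC 1 a); lra.
have Me : M * e * (1 - e) <= M * e by rewrite ler_piMr ?mulr_ge0 ?(ltW e0) //; lra.
have : X * (1 - e) <= (`|h|^-1 * (2 * `|1 - a| * A ^+ 2) + M * e) * (1 - e).
  by rewrite ler_wpM2r // subr_ge0 ltW.
move: KE Me; lra.
Qed.

(** As [dv] has integral 0, [c] may be subtracted from the truncation. For [|c| < k] it is fixed by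
    [trunc k], which is 1-Lipschitz, so [|trunc k v - c| <= |v - c|] and the [L^2] bound [A]
    survives truncation. *)
Lemma truncated_pairing_bound t dv (k : R) : 0 < t -> L1_derivative S v t dv ->
  B (v t) (fun x => - dv x) -> 0 < k -> `|c| < k ->
  \int[mu]_(x in S) (- dv x * trunc k (v t x)) <= 2 / (`|r| * t) * A ^+ 2.
Proof.
move=> t0 hv Bv k0 ck; have it := iv (ltW t0).
pose f x := trunc k (v t x) - c.
have mf : measurable_fun S f.
  apply: measurable_funB => //; exact: (measurableT_comp (measurable_trunc k0) it.1).
have fM x : `|f x| <= k + `|c|.
  by apply: le_trans (ler_normB _ _) _; rewrite lerD2r trunc_le.
have fA : (\int[mu]_(x in S) (f x ^+ 2)%:E <= (A ^+ 2)%:E)%E.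
  apply: le_trans (L2_nonincreasing (ltW t0)); apply: ge0_le_integral => //.
  - by move=> x _; rewrite lee_fin sqr_ge0.
  - by apply/measurable_EFinP; exact: measurable_funX.
  - by apply/measurable_EFinP; apply: measurable_funX; exact: (ivc (ltW t0)).1.
  - move=> x _; rewrite lee_fin -[leLHS]real_normK ?num_real // -[leRHS]real_normK ?num_real //.
    rewrite ler_sqr ?nnegrE //.
    by have := trunc_lip (v t x) c k0; rewrite [trunc k c]trunc_id.
have [_ ihv] := BL1 Bv; have [idv _] := hv.
have /inLp1P ihv' := ihv.
have i1 : inLp S 1 (fun x => - dv x * f x).
  by apply/inLp1P; exact: integrable_bounded_mul ihv' mf fM.
have /inLp1P idv' := idv.
have i2 : inLp S 1 (fun x => dv x * f x).
  by apply/inLp1P; exact: integrable_bounded_mul idv' mf fM.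
rewrite (_ : \int[mu]_(x in S) _ = \int[mu]_(x in S) ((-1) * (dv x * f x) + c * (- dv x))).
  rewrite Rintegral_lin // (B0 Bv) mulr0 addr0 mulN1r.
  apply: le_trans (derivative_bound t0 hv mf fM fA).
  by rewrite -normrN ler_norm.
by apply: eq_Rintegral => x _; rewrite /f; ring.
Qed.

End smoothing.

(** An interval of positive length is not contained in a null set. This supplies times of
    differentiability arbitrarily close to [t]. *)
Lemma ae_exists_right {R : realType} (P : R -> Prop) (t d : R) :
  {ae (@lebesgue_measure R), forall s : R, 0 < s -> P s} -> 0 < t -> 0 < d ->
  exists s, [/\ t < s, s < t + d & P s].
Proof.
move=> [M [mM M0 hM]] t0 d0; apply: contrapT => nh.
pose I : set (measurableTypeR R) := `]t, t + d[%classic.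
have sub : I `<=` M.
  move=> s; rewrite /I /= in_itv /= => /andP[ts std]; apply: hM => /= h; apply: nh.
  by exists s; split => //; apply: h; lra.
have mI : measurable I by exact: measurable_itv.
have : (lebesgue_measure I <= lebesgue_measure M)%E by apply: le_measure; rewrite ?inE.
rewrite [X in (_ <= X)%E]M0 /I lebesgue_measure_itv /= lte_fin ltrDl d0 -EFinD lee_fin; lra.
Qed.

Theorem corollary4p8 (R : realType) (n : nat) (S : set 'rV[R]_n) (p : R)
    (gamma : 'rV[R]_n -> R) (C : R)
    (T : R -> ('rV[R]_n -> R) -> 'rV[R]_n -> R) (u : 'rV[R]_n -> R) (t : R)
    (n_ge2 : (2 <= n)%N)
    (S_nonempty : S !=set0) (S_open : open S) (S_connected : connected S)
    (S_bounded : bounded_set S) (S_C1 : C1_domain S)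
    (p_gt1 : 1 < p) (p_neq2 : p != 2)
    (gamma_gt0 : forall x, S x -> 0 < gamma x)
    (gamma_Loo : inLp S +oo gamma)
    (gamma_L1 : inLp S 1 (fun x => gamma x `^ (1 / (1 - p))))
    (gamma_muckenhoupt : exists2 gamma0 : 'rV[R]_n -> R, muckenhoupt p gamma0 &
       {ae lebesgue_rV n, forall x, S x -> gamma0 x = gamma x})
    (Acal_completely_accretive : completely_accretive S (opAcal S p gamma))
    (Acal_m_accretive : m_accretive S (opAcal S p gamma))
    (Acal_closure : forall f fhat,
       opAcal S p gamma f fhat <-> graph_closure S (opA S p gamma) f fhat)
    (A_dense : dense_domain S (opA S p gamma))
    (T_semigroup : semigroup_of S (opAcal S p gamma) T)
    (C_poincare : poincare_constant S C)
    (u_L2 : inLp S 2 u) (t_gt0 : 0 < t) :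
  (LnormS S 1 (fun x => T t u x - mean S u)%R <=
   C%:E * Gamma0 S p gamma *
   LnormS S 2 (fun x => u x - mean S u)%R `^ (2 / p) *
   ((1 / t) `^ (1 / p))%:E)%E.
Proof.
have mS : measurable S by exact: open_measurable_rV.
have Sfin : (lebesgue_rV n S < +oo)%E by exact: bounded_lebesgue_rV.
have mgamma : measurable_fun S gamma by case: gamma_Loo.
have p0 : 0 < p by exact: lt_trans p_gt1.
have [C0 pC _] := C_poincare.
have u_L1 := inLp2_inLp1 S_open Sfin u_L2.
have [sv _] := T_semigroup u u_L1; set v := (fun t => T t u) in sv.
have [iv vct _ vae v0u] := sv.
set B := opAcal S p gamma in sv vae.
have BL1 f fhat : B f fhat -> inLp S 1 f /\ inLp S 1 fhat by case.
have B0 f fhat : B f fhat -> \int[lebesgue_rV n]_(x in S) fhat x = 0.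
  exact: (opAcal_integral0 S_open Sfin p_gt1 mgamma Acal_closure).
have Bc d : B (cst d) (cst 0).
  exact: (opAcal_cst S_open Sfin p_gt1 mgamma Acal_closure).
(* The degree [p - 1] is split as [a] times [a^(p-2)]; the second factor becomes the time
   dilation. *)
have Bs f fhat (a d : R) : 0 < a -> B f fhat ->
    B (fun x => a * f x + d) (fun x => a * a `^ (p - 2) * fhat x).
  move=> a0 Bf; have an : a != 0 by rewrite gt_eqF.
  have -> : a * a `^ (p - 2) = a `^ (p - 1).
    rewrite (_ : p - 1 = 1 + (p - 2)); last by ring.
    by rewrite [RHS]powRD ?an ?implybT // powRr1 // ltW.
  exact: (opAcal_affine S_open Sfin p_gt1 gamma_gt0 mgamma Acal_closure).
have r0 : p - 2 != 0 by rewrite subr_eq0.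
set c := mean S u.
have [A [A0 uA uA2]] := LnormS2_eq (integral_sqr_subr S_open Sfin c u_L2).
have mv0 : measurable_fun S (v 0) by case: (iv 0 (lexx _)).
have v0A : (\int[lebesgue_rV n]_(x in S) ((v 0 x - c) ^+ 2)%:E = (A ^+ 2)%:E)%E.
  rewrite -uA2; apply: ae_eq_integral => //.
  - apply/measurable_EFinP; apply: measurable_funX.
    by apply: measurable_funB => //; exact: measurable_cst.
  - apply/measurable_EFinP; apply: measurable_funX.
    by apply: measurable_funB; [exact: u_L2.1|exact: measurable_cst].
  - by apply: filterS v0u => x h Sx; rewrite h.
(* The Poincare inequality produces the mean of [v s]; conservation of mass identifies it with that
   of [u]. *)
have vmean s : 0 <= s -> mean S (v s) = c.
  move=> s0; rewrite /c /mean (integral_conserved mS BL1 B0 sv s0); congr (_ * _).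
  exact: (ae_eq_Rintegral mS mv0 u_L2.1 v0u).
have Wf := weight_fin_num gamma_L1.
set W := (X in X \is a fin_num) in Wf.
pose X s := C * (fine W * ((2 / (`|p - 2| * s) * A ^+ 2) `^ p^-1)).
have good s : 0 < s -> (exists2 dv, L1_derivative S v s dv & B (v s) (fun x => - dv x)) ->
    L1norm S (fun x => v s x - c) <= X s.
  move=> s0 [dv hv Bv].
  have := poincare_truncations S_open Sfin p_gt1 gamma_gt0 mgamma gamma_L1 C0 pC Bv
    (fun k k0 ck => truncated_pairing_bound S_open Sfin BL1 Acal_completely_accretive
      B0 Bc Bs r0 sv A0 v0A s0 hv Bv k0 ck).
  rewrite (vmean s (ltW s0)) LnormS1_L1norm.
    by rewrite -/W -(fineK Wf) -!EFinM lee_fin.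
  by apply: (inLp1B mS); [exact: iv (ltW s0)|exact: inLp1_cst].
have ct : inLp S 1 (fun=> c) by exact: inLp1_cst.
have itc : inLp S 1 (fun x => v t x - c).
  by apply: (inLp1B mS) => //; exact: iv (ltW t_gt0).
(* The bound is known at almost every time. Good times [s] are taken to the right of [t], since [X]
   is nonincreasing and thus [X s <= X t]; the distance from [v s] to [v t] is small by
   continuity. *)
have main : L1norm S (fun x => v t x - c) <= X t.
  apply/ler_addgt0Pr => e e0.
  have [d d0 hd] := vct t e (ltW t_gt0) e0.
  have [s [ts std hs]] := ae_exists_right vae t_gt0 d0.
  have s0 : 0 < s by exact: lt_trans ts.
  have its := iv s (ltW s0); have itt := iv t (ltW t_gt0).
  apply: le_trans (L1norm_tri mS itt its ct) _; rewrite addrC; apply: lerD.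
    apply: le_trans (good s s0 hs) _.
    rewrite /X ler_wpM2l ?(ltW C0) // ler_wpM2l ?fine_ge0 ?poweR_ge0 //.
    have np : 0 < `|p - 2| by rewrite normr_gt0.
    apply: ge0_ler_powR; rewrite ?invr_ge0 ?(ltW p0) ?nnegrE //.
    - by rewrite mulr_ge0 ?sqr_ge0 // divr_ge0 // mulr_ge0 // ltW.
    - by rewrite mulr_ge0 ?sqr_ge0 // divr_ge0 // mulr_ge0 // ltW.
    - rewrite ler_wpM2r ?sqr_ge0 // ler_wpM2l // lef_pV2 ?posrE ?mulr_gt0 //.
      by rewrite ler_wpM2l // ltW.
  have sd : `|s - t| < d by rewrite ger0_norm ?subr_ge0 ?(ltW ts) //; lra.
  have := hd s (ltW s0) sd; rewrite LnormS1_L1norm; last exact: (inLp1B mS its itt).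
  by rewrite lte_fin L1norm_sym => /ltW.
rewrite -/(v t) LnormS1_L1norm // uA poweR_EFin /Gamma0 -/W -(fineK Wf) -!EFinM lee_fin.
apply: le_trans main _; rewrite /X le_eqVlt; apply/orP; left; apply/eqP.
(* [A^(2/p)] is read as [(A^2)^(1/p)], and the power [1/p] in [X t] is distributed over
   [2 / |p - 2|], [A^2] and [1 / t]. *)
rewrite (_ : 2 / p = 2 * (1 / p)); last by rewrite mul1r.
rewrite (powRrM A) powR_mulrn // !div1r.
have np : 0 < `|p - 2| by rewrite normr_gt0.
have -> : 2 / (`|p - 2| * t) * A ^+ 2 = 2 / `|p - 2| * A ^+ 2 * t^-1.
  by field; rewrite !gt_eqF.
have g0 : 0 <= 2 / `|p - 2| by rewrite divr_ge0.
rewrite (@powRM _ (2 / `|p - 2| * A ^+ 2)) ?mulr_ge0 ?sqr_ge0 ?invr_ge0 ?(ltW t_gt0) //.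
by rewrite powRM ?sqr_ge0 //; ring.
Qed.
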